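(* Let $N\geq1$, let $K$ be a subfield of $\mathbb{C}$, and let $q$ be an indeterminate over $K$. Let $\xi$ be a diagonal $K[q,q^{-1}]$-point of $M_q$ such that $\eta(\xi)$ has pairwise different eigenvalues. Then the image of $\beta^\xi_{K(q)}$ coincides with $\mathcal{O}_{K(q)}(D\setminus GL_q)$.
   Context: For a commutative ring $A$ and a unit $q\in A$, $\mathcal{O}_A(M_q)$ is the unital associative $A$-algebra generated by $x_{ij}$, $1\le i,j\le N$, subject to the relations $x_{ij}x_{il}=qx_{il}x_{ij}$, $x_{ij}x_{kj}=qx_{kj}x_{ij}$, $x_{il}x_{kj}=x_{kj}x_{il}$, $x_{ij}x_{kl}-x_{kl}x_{ij}=(q-q^{-1})x_{il}x_{kj}$ whenever $i<k$ and $j<l$ (for the indices occurring in the relation). It is an $A$-bialgebra with $\Delta(x_{ij})=\sum_k x_{ik}\otimes x_{kj}$, $\varepsilon(x_{ij})=\delta_{ij}$. The quantum determinant $\det_q=\sum_{\sigma\in S_N}(-q)^{l(\sigma)}x_{1,\sigma(1)}\cdots x_{N,\sigma(N)}$ ($l(\sigma)$ the number of inversions) is central, and $\mathcal{O}_A(GL_q)=\mathcal{O}_A(M_q)[\det_q^{-1}]$ is a Hopf algebra over $A$ with comultiplication $\Delta$ and antipode $S$. In Sweedler notation, $\beta_A:\mathcal{O}_A(M_q)\to\mathcal{O}_A(M_q)\otimes_A\mathcal{O}_A(GL_q)$ is the right coaction $\beta_A(h)=\sum h_2\otimes S(h_1)h_3$. An $A$-point of $M_q$ is an $N\times N$ matrix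 $\xi$ with entries in $A$ satisfying the defining relations of $\mathcal{O}_A(M_q)$ (every diagonal matrix over $A$ is one); it determines the $A$-algebra homomorphism $\mathrm{ev}_\xi:\mathcal{O}_A(M_q)\to A$, $x_{ij}\mapsto\xi_{ij}$. The co-orbit map is $\beta_A^\xi=(\mathrm{ev}_\xi\otimes\mathrm{id})\circ\beta_A:\mathcal{O}_A(M_q)\to\mathcal{O}_A(GL_q)$. A $K[q,q^{-1}]$-point is in particular a $K(q)$-point. Let $\mathcal{O}_A(D)=A[t_1^{\pm1},\ldots,t_N^{\pm1}]$ with $\Delta(t_i)=t_i\otimes t_i$, let $\pi_D:\mathcal{O}_A(GL_q)\to\mathcal{O}_A(D)$ be the Hopf algebra homomorphism $x_{ij}\mapsto\delta_{ij}t_i$. Then $\mathcal{O}_A(D\setminus GL_q)=\{f\in\mathcal{O}_A(GL_q)\mid(\pi_D\otimes\mathrm{id})\circ\Delta(f)=1\otimes f\}$. $\eta:K[q,q^{-1}]\to K$ is the $K$-algebra homomorphism with $q\mapsto1$, and also denotes the induced map $M(N,K[q,q^{-1}])\to M(N,K)$ applied entrywise. *)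

(* Defs.v *)
From HB Require Import structures.
From mathcomp Require Import all_boot all_order perm all_algebra.
From mathcomp Require Import boolp classical_sets.

Set Implicit Arguments.
Unset Strict Implicit.
Unset Printing Implicit Defensive.

Import GRing.Theory.
Local Open Scope ring_scope.
Local Open Scope quotient_scope.

Reserved Notation "a *%: v" (at level 40).

(* Unital associative A-algebras, as rings with a central structure morphism   *)
(* A -> V.  MathComp's algType requires 1 != 0, which can fail for algebras    *)
(* given by generators and relations and for tensor products.                  *)
HB.mixin Record isPzAlgebra (A : comPzRingType) V of GRing.PzRing V := {
  algmap : A -> V;
  algmapD : {morph algmap : a b / a + b};
  algmapM : {morph algmap : a b / a * b};
  algmap1 : algmap 1 = 1;
  algmapC : forall (a : A) (v : V), algmap a * v = v * algmap a
}.

#[short(type="pzAlgType")]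
HB.structure Definition PzAlgebra (A : comPzRingType) :=
  {V of isPzAlgebra A V & GRing.PzRing V}.

Definition ascale (A : comPzRingType) (V : pzAlgType A) (a : A) (v : V) : V :=
  algmap a * v.
Notation "a *%: v" := (ascale a v) : ring_scope.

Lemma algmap0 (A : comPzRingType) (V : pzAlgType A) : algmap (0 : A) = 0 :> V.
Proof. by apply: (@addrI _ (algmap 0)); rewrite -algmapD !addr0. Qed.

Lemma ascaleAl (A : comPzRingType) (V : pzAlgType A) (a : A) (u v : V) :
  (a *%: u) * v = a *%: (u * v).
Proof. by rewrite /ascale mulrA. Qed.

Lemma ascaleAr (A : comPzRingType) (V : pzAlgType A) (a : A) (u v : V) :
  u * (a *%: v) = a *%: (u * v).
Proof. by rewrite /ascale !mulrA algmapC. Qed.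

Definition is_alg_hom (A : comPzRingType) (U V : pzAlgType A) (f : U -> V) :=
  [/\ {morph f : u v / u + v}, {morph f : u v / u * v}
    & forall a : A, f (algmap a) = algmap a].

Definition is_linear (A : comPzRingType) (U V : pzAlgType A) (f : U -> V) :=
  {morph f : u v / u + v} /\ forall (a : A) u, f (a *%: u) = a *%: f u.

HB.instance Definition _ (A : comPzRingType) := GRing.PzRing.on A^o.
HB.instance Definition _ (A : comPzRingType) :=
  @isPzAlgebra.Build A A^o (fun a => a) (fun a b => erefl) (fun a b => erefl)
    erefl (@mulrC A).

(* Algebras presented by generators and relations: terms over the generators   *)
(* modulo the smallest congruence containing the axioms of a unital            *)
(* associative A-algebra and the given relations.                              *)
Section Presentation.
Variables (A : comPzRingType) (G : Type).

Inductive term :=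
| Tgen of G
| Tcst of A
| Tadd of term & term
| Tmul of term & term.

Definition Topp s := Tmul (Tcst (-1)) s.

Variable rel : term -> term -> Prop.

Inductive cong : term -> term -> Prop :=
| cong_rel s t : rel s t -> cong s t
| cong_refl s : cong s s
| cong_sym s t : cong s t -> cong t s
| cong_trans s t u : cong s t -> cong t u -> cong s u
| cong_add s s' t t' : cong s s' -> cong t t' -> cong (Tadd s t) (Tadd s' t')
| cong_mul s s' t t' : cong s s' -> cong t t' -> cong (Tmul s t) (Tmul s' t')
| cong_addA s t u : cong (Tadd s (Tadd t u)) (Tadd (Tadd s t) u)
| cong_addC s t : cong (Tadd s t) (Tadd t s)
| cong_add0 s : cong (Tadd (Tcst 0) s) s
| cong_addN s : cong (Tadd (Topp s) s) (Tcst 0)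
| cong_mulA s t u : cong (Tmul s (Tmul t u)) (Tmul (Tmul s t) u)
| cong_mul1l s : cong (Tmul (Tcst 1) s) s
| cong_mul1r s : cong (Tmul s (Tcst 1)) s
| cong_mulDl s t u : cong (Tmul (Tadd s t) u) (Tadd (Tmul s u) (Tmul t u))
| cong_mulDr s t u : cong (Tmul s (Tadd t u)) (Tadd (Tmul s t) (Tmul s u))
| cong_cstD a b : cong (Tcst (a + b)) (Tadd (Tcst a) (Tcst b))
| cong_cstM a b : cong (Tcst (a * b)) (Tmul (Tcst a) (Tcst b))
| cong_cstC a s : cong (Tmul (Tcst a) s) (Tmul s (Tcst a)).

HB.instance Definition _ := gen_eqMixin term.
HB.instance Definition _ := gen_choiceMixin term.

Definition congb (s t : term) : bool := `[< cong s t >].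
Lemma congb_refl : reflexive congb.
Proof. by move=> s; apply/asboolP; apply: cong_refl. Qed.
Lemma congb_sym : symmetric congb.
Proof. by move=> s t; apply/asboolP/asboolP; apply: cong_sym. Qed.
Lemma congb_trans : transitive congb.
Proof.
by move=> t s u /asboolP st /asboolP tu; apply/asboolP; apply: cong_trans tu.
Qed.
Canonical congb_equiv := EquivRel congb congb_refl congb_sym congb_trans.

Definition presented := {eq_quot congb}.
HB.instance Definition _ := Choice.on presented.
HB.instance Definition _ := EqQuotient.on presented.

Lemma presentedP s t : \pi_presented s = \pi_presented t <-> cong s t.
Proof. by split=> [/eqmodP/asboolP|?]; last apply/eqmodP/asboolP. Qed.

Lemma cong_repr s : cong (repr (\pi_presented s)) s.
Proof. by apply/presentedP; rewrite reprK. Qed.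

Definition padd (x y : presented) := \pi_presented (Tadd (repr x) (repr y)).
Definition pmul (x y : presented) := \pi_presented (Tmul (repr x) (repr y)).
Definition popp (x : presented) := \pi_presented (Topp (repr x)).
Definition pcst (a : A) := \pi_presented (Tcst a).

Lemma pi_add s t : padd (\pi_presented s) (\pi_presented t) = \pi_presented (Tadd s t).
Proof. by apply/presentedP; apply: cong_add; apply: cong_repr. Qed.
Lemma pi_mul s t : pmul (\pi_presented s) (\pi_presented t) = \pi_presented (Tmul s t).
Proof. by apply/presentedP; apply: cong_mul; apply: cong_repr. Qed.
Lemma pi_opp s : popp (\pi_presented s) = \pi_presented (Topp s).
Proof.
by apply/presentedP; apply: cong_mul; [apply: cong_refl | apply: cong_repr].
Qed.

Lemma paddA : associative padd.
Proof.
elim/quotW=> x; elim/quotW=> y; elim/quotW=> z.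
rewrite (pi_add y z) (pi_add x y) !pi_add.
by apply/presentedP; apply: cong_addA.
Qed.
Lemma paddC : commutative padd.
Proof.
elim/quotW=> x; elim/quotW=> y.
by rewrite !pi_add; apply/presentedP; apply: cong_addC.
Qed.
Lemma padd0 : left_id (pcst 0) padd.
Proof.
by elim/quotW=> x; rewrite pi_add; apply/presentedP; apply: cong_add0.
Qed.
Lemma paddN : left_inverse (pcst 0) popp padd.
Proof.
elim/quotW=> x; rewrite (pi_opp x) pi_add.
by apply/presentedP; apply: cong_addN.
Qed.
Lemma pmulA : associative pmul.
Proof.
elim/quotW=> x; elim/quotW=> y; elim/quotW=> z.
rewrite (pi_mul y z) (pi_mul x y) !pi_mul.
by apply/presentedP; apply: cong_mulA.
Qed.
Lemma pmul1l : left_id (pcst 1) pmul.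
Proof.
by elim/quotW=> x; rewrite pi_mul; apply/presentedP; apply: cong_mul1l.
Qed.
Lemma pmul1r : right_id (pcst 1) pmul.
Proof.
by elim/quotW=> x; rewrite pi_mul; apply/presentedP; apply: cong_mul1r.
Qed.
Lemma pmulDl : left_distributive pmul padd.
Proof.
elim/quotW=> x; elim/quotW=> y; elim/quotW=> z.
rewrite (pi_add x y) (pi_mul x z) (pi_mul y z) pi_mul pi_add.
by apply/presentedP; apply: cong_mulDl.
Qed.
Lemma pmulDr : right_distributive pmul padd.
Proof.
elim/quotW=> x; elim/quotW=> y; elim/quotW=> z.
rewrite (pi_add y z) (pi_mul x y) (pi_mul x z) pi_mul pi_add.
by apply/presentedP; apply: cong_mulDr.
Qed.

HB.instance Definition _ :=
  GRing.isZmodule.Build presented paddA paddC padd0 paddN.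
HB.instance Definition _ := GRing.Zmodule_isPzRing.Build presented
  pmulA pmul1l pmul1r pmulDl pmulDr.

Lemma pcstD : {morph pcst : a b / a + b}.
Proof.
by move=> a b; rewrite /GRing.add /= pi_add; apply/presentedP; apply: cong_cstD.
Qed.
Lemma pcstM : {morph pcst : a b / a * b}.
Proof.
move=> a b; rewrite [in RHS]/GRing.mul /= pi_mul.
by apply/presentedP; apply: cong_cstM.
Qed.
Lemma pcstC a (x : presented) : pcst a * x = x * pcst a.
Proof.
move: x; elim/quotW=> x.
by rewrite /GRing.mul /= !pi_mul; apply/presentedP; apply: cong_cstC.
Qed.

HB.instance Definition _ :=
  isPzAlgebra.Build A presented pcstD pcstM erefl pcstC.

Definition pgen (g : G) : presented := \pi_presented (Tgen g).

End Presentation.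

Section Lift.
Variables (A : comPzRingType) (G : Type) (rel : term A G -> term A G -> Prop).
Variables (B : pzAlgType A) (f : G -> B).

Fixpoint teval (t : term A G) : B :=
  match t with
  | Tgen g => f g
  | Tcst a => algmap a
  | Tadd s t => teval s + teval t
  | Tmul s t => teval s * teval t
  end.

Definition satisfies := forall s t, rel s t -> teval s = teval t.

(* The homomorphism extending f : G -> B; it is independent of the choice of   *)
(* representatives exactly when f satisfies the relations, see plift_alg_hom   *)
(* and plift_pgen.                                                             *)
Definition plift (x : presented rel) : B := teval (repr x).

Hypothesis frel : satisfies.

Lemma teval_cong s t : cong rel s t -> teval s = teval t.
Proof.
elim=> {s t} //=.
- by move=> s t u _ -> _ ->.
- by move=> s s' t t' _ -> _ ->.
- by move=> s s' t t' _ -> _ ->.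
- by move=> s t u; rewrite addrA.
- by move=> s t; rewrite addrC.
- by move=> s; rewrite algmap0 add0r.
- move=> s; rewrite -{2}[teval s]mul1r -algmap1 -mulrDl -algmapD addNr.
  by rewrite algmap0 mul0r.
- by move=> s t u; rewrite mulrA.
- by move=> s; rewrite algmap1 mul1r.
- by move=> s; rewrite algmap1 mulr1.
- by move=> s t u; rewrite mulrDl.
- by move=> s t u; rewrite mulrDr.
- exact: algmapD.
- exact: algmapM.
- by move=> a s; rewrite algmapC.
Qed.

Lemma plift_alg_hom : is_alg_hom plift.
Proof.
split=> [x y|x y|a]; rewrite /plift.
- by rewrite [x + y]/GRing.add /= (teval_cong (cong_repr _ _)).
- by rewrite [x * y]/GRing.mul /= (teval_cong (cong_repr _ _)).
- by rewrite [algmap a in LHS]/algmap /= (teval_cong (cong_repr _ _)).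
Qed.

Lemma plift_pgen g : plift (pgen rel g) = f g.
Proof. by rewrite /plift (teval_cong (cong_repr _ _)). Qed.
End Lift.

(* The tensor product U (x)_A V: finite formal sums of pairs (u, v), modulo    *)
(* bilinearity.                                                                *)
Section Tensor.
Variables (A : comPzRingType) (U V : pzAlgType A).

Inductive tcong : seq (U * V) -> seq (U * V) -> Prop :=
| tcong_refl s : tcong s s
| tcong_sym s t : tcong s t -> tcong t s
| tcong_trans s t u : tcong s t -> tcong t u -> tcong s u
| tcong_cat s s' t t' : tcong s s' -> tcong t t' -> tcong (s ++ t) (s' ++ t')
| tcong_catC s t : tcong (s ++ t) (t ++ s)
| tcong_0l v : tcong [:: (0, v)] [::]
| tcong_Dl u u' v : tcong [:: (u + u', v)] [:: (u, v); (u', v)]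
| tcong_Dr u v v' : tcong [:: (u, v + v')] [:: (u, v); (u, v')]
| tcong_Z a u v : tcong [:: (a *%: u, v)] [:: (u, a *%: v)].

Definition tcongb (s t : seq (U * V)) : bool := `[< tcong s t >].
Lemma tcongb_refl : reflexive tcongb.
Proof. by move=> s; apply/asboolP; apply: tcong_refl. Qed.
Lemma tcongb_sym : symmetric tcongb.
Proof. by move=> s t; apply/asboolP/asboolP; apply: tcong_sym. Qed.
Lemma tcongb_trans : transitive tcongb.
Proof.
by move=> t s u /asboolP st /asboolP tu; apply/asboolP; apply: tcong_trans tu.
Qed.
Canonical tcongb_equiv := EquivRel tcongb tcongb_refl tcongb_sym tcongb_trans.

Definition tensor := {eq_quot tcongb}.
HB.instance Definition _ := Choice.on tensor.
HB.instance Definition _ := EqQuotient.on tensor.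

Lemma tensorP s t : \pi_tensor s = \pi_tensor t <-> tcong s t.
Proof. by split=> [/eqmodP/asboolP|?]; last apply/eqmodP/asboolP. Qed.

Lemma tcong_repr s : tcong (repr (\pi_tensor s)) s.
Proof. by apply/tensorP; rewrite reprK. Qed.

Definition topp_seq (s : seq (U * V)) := [seq (- p.1, p.2) | p <- s].

Definition tadd (x y : tensor) := \pi_tensor (repr x ++ repr y).
Definition topp (x : tensor) := \pi_tensor (topp_seq (repr x)).
Definition tzero := \pi_tensor [::].

Lemma pi_tadd s t : tadd (\pi s) (\pi t) = \pi_tensor (s ++ t).
Proof. by apply/tensorP; apply: tcong_cat; apply: tcong_repr. Qed.

Lemma tcong_opp s : tcong (topp_seq s ++ s) [::].
Proof.
elim: s => [|[u v] s IHs] /=; first exact: tcong_refl.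
have := tcong_cat (tcong_trans (tcong_sym (tcong_Dl (- u) u v)) _) IHs.
rewrite addNr => /(_ _ (tcong_0l v)) /=; apply: tcong_trans.
apply: (@tcong_cat [:: _] [:: _] _ _ (tcong_refl _)).
rewrite -cat1s catA -[_ :: _ ++ _]/(([:: (u, v)] ++ topp_seq s) ++ s).
by apply: tcong_cat (tcong_refl _); apply: tcong_catC.
Qed.

Lemma taddA : associative tadd.
Proof.
elim/quotW=> x; elim/quotW=> y; elim/quotW=> z.
by rewrite (pi_tadd y z) (pi_tadd x y) !pi_tadd catA.
Qed.
Lemma taddC : commutative tadd.
Proof.
elim/quotW=> x; elim/quotW=> y.
by rewrite !pi_tadd; apply/tensorP; apply: tcong_catC.
Qed.
Lemma tadd0 : left_id tzero tadd.
Proof. by elim/quotW=> x; rewrite pi_tadd. Qed.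
Lemma taddN : left_inverse tzero topp tadd.
Proof.
move=> x; rewrite -{2}[x]reprK pi_tadd.
by apply/tensorP; apply: tcong_opp.
Qed.

HB.instance Definition _ := GRing.isZmodule.Build tensor taddA taddC tadd0 taddN.

Definition tpure (u : U) (v : V) : tensor := \pi_tensor [:: (u, v)].

Lemma tpureDl u u' v : tpure (u + u') v = tpure u v + tpure u' v.
Proof.
rewrite [RHS]/GRing.add /= pi_tadd.
by apply/tensorP; apply: tcong_Dl.
Qed.
Lemma tpureDr u v v' : tpure u (v + v') = tpure u v + tpure u v'.
Proof.
rewrite [RHS]/GRing.add /= pi_tadd.
by apply/tensorP; apply: tcong_Dr.
Qed.
Lemma tpureZ a u v : tpure (a *%: u) v = tpure u (a *%: v).
Proof. by apply/tensorP; apply: tcong_Z. Qed.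

Lemma pi_tsum s : \pi_tensor s = \sum_(p <- s) tpure p.1 p.2.
Proof.
elim: s => [|[u v] s IHs]; first by rewrite big_nil.
by rewrite big_cons -IHs /= [RHS]/GRing.add /= pi_tadd.
Qed.

Lemma tensor_ind (P : tensor -> Prop) :
  P 0 -> (forall x y, P x -> P y -> P (x + y)) -> (forall u v, P (tpure u v)) ->
  forall x, P x.
Proof.
move=> P0 PD Pp; elim/quotW=> s; rewrite pi_tsum.
by elim/big_ind: _ => // p _; apply: Pp.
Qed.

(* The map induced by f : U -> V -> W; it is independent of the choice of      *)
(* representatives when f is biadditive and A-balanced, see tlift_pure.        *)
Definition tlift (W : zmodType) (f : U -> V -> W) (x : tensor) : W :=
  \sum_(p <- repr x) f p.1 p.2.

Section TLift.
Variables (W : zmodType) (f : U -> V -> W).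
Definition balanced :=
  [/\ forall u u' v, f (u + u') v = f u v + f u' v,
      forall u v v', f u (v + v') = f u v + f u v'
    & forall (a : A) u v, f (a *%: u) v = f u (a *%: v)].

Hypothesis f_bal : balanced.

Lemma tlift_pi s : tlift f (\pi s) = \sum_(p <- s) f p.1 p.2.
Proof.
have [fDl fDr fZ] := f_bal; rewrite /tlift.
move: (repr _) (tcong_repr s) => r; elim=> {r s} //=.
- by move=> s t u _ -> _ ->.
- by move=> s s' t t' _ IHs _ IHt; rewrite !big_cat /= IHs IHt.
- by move=> s t; rewrite !big_cat /= addrC.
- move=> v; rewrite big_seq1 big_nil /=.
  by apply: (@addrI _ (f 0 v)); rewrite -fDl !addr0.
- by move=> u u' v; rewrite !big_cons !big_nil /= fDl !addr0.
- by move=> u v v'; rewrite !big_cons !big_nil /= fDr !addr0.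
- by move=> a u v; rewrite !big_seq1 /= fZ.
Qed.

Lemma tlift_pure u v : tlift f (tpure u v) = f u v.
Proof. by rewrite tlift_pi big_seq1. Qed.

Lemma tlift0 : tlift f 0 = 0.
Proof. by rewrite [0 in LHS]/GRing.zero /= tlift_pi big_nil. Qed.

Lemma tliftD x y : tlift f (x + y) = tlift f x + tlift f y.
Proof.
move: x y; elim/quotW=> s; elim/quotW=> t.
by rewrite [_ + _ in LHS]/GRing.add /= pi_tadd !tlift_pi big_cat.
Qed.
End TLift.
End Tensor.

Section TensorAlgebra.
Variables (A : comPzRingType) (U V : pzAlgType A).
Local Notation T := (tensor U V).
Implicit Types x y z : T.

Definition tmulp (u : U) (v : V) (y : T) : T :=
  tlift (fun u' v' => tpure (u * u') (v * v')) y.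
Definition tmul x y : T := tlift (fun u v => tmulp u v y) x.

Lemma tmulp_bal u v : balanced (fun u' v' => tpure (u * u') (v * v') : T).
Proof.
by split=> [*|*|*]; rewrite ?mulrDr ?tpureDl ?tpureDr // !ascaleAr tpureZ.
Qed.
Lemma tmul_bal y : balanced (fun u v => tmulp u v y).
Proof.
split=> [u u' v|u v v'|a u v].
- by rewrite -big_split; apply: eq_bigr => p _; rewrite mulrDl tpureDl.
- by rewrite -big_split; apply: eq_bigr => p _; rewrite mulrDl tpureDr.
- by apply: eq_bigr => p _; rewrite !ascaleAl tpureZ.
Qed.

Lemma tmul_pure u v u' v' :
  tmul (tpure u v) (tpure u' v') = tpure (u * u') (v * v').
Proof.
rewrite /tmul (tlift_pure (tmul_bal _)) /tmulp.
by rewrite (tlift_pure (tmulp_bal _ _)).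
Qed.

Lemma tmulDl : left_distributive tmul +%R.
Proof. by move=> x y z; rewrite /tmul (tliftD (tmul_bal z)). Qed.
Lemma tmulDr : right_distributive tmul +%R.
Proof.
move=> x y z; rewrite /tmul /tlift -big_split; apply: eq_bigr => p _.
exact: (tliftD (tmulp_bal _ _)).
Qed.
Lemma tmul0l x : tmul 0 x = 0.
Proof. by apply: (@addrI _ (tmul 0 x)); rewrite -tmulDl !addr0. Qed.
Lemma tmul0r x : tmul x 0 = 0.
Proof. by apply: (@addrI _ (tmul x 0)); rewrite -tmulDr !addr0. Qed.

Lemma tmulA : associative tmul.
Proof.
move=> x y z; elim/tensor_ind: x => [|x x' IHx IHx'|u v].
- by rewrite !tmul0l.
- by rewrite !tmulDl IHx IHx'.
elim/tensor_ind: y => [|y y' IHy IHy'|u' v'].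
- by rewrite tmul0r !tmul0l tmul0r.
- by rewrite tmulDl !tmulDr tmulDl IHy IHy'.
elim/tensor_ind: z => [|z z' IHz IHz'|u2 v2].
- by rewrite !tmul0r.
- by rewrite !tmulDr IHz IHz'.
by rewrite !tmul_pure !mulrA.
Qed.
Lemma tmul1l : left_id (tpure 1 1) tmul.
Proof.
elim/tensor_ind=> [|x y IHx IHy|u v]; first exact: tmul0r.
  by rewrite tmulDr IHx IHy.
by rewrite tmul_pure !mul1r.
Qed.
Lemma tmul1r : right_id (tpure 1 1) tmul.
Proof.
elim/tensor_ind=> [|x y IHx IHy|u v]; first exact: tmul0l.
  by rewrite tmulDl IHx IHy.
by rewrite tmul_pure !mulr1.
Qed.

HB.instance Definition _ :=
  GRing.Zmodule_isPzRing.Build T tmulA tmul1l tmul1r tmulDl tmulDr.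

Definition tcst (a : A) : T := tpure (algmap a) 1.
Lemma tcstD : {morph tcst : a b / a + b}.
Proof. by move=> a b; rewrite /tcst algmapD tpureDl. Qed.
Lemma tcstM : {morph tcst : a b / a * b}.
Proof.
by move=> a b; rewrite /tcst algmapM [RHS]tmul_pure mulr1.
Qed.
Lemma tcst1 : tcst 1 = 1.
Proof. by rewrite /tcst algmap1. Qed.
Lemma tcstC a x : tcst a * x = x * tcst a.
Proof.
elim/tensor_ind: x => [|x y IHx IHy|u v]; first by rewrite mulr0 mul0r.
  by rewrite mulrDr mulrDl IHx IHy.
by rewrite /tcst [LHS]tmul_pure [RHS]tmul_pure algmapC mul1r mulr1.
Qed.

HB.instance Definition _ := isPzAlgebra.Build A T tcstD tcstM tcst1 tcstC.

End TensorAlgebra.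

Definition tmap (A : comPzRingType) (U V U' V' : pzAlgType A)
    (f : U -> U') (g : V -> V') : tensor U V -> tensor U' V' :=
  tlift (fun u v => tpure (f u) (g v)).

(* The algebra B[b^-1], for b central: B with an inverse of b adjoined.        *)
Section AdjoinInv.
Variables (A : comPzRingType) (B : pzAlgType A) (b : B).

(* Some x is the image of x : B, None is the inverse of b *)
Local Notation T := (term A (option B)).
Local Notation incl x := (Tgen A (Some x)).

Inductive adjoin_rel : T -> T -> Prop :=
| adjoin_cst a : adjoin_rel (incl (algmap a)) (Tcst _ a)
| adjoin_D x y : adjoin_rel (incl (x + y)) (Tadd (incl x) (incl y))
| adjoin_M x y : adjoin_rel (incl (x * y)) (Tmul (incl x) (incl y))
| adjoin_V : adjoin_rel (Tmul (incl b) (Tgen A None)) (Tcst _ 1)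
| adjoin_Vl : adjoin_rel (Tmul (Tgen A None) (incl b)) (Tcst _ 1).

Definition adjoin_inv := presented adjoin_rel.
HB.instance Definition _ := PzAlgebra.on adjoin_inv.

Definition adjoin_in (x : B) : adjoin_inv := pgen adjoin_rel (Some x).
Definition adjoin_invb : adjoin_inv := pgen adjoin_rel None.

(* The homomorphism which is f on B and maps the inverse of b to c. *)
Definition adjoin_lift (C : pzAlgType A) (f : B -> C) (c : C) :
    adjoin_inv -> C :=
  plift (fun g => if g is Some x then f x else c).

End AdjoinInv.

Section QuantumMatrices.
Variables (A : comUnitRingType) (q : A) (N : nat).

Section Relations.
Local Notation G := ('I_N * 'I_N)%type.
Local Notation x i j := (Tgen A (i, j)).
Local Notation "s + t" := (Tadd s t).
Local Notation "s * t" := (Tmul s t).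
Local Notation "- s" := (Topp s).
Local Notation cst a := (Tcst G a).

Inductive qmat_rel : term A G -> term A G -> Prop :=
| qmat_row (i j l : 'I_N) : (j < l)%N ->
    qmat_rel (x i j * x i l) (cst q * (x i l * x i j))
| qmat_col (i k j : 'I_N) : (i < k)%N ->
    qmat_rel (x i j * x k j) (cst q * (x k j * x i j))
| qmat_comm (i k j l : 'I_N) : (i < k)%N -> (j < l)%N ->
    qmat_rel (x i l * x k j) (x k j * x i l)
| qmat_cross (i k j l : 'I_N) : (i < k)%N -> (j < l)%N ->
    qmat_rel (x i j * x k l + - (x k l * x i j))
             (cst (q - q^-1)%R * (x i l * x k j)).
End Relations.

(* O_A(M_q) *)
Definition OM := presented qmat_rel.
HB.instance Definition _ := PzAlgebra.on OM.

Definition xM (i j : 'I_N) : OM := pgen qmat_rel (i, j).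

Definition inversions (s : 'S_N) : nat :=
  #|[set p : 'I_N * 'I_N | (p.1 < p.2)%N && (s p.2 < s p.1)%N]|.

Definition qdet : OM :=
  \sum_(s : 'S_N) ((- q) ^+ inversions s) *%: \prod_(i < N) xM i (s i).

(* O_A(GL_q) *)
Definition OGL := adjoin_inv qdet.
HB.instance Definition _ := PzAlgebra.on OGL.

Definition inGL : OM -> OGL := @adjoin_in A OM qdet.
Definition qdetV : OGL := @adjoin_invb A OM qdet.

Definition comulM : OM -> tensor OM OM :=
  plift (fun g => \sum_k tpure (xM g.1 k) (xM k g.2)).

Definition counitM : OM -> A^o := plift (fun g => (g.1 == g.2)%:R).

Definition comulGL : OGL -> tensor OGL OGL :=
  adjoin_lift (tmap inGL inGL \o comulM) (tpure qdetV qdetV).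

Definition counitGL : OGL -> A^o := adjoin_lift counitM 1.

Definition is_antipode (S : OGL -> OGL) :=
  [/\ is_linear S,
      forall h, tlift (fun h1 h2 => S h1 * h2) (comulGL h)
                  = algmap (counitGL h : A)
    & forall h, tlift (fun h1 h2 => h1 * S h2) (comulGL h)
                  = algmap (counitGL h : A)].

(* The antipode of O_A(GL_q): the only map satisfying is_antipode. *)
Definition antipode : OGL -> OGL := xget (fun=> 0) [set S | is_antipode S].

(* h |-> sum h_2 (x) S(h_1) h_3, with the iterated comultiplication taken as   *)
(* (comulM (x) id) o comulM.                                                   *)
Definition betaM (h : OM) : tensor OM OGL :=
  tlift (fun h12 h3 =>
      tlift (fun h1 h2 => tpure h2 (antipode (inGL h1) * inGL h3)) h12)
    (tmap comulM id (comulM h)).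

Definition is_point (xi : 'M[A]_N) : Prop :=
  satisfies qmat_rel (fun g => xi g.1 g.2 : A^o).

Definition ev (xi : 'M[A]_N) : OM -> A^o := plift (fun g => xi g.1 g.2 : A^o).

(* (ev_xi (x) id) o betaM, with A (x) O_A(GL_q) identified with O_A(GL_q). *)
Definition coorbit (xi : 'M[A]_N) (h : OM) : OGL :=
  tlift (fun h' g => (ev xi h' : A) *%: g) (betaM h).

(* A[t_1^{+-1}, .., t_N^{+-1}]: inl i is t_i and inr i is its inverse. *)
Inductive torus_rel : term A ('I_N + 'I_N) -> term A ('I_N + 'I_N) -> Prop :=
| torus_comm g h :
    torus_rel (Tmul (Tgen A g) (Tgen A h)) (Tmul (Tgen A h) (Tgen A g))
| torus_V i :
    torus_rel (Tmul (Tgen A (inl i)) (Tgen A (inr i))) (Tcst _ 1).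

(* O_A(D) *)
Definition OD := presented torus_rel.
HB.instance Definition _ := PzAlgebra.on OD.

Definition tD (i : 'I_N) : OD := pgen torus_rel (inl i).
Definition tDV (i : 'I_N) : OD := pgen torus_rel (inr i).

Definition piM : OM -> OD := plift (fun g => if g.1 == g.2 then tD g.1 else 0).
Definition piD : OGL -> OD := adjoin_lift piM (\prod_(i < N) tDV i).

(* O_A(D \ GL_q) *)
Definition D_coinvariants : set OGL :=
  [set f | tmap piD id (comulGL f) = tpure 1 f].

End QuantumMatrices.

Arguments coorbit {A} q {N} xi h.
Arguments D_coinvariants {A} q N.

Section LaurentPolynomials.
Variable K : fieldType.
Local Notation Kq := {fraction {poly K}}.
Local Notation "p %:F" := (@FracField.tofrac {poly K} p).

Definition qfrac : Kq := ('X : {poly K})%:F.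

Definition laurent : {pred Kq} :=
  [pred f | `[< exists p n, f = p%:F / qfrac ^+ n >]].

Lemma qfrac_neq0 : qfrac != 0.
Proof. by rewrite tofrac_eq0 polyX_eq0. Qed.

Lemma laurent_subring : subring_closed laurent.
Proof.
have q0 := qfrac_neq0.
split=> [|_ _ /asboolP[p [n ->]] /asboolP[r [m ->]]
         |_ _ /asboolP[p [n ->]] /asboolP[r [m ->]]]; apply/asboolP.
- by exists 1, 0%N; rewrite tofrac1 expr0 divr1.
- exists (p * 'X^m - r * 'X^n), (n + m)%N.
  rewrite tofracB !tofracM !tofracXn exprD -mulNr addf_div ?expf_neq0 //.
  by rewrite mulNr.
- by exists (p * r), (n + m)%N; rewrite tofracM exprD invfM mulrACA.
Qed.
HB.instance Definition _ := GRing.isSubringClosed.Build Kq laurent laurent_subring.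

(* K[q, q^-1], as a subring of K(q) *)
Record Laurent := MkLaurent { lval :> Kq; _ : lval \in laurent }.
HB.instance Definition _ := [isSub for lval].
HB.instance Definition _ := [Choice of Laurent by <:].
HB.instance Definition _ := [SubChoice_isSubComNzRing of Laurent by <:].

Definition lunit : {pred Laurent} := [pred f | `[< exists g, g * f = 1 >]].
Definition linv (f : Laurent) : Laurent :=
  if pselect (exists g, g * f = 1) is left fP then projT1 (cid fP) else f.
Lemma linvl : {in lunit, left_inverse 1 linv *%R}.
Proof.
move=> f /asboolP fP; rewrite /linv; case: pselect => // fP'.
by case: (cid fP').
Qed.
Lemma lunitP (f g : Laurent) : g * f = 1 -> f \in lunit.
Proof. by move=> gf; apply/asboolP; exists g. Qed.
Lemma linv_out : {in [predC lunit], linv =1 id}.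
Proof.
by move=> f /asboolP fP; rewrite /linv; case: pselect.
Qed.
HB.instance Definition _ :=
  GRing.ComNzRing_hasMulInverse.Build Laurent linvl lunitP linv_out.

Lemma laurentP (f : Laurent) : exists p n, lval f = p%:F / qfrac ^+ n.
Proof. by apply/asboolP; apply: (valP f). Qed.

Lemma qfrac_laurent : qfrac \in laurent.
Proof. by apply/asboolP; exists 'X, 0%N; rewrite expr0 divr1. Qed.
Definition qL : Laurent := MkLaurent qfrac_laurent.

(* The evaluation at q = 1: p / q^n |-> p(1), see etaE. *)
Definition eta (f : Laurent) : K := (projT1 (cid (laurentP f))).[1].

Lemma etaE (f : Laurent) p n : lval f = p%:F / qfrac ^+ n -> eta f = p.[1].
Proof.
rewrite /eta; case: cid => r /= [m ->] /eqP.
rewrite eqr_div ?expf_neq0 ?qfrac_neq0 //.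
rewrite -!tofracXn -!tofracM tofrac_eq => /eqP/(congr1 (horner^~ 1)).
by rewrite !hornerE !expr1n !mulr1.
Qed.

Lemma eta_qL : eta qL = 1.
Proof. by rewrite (@etaE _ 'X 0) ?hornerX // expr0 divr1. Qed.

Lemma eta_const (f : Laurent) c : lval f = (c%:P)%:F -> eta f = c.
Proof. by move=> fc; rewrite (@etaE _ c%:P 0) ?hornerC // expr0 divr1. Qed.

Lemma etaD : {morph eta : f g / f + g}.
Proof.
move=> f g; have [p [n fE]] := laurentP f; have [r [m gE]] := laurentP g.
rewrite (etaE fE) (etaE gE) (@etaE _ (p * 'X^m + r * 'X^n) (n + m)).
  by rewrite !hornerE !expr1n !mulr1.
rewrite [lval _](_ : _ = lval f + lval g) // fE gE.
rewrite tofracD !tofracM !tofracXn exprD addf_div ?expf_neq0 ?qfrac_neq0 //.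
Qed.

Lemma etaM : {morph eta : f g / f * g}.
Proof.
move=> f g; have [p [n fE]] := laurentP f; have [r [m gE]] := laurentP g.
rewrite (etaE fE) (etaE gE) (@etaE _ (p * r) (n + m)) ?hornerE //.
rewrite [lval _](_ : _ = lval f * lval g) // fE gE.
by rewrite tofracM exprD invfM mulrACA.
Qed.

End LaurentPolynomials.

Definition distinct_eigenvalues (F : fieldType) (N : nat) (M : 'M[F]_N) :=
  exists s : seq F, [/\ uniq s, size s = N & all (eigenvalue M) s].

(* Main.v *)
(* Write X for the matrix of generators in O(GL_q), Y = S(X) = X^-1 and Xi for *)
(* the diagonal matrix xi.  On words of length n the co-orbit map gives the    *)
(* entries of Y_n Xi^(x)n X_n, where X_n = X_1 ... X_n and Y_n = X_n^-1.       *)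
(* Consider the set of scalar matrices M in End(V^(x)n) such that all entries  *)
(* of Y_n M X_n lie in the image.  It is linear, and it is stable under        *)
(* multiplication by the Hecke algebra (which commutes with X_n), under        *)
(* M |-> Xi (x) M (the image is stable under the twisted adjoint action),      *)
(* under M |-> M (x) 1 and under the quantum partial trace over the innermost  *)
(* factor.  At q = 1 these operations generate every matrix unit E_KL with K   *)
(* and L rearrangements of each other: the partial trace of P_12 (Xi (x) M) is *)
(* Xi_1 M, and Lagrange interpolation at the distinct entries of eta(xi)       *)
(* separates the indices.  Lifting these units to K[q, q^-1] yields a square   *)
(* matrix that is the identity at q = 1, so its determinant is nonzero and     *)
(* over K(q) the set contains every such E_KL.  Finally O(GL_q) is spanned by  *)
(* products Y..Y X..X, and the torus coinvariance kills all of them except     *)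
(* those with balanced row indices, which are entries of Y_n E_KL X_n.         *)
From HB Require Import structures.
Require Import Defs.
From mathcomp Require Import all_boot all_order perm all_algebra.
From mathcomp Require Import boolp classical_sets reals complex.

Set Implicit Arguments.
Unset Strict Implicit.
Unset Printing Implicit Defensive.

Import GRing.Theory.
Local Open Scope ring_scope.

(** * Algebras, matrices and spans *)

(** Write X for the generators of O(GL_q) and Y for the inverse matrix, which is the image of X
    under the antipode ([xGL_inverse], [antipode_in]). All relations are used in the R-matrix form R
    X_1 X_2 = X_1 X_2 R, justified by [qmat_satisfies]. X is inverted by q-Laplace expansions of the
    determinant.

    The co-orbit map enters only through linearity, the value at 1 and the recursion [coorbit_mulx]:
    right multiplication of h by x_ij replaces the value u by the sum over k of xi_k y_ik u x_kj.
    The factors y_ik and x_kj have opposite torus weights, so all values are coinvariant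
    ([coinvariant_Im]).

    For the converse, [Phi] sends a scalar matrix M on the n-th tensor power to Y_n M X_n, and one
    asks for which M all entries lie in the image. Each closure property is an identity for [Phi]:
    [Phi_head] is the recursion, [Phi_row] and [Phi_col] are the R-matrix relation, [Phi_pre] is YX
    = 1, and [Phi_tr] rests on the quantum trace identity [qtrace]. At q = 1 these operations
    produce all matrix units E_KL with L a rearrangement of K ([classical_perm_unit]), because the
    entries of eta(xi) are distinct. [ImM_unit] carries this to K(q): invertibility of a matrix over
    K[q, q^-1] can be tested on its determinant at q = 1.

    It remains to see that coinvariants are combinations of such entries. O(GL_q) is spanned by
    products of y's followed by x's ([OGL_span]), coinvariance selects the balanced ones
    ([coinv_balanced]), and those are entries of Y_n E_KL X_n ([word_Phi]). [coorbit_image] joins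
    the two inclusions. *)

Section AlgMap.
Variables (A : comPzRingType) (V : pzAlgType A).

Lemma algmap_zmod_morphism : zmod_morphism (@algmap A V).
Proof.
move=> a b; apply: (@addIr _ (algmap b)).
by rewrite -algmapD !subrK.
Qed.
Lemma algmap_monoid_morphism : monoid_morphism (@algmap A V).
Proof. by split; [apply: algmap1 | apply: algmapM]. Qed.
HB.instance Definition _ :=
  GRing.isZmodMorphism.Build A V (@algmap A V) algmap_zmod_morphism.
HB.instance Definition _ :=
  GRing.isMonoidMorphism.Build A V (@algmap A V) algmap_monoid_morphism.
End AlgMap.

Section AlgHom.
Variables (A : comPzRingType) (U V : pzAlgType A) (f : U -> V).
Hypothesis fH : is_alg_hom f.

Lemma homD : {morph f : u v / u + v}. Proof. by case: fH. Qed.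
Lemma homM : {morph f : u v / u * v}. Proof. by case: fH. Qed.
Lemma homA a : f (algmap a) = algmap a. Proof. by case: fH. Qed.
Lemma hom0 : f 0 = 0.
Proof. by apply: (@addIr _ (f 0)); rewrite -homD !add0r. Qed.
Lemma hom1 : f 1 = 1.
Proof. by rewrite -[1](rmorph1 (@algmap A U)) homA rmorph1. Qed.
Lemma homZ a u : f (a *%: u) = a *%: f u.
Proof. by rewrite /ascale homM homA. Qed.
Lemma hom_sum I r (P : pred I) (F : I -> U) :
  f (\sum_(i <- r | P i) F i) = \sum_(i <- r | P i) f (F i).
Proof. exact: (big_morph f homD hom0). Qed.
Lemma hom_prod I r (P : pred I) (F : I -> U) :
  f (\prod_(i <- r | P i) F i) = \prod_(i <- r | P i) f (F i).
Proof. exact: (big_morph f homM hom1). Qed.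
End AlgHom.

Lemma alg_hom_comp (A : comPzRingType) (U V W : pzAlgType A)
    (g : V -> W) (f : U -> V) : is_alg_hom g -> is_alg_hom f ->
  is_alg_hom (g \o f).
Proof.
move=> [gD gM gA] [fD fM fA].
by split=> [x y|x y|a] /=; rewrite ?(fD, fM, fA) ?(gD, gM, gA).
Qed.

Lemma presented_ind (A : comPzRingType) G (rel : term A G -> term A G -> Prop)
    (P : presented rel -> Prop) :
  (forall a, P (algmap a)) -> (forall g, P (pgen rel g)) ->
  (forall x y, P x -> P y -> P (x + y)) ->
  (forall x y, P x -> P y -> P (x * y)) -> forall x, P x.
Proof.
move=> PA Pg PD PM; elim/quotW; elim=> [g|a|s Ps t Pt|s Ps t Pt].
- exact: Pg.
- exact: PA.
- by rewrite -(Defs.pi_add rel s t); apply: PD.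
- by rewrite -(Defs.pi_mul rel s t); apply: PM.
Qed.

Section FunMatrix.
Variables (B : pzRingType) (T : finType).
Implicit Types M P Q : T -> T -> B.

Lemma sum_delta_l i (F : T -> B) : \sum_k (i == k)%:R * F k = F i.
Proof.
rewrite (bigD1 i) //= eqxx mul1r big1 ?addr0 // => k.
by rewrite eq_sym => /negPf->; rewrite mul0r.
Qed.
Lemma sum_delta_r j (F : T -> B) : \sum_k F k * (k == j)%:R = F j.
Proof.
rewrite (bigD1 j) //= eqxx mulr1 big1 ?addr0 // => k.
by move=> /negPf->; rewrite mulr0.
Qed.

(* The matrices used below are indexed by multi-indices rather than ordinals.  *)
Definition mm M P : T -> T -> B := fun i j => \sum_k M i k * P k j.
Definition mid : T -> T -> B := fun i j => (i == j)%:R.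

Lemma mmA M P Q : mm (mm M P) Q = mm M (mm P Q).
Proof.
apply/funext => i; apply/funext => j; rewrite /mm.
under eq_bigr => k _ do rewrite mulr_suml.
rewrite exchange_big; apply: eq_bigr => k _; rewrite mulr_sumr.
by apply: eq_bigr => l _; rewrite mulrA.
Qed.
Lemma mm1l M : mm mid M = M.
Proof. by apply/funext => i; apply/funext => j; apply: sum_delta_l. Qed.
Lemma mm1r M : mm M mid = M.
Proof. by apply/funext => i; apply/funext => j; apply: sum_delta_r. Qed.

Lemma mm_inv_uniq M P Q : mm P M = mid -> mm M Q = mid -> P = Q.
Proof. by move=> PM MQ; rewrite -[P]mm1r -MQ -mmA PM mm1l. Qed.

Lemma mm_comm_inv c M P : mm M P = mid -> mm P M = mid ->
  mm c M = mm M c -> mm c P = mm P c.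
Proof.
move=> MP PM cM.
by rewrite -[mm c P]mm1l -PM mmA -(mmA M) -cM mmA MP mm1r.
Qed.
End FunMatrix.

Arguments mid {B T}.

Section SpanDef.
Variables (A : comPzRingType) (V : pzAlgType A).

(** Scalars act through [algmap] and multiply generators only; closure under scaling is derived in
    [lspan_scale]. *)
Inductive lspan (P : V -> Prop) : V -> Prop :=
| lspan0 : lspan P 0
| lspanD u v : lspan P u -> lspan P v -> lspan P (u + v)
| lspanZ a u : P u -> lspan P (algmap a * u).

Lemma lspan_in (P : V -> Prop) u : P u -> lspan P u.
Proof. by move=> Pu; rewrite -[u]mul1r -algmap1; apply: lspanZ. Qed.

Lemma lspan_scale (P : V -> Prop) a u : lspan P u -> lspan P (algmap a * u).
Proof.
elim=> [|v w _ IHv _ IHw|b v Pv]; first by rewrite mulr0; apply: lspan0.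
  by rewrite mulrDr; apply: lspanD.
by rewrite mulrA -algmapM; apply: lspanZ.
Qed.

Lemma lspan_sum (P : V -> Prop) I r (Q : pred I) (F : I -> V) :
  (forall i, Q i -> lspan P (F i)) -> lspan P (\sum_(i <- r | Q i) F i).
Proof. by move=> PF; elim/big_ind: _ => //; [apply: lspan0|apply: lspanD]. Qed.

Lemma lspan_mulr (P Q : V -> Prop) w u :
  (forall v, P v -> lspan Q (v * w)) -> lspan P u -> lspan Q (u * w).
Proof.
move=> PQ; elim=> [|v v' _ IHv _ IHw|b v Pv].
- by rewrite mul0r; apply: lspan0.
- by rewrite mulrDl; apply: lspanD.
- by rewrite -mulrA; apply: lspan_scale; apply: PQ.
Qed.

Lemma lspan_mull (P Q : V -> Prop) w u :
  (forall v, P v -> lspan Q (w * v)) -> lspan P u -> lspan Q (w * u).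
Proof.
move=> PQ; elim=> [|v v' _ IHv _ IHw|b v Pv].
- by rewrite mulr0; apply: lspan0.
- by rewrite mulrDr; apply: lspanD.
- by rewrite mulrA -algmapC -mulrA; apply: lspan_scale; apply: PQ.
Qed.

Lemma lspan_mul (P : V -> Prop) u v : (forall u v, P u -> P v -> P (u * v)) ->
  lspan P u -> lspan P v -> lspan P (u * v).
Proof.
move=> PM Pu Pv; apply: (lspan_mulr (P := P)) Pu => u' Pu'.
by apply: (lspan_mull (P := P)) Pv => v' Pv'; apply: lspan_in; apply: PM.
Qed.
End SpanDef.

(* Quantum R-matrix, rescaled by q so that no q^-1 occurs.                     *)
Definition rmat (A : pzRingType) (q : A) N (p r : 'I_N * 'I_N) : A :=
  ((p.2, p.1) == r)%:R * q ^+ (1 + (p.1 == p.2))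
  + (p == r)%:R * ((q ^+ 2 - 1) *+ (p.1 < p.2)%N).

Arguments rmat {A} q {N} p r.

Section Rmat.
Variables (A : comPzRingType) (q : A) (N : nat) (B : pzAlgType A).
Local Notation T := ('I_N * 'I_N)%type.

Definition cmat (T' : Type) (M : T' -> T' -> A) : T' -> T' -> B :=
  fun i j => algmap (M i j).

Lemma rmat_mull (W : T -> T -> B) p r :
  mm (cmat (rmat q)) W p r = algmap (q ^+ (1 + (p.1 == p.2))) * W (p.2, p.1) r
    + algmap ((q ^+ 2 - 1) *+ (p.1 < p.2)%N) * W p r.
Proof.
rewrite /mm /cmat /rmat.
under eq_bigr => k _.
  rewrite rmorphD !rmorphM !rmorph_nat mulrDl -!mulrA; over.
by rewrite big_split /= !sum_delta_l.
Qed.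

Lemma rmat_mulr (W : T -> T -> B) p r :
  mm W (cmat (rmat q)) p r = algmap (q ^+ (1 + (r.1 == r.2))) * W p (r.2, r.1)
    + algmap ((q ^+ 2 - 1) *+ (r.1 < r.2)%N) * W p r.
Proof.
have rmC k : rmat q k r = q ^+ (1 + (r.1 == r.2)) * (k == (r.2, r.1))%:R
    + (q ^+ 2 - 1) *+ (r.1 < r.2)%N * (k == r)%:R.
  rewrite /rmat; case: k r => [a b] [c d] /=; rewrite mulrC; congr (_ + _).
    rewrite !xpair_eqE andbC; have [->|_] := eqVneq a d; last by rewrite !mulr0.
    by have [->|_] := eqVneq b c; rewrite ?mulr0 // eq_sym.
  by rewrite mulrC; case: eqP => [[-> ->]//|_]; rewrite !mulr0.
rewrite /mm /cmat.
under eq_bigr => k _.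
  rewrite -algmapC rmC rmorphD !rmorphM !rmorph_nat mulrDl.
  have comr (b : bool) (w : B) : b%:R * w = w * b%:R.
    by rewrite -(rmorph_nat (@algmap A B)) algmapC.
  rewrite -!mulrA !comr !mulrA.
  over.
by rewrite big_split /= !sum_delta_r.
Qed.

Definition ten2 (z : 'I_N -> 'I_N -> B) : T -> T -> B :=
  fun p r => z p.1 r.1 * z p.2 r.2.

(* The defining relations of O(M_q) in R-matrix form.                          *)
Definition qrel (z : 'I_N -> 'I_N -> B) :=
  mm (cmat (rmat q)) (ten2 z) = mm (ten2 z) (cmat (rmat q)).

Lemma qrelE z : qrel z <-> forall i k j l,
  algmap (q ^+ (1 + (i == k))) * (z k j * z i l)
    + algmap ((q ^+ 2 - 1) *+ (i < k)%N) * (z i j * z k l)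
  = algmap (q ^+ (1 + (j == l))) * (z i l * z k j)
    + algmap ((q ^+ 2 - 1) *+ (j < l)%N) * (z i j * z k l).
Proof.
split=> [zR i k j l|zR].
  have := congr1 (fun M => M (i, k) (j, l)) zR.
  by rewrite rmat_mull rmat_mulr.
apply/funext => -[i k]; apply/funext => -[j l].
by rewrite rmat_mull rmat_mulr; apply: zR.
Qed.

(** The two sides of [qrelE] trade places under transposition, because [rmat] is a symmetric
    matrix. *)
Lemma qrel_tr z : qrel z -> qrel (fun i j => z j i).
Proof. by move=> /qrelE zR; apply/qrelE => i k j l; apply/esym/zR. Qed.
End Rmat.

Arguments cmat {A B T'} M i j.
Arguments ten2 {A N B} z p r.

Section QmatRel.
Variables (A : comUnitRingType) (q : A) (N : nat) (B : pzAlgType A).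
Hypothesis qU : q \is a GRing.unit.

Lemma algmap_unitI (u v : B) : algmap q * u = algmap q * v -> u = v.
Proof.
move=> /(congr1 (fun w => algmap q^-1 * w)).
by rewrite !mulrA -algmapM mulVr // algmap1 !mul1r.
Qed.

Lemma algmap_subqV : algmap (q - q^-1) = algmap q^-1 * algmap (q ^+ 2 - 1) :> B.
Proof. by rewrite -algmapM mulrBr mulr1 expr2 mulrA mulVr // mul1r. Qed.


Lemma rmat_row_eq (u v : B) :
  algmap (q ^+ 2) * u = algmap q * v + algmap (q ^+ 2 - 1) * u <->
  u = algmap q * v.
Proof.
rewrite rmorphB rmorph1 mulrBl mul1r addrCA; split=> [uv|->].
  by apply/eqP; rewrite eq_sym -subr_eq0 -(inj_eq (addrI (algmap (q ^+ 2) * u))) addr0 -uv.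
by rewrite subrr addr0.
Qed.

Lemma rmat_col_eq (u v : B) :
  algmap q * v + algmap (q ^+ 2 - 1) * u = algmap (q ^+ 2) * u <->
  u = algmap q * v.
Proof.
by split=> [/esym/rmat_row_eq|/rmat_row_eq].
Qed.

(** The entries of the R-matrix identity fall into nine cases by the order of i, k and of j, l.
    Those with one equality are the row and column relations, those with none are the commutation
    and cross relations up to the unit q, and the one with two equalities is trivial. *)
Lemma qmat_satisfies (f : 'I_N * 'I_N -> B) :
  qrel q (fun i j => f (i, j)) <-> satisfies (@qmat_rel A q N) f.
Proof.
split=> [/qrelE zR s t|fS].
  case=> {s t} [i j l jl|i k j ik|i k j l ik jl|i k j l ik jl] /=.
  - have := zR i i j l.
    rewrite eqxx ltnn jl mulr0n mulr1n rmorph0 mul0r addr0.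
    by rewrite -val_eqE (ltn_eqF jl) => /rmat_row_eq.
  - have := zR i k j j.
    rewrite eqxx ltnn ik mulr0n mulr1n rmorph0 mul0r addr0.
    by rewrite -val_eqE (ltn_eqF ik) => /rmat_col_eq.
  - have := zR i k j l.
    rewrite -!val_eqE (ltn_eqF ik) (ltn_eqF jl) ik jl => /addIr.
    by rewrite addn0 expr1 => /algmap_unitI.
  - have := zR i k l j.
    rewrite -!val_eqE (ltn_eqF ik) (gtn_eqF jl) ik (ltnNge l) (ltnW jl).
    rewrite addn0 expr1 mulr0n rmorph0 mul0r addr0 mulr1n.
    rewrite algmap_subqV -mulrA => e; apply: algmap_unitI.
    rewrite [RHS]mulrA -algmapM mulrV // algmap1 mul1r mulrDr.
    by rewrite -e rmorphN1 mulN1r mulrN addrAC subrr add0r.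
apply/qrelE => i k j l.
have row (a b c : 'I_N) (h : (b < c)%N) := fS _ _ (qmat_row q a h).
have col (a b c : 'I_N) (h : (a < b)%N) := fS _ _ (qmat_col q c h).
have comm (a b c d : 'I_N) (h : (a < b)%N) (h' : (c < d)%N) :=
  fS _ _ (qmat_comm q h h').
have cross (a b c d : 'I_N) (h : (a < b)%N) (h' : (c < d)%N) :=
  fS _ _ (qmat_cross q h h').
rewrite /= in row col comm cross.
have crossq (a b c d : 'I_N) : (a < b)%N -> (c < d)%N ->
    algmap q * (f (a, c) * f (b, d)) = algmap q * (f (b, d) * f (a, c))
      + algmap (q ^+ 2 - 1) * (f (a, d) * f (b, c)).
  move=> ab cd; have := congr1 (fun w => algmap q * w) (cross _ _ _ _ ab cd).
  rewrite algmap_subqV !mulrA -algmapM mulrV // algmap1 mul1r -!mulrA => <-.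
  by rewrite mulrDr rmorphN1 mulN1r mulrN addrCA subrr addr0.
have eqo (a b : 'I_N) : (a == b) = (a == b :> nat) by [].
case: (ltngtP i k) => ik; case: (ltngtP j l) => jl; rewrite !eqo.
all: rewrite ?(ltn_eqF ik) ?(gtn_eqF ik) ?(ltn_eqF jl) ?(gtn_eqF jl).
all: rewrite ?mulr1n ?mulr0n ?rmorph0 ?mul0r ?addr0 ?addn0 ?expr1.
- by rewrite (comm _ _ _ _ ik jl).
- by rewrite (crossq _ _ _ _ ik jl).
- by rewrite (val_inj jl) eqxx; apply/rmat_col_eq/col.
- by rewrite (crossq _ _ _ _ ik jl) (comm _ _ _ _ ik jl).
- by rewrite (comm _ _ _ _ ik jl).
- by rewrite (val_inj jl) eqxx (col _ _ _ ik) mulrA -algmapM.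
- by rewrite (val_inj ik) eqxx; apply/rmat_row_eq/row.
- by rewrite (val_inj ik) eqxx (row _ _ _ jl) [RHS]mulrA -algmapM.
- by rewrite (val_inj ik) (val_inj jl) !eqxx.
Qed.
End QmatRel.

(** * The quantum determinant *)

Section Index.
Variable N : nat.

(** Multi-indices are nested pairs, so that matrices on tensor powers are built by recursion on n
    and sums split off the first letter. *)
Fixpoint idx n : finType :=
  if n is n'.+1 then ('I_N * idx n')%type : finType else unit : finType.

Fixpoint iseq n : idx n -> seq 'I_N :=
  if n is n'.+1 return idx n -> seq 'I_N
  then fun I => I.1 :: iseq I.2 else fun=> [::].

Lemma size_iseq n (I : idx n) : size (iseq I) = n.
Proof. by elim: n I => //= n IHn [i I] /=; rewrite IHn. Qed.

Lemma iseq_inj n : injective (@iseq n).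
Proof.
by elim: n => [[] []|n IHn [i I] [j J] /= [-> /IHn->]].
Qed.

Lemma iseq_surj (s : seq 'I_N) : exists I : idx (size s), iseq I = s.
Proof.
elim: s => [|i s [I Is]]; first by exists tt.
by exists (i, I); rewrite /= Is.
Qed.

Lemma iseq_surj_size n (s : seq 'I_N) : size s = n -> exists I : idx n, iseq I = s.
Proof. by move=> <-; apply: iseq_surj. Qed.

Lemma sum_idxS (R : nmodType) n (F : idx n.+1 -> R) :
  \sum_(I : idx n.+1) F I = \sum_(i : 'I_N) \sum_(I : idx n) F (i, I).
Proof. by rewrite pair_bigA; apply: eq_bigr => -[]. Qed.

Lemma sum_idx0 (R : nmodType) (F : idx 0 -> R) : \sum_(I : idx 0) F I = F tt.
Proof. by rewrite (big_pred1 tt) // => -[]. Qed.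

Lemma sum_idx_rcons (R : nmodType) n (F : seq 'I_N -> R) :
  \sum_(I : idx n.+1) F (iseq I)
    = \sum_(i : 'I_N) \sum_(I : idx n) F (rcons (iseq I) i).
Proof.
elim: n F => [|n IHn] F; first by rewrite sum_idxS.
rewrite sum_idxS.
under eq_bigr => i _ do rewrite (IHn (fun s => F (i :: s))).
by rewrite exchange_big; apply: eq_bigr => i _; rewrite sum_idxS.
Qed.

Definition leI (i j : 'I_N) := (i <= j)%N.
Lemma leI_trans : transitive leI. Proof. by move=> a b c; apply: leq_trans. Qed.
Lemma leI_total : total leI. Proof. by move=> a b; apply: leq_total. Qed.
Lemma leI_anti : antisymmetric leI.
Proof. by move=> a b ab; apply/val_inj/anti_leq. Qed.

Lemma sort_leI s t : sorted leI t -> perm_eq t s -> sort leI s = t.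
Proof.
move=> st ts; apply: (sorted_eq leI_trans leI_anti) => //.
  exact: (sort_sorted leI_total).
by rewrite perm_sort perm_sym.
Qed.

Lemma enum_sorted : sorted leI (enum 'I_N).
Proof.
have := iota_sorted 0 N; rewrite -val_enum_ord.
by rewrite sorted_map.
Qed.

Lemma sort_uniq_full s : uniq s -> size s = N -> sort leI s = enum 'I_N.
Proof.
move=> us sN; apply: sort_leI enum_sorted _.
rewrite perm_sym uniq_perm ?enum_uniq // => i; rewrite mem_enum.
have /(uniq_min_size us): {subset s <= enum 'I_N} by move=> j; rewrite mem_enum.
by rewrite size_enum_ord sN => /(_ (leqnn _))[_ ->]; rewrite mem_enum.
Qed.

Fixpoint ninv (s : seq 'I_N) : nat :=
  if s is i :: s' then count (fun j : 'I_N => j < i)%N s' + ninv s' else 0.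

Lemma ninv_swap s (i k : 'I_N) t : (i < k)%N ->
  ninv (s ++ [:: k, i & t]) = (ninv (s ++ [:: i, k & t])).+1.
Proof.
move=> ik; elim: s => [|a s IHs] /=.
  by rewrite ik (leq_gtF (ltnW ik)) add0n add1n addSn addnCA.
by rewrite IHs addnS !count_cat /= (addnCA (k < a)%N).
Qed.
End Index.

Section QAlternating.
Variables (A : comUnitRingType) (q : A) (N : nat) (B : pzAlgType A).
Hypotheses (qU : q \is a GRing.unit) (q2U : 1 + q ^+ 2 \is a GRing.unit).

(** Coordinate functions of q-antisymmetric tensors, with conditions on adjacent letters only. *)
Definition qalt (v : seq 'I_N -> B) :=
  (forall s i t, v (s ++ [:: i, i & t]) = 0) /\
  (forall s (i k : 'I_N) t, (i < k)%N ->
    v (s ++ [:: k, i & t]) = algmap (- q) * v (s ++ [:: i, k & t])).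

Lemma qalt_cons v i : qalt v -> qalt (fun s => v (i :: s)).
Proof.
by move=> [v0 vN]; split=> [s|s j k t jk]; [apply: (v0 (i :: s))|apply: (vN (i :: s))].
Qed.

Lemma qalt_insert v i t : qalt v -> sorted (@leI N) t -> uniq t ->
  v (i :: t) = if i \in t then 0
    else algmap ((- q) ^+ count (fun j : 'I_N => j < i)%N t) * v (sort (@leI N) (i :: t)).
Proof.
elim: t v => [|j t IHt] v vA; first by rewrite /= algmap1 mul1r.
move=> st ut; have [v0 vN] := vA.
rewrite inE; have [->|ij] := eqVneq i j; first exact: (v0 [::]).
case: (ltngtP i j) => [lij|lji|/val_inj/eqP]; last by rewrite (negPf ij).
- have sit : sorted (@leI N) [:: i, j & t] by rewrite /= /leI (ltnW lij).
  have /allP tj := order_path_min (@leI_trans N) st.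
  rewrite /= [i \in t](_ : _ = false); last first.
    by apply/negP => /tj; rewrite /leI leqNgt lij.
  rewrite (_ : count _ t = 0%N) ?(leq_gtF (ltnW lij)) ?algmap1 ?mul1r.
    by rewrite (sort_leI sit).
  apply/eqP; rewrite -leqn0 leqNgt -has_count; apply/hasPn => k /tj.
  by rewrite /leI -leqNgt => /(leq_trans (ltnW lij)).
- have st' := path_sorted st; have /andP[jt ut'] := ut.
  rewrite (vN [::]) //= (IHt (fun s => v (j :: s)) (qalt_cons _ vA)) //.
  case: ifP => it; first by rewrite mulr0.
  rewrite mulrA -algmapM lji add1n exprS; congr (_ * v _).
  apply/esym/sort_leI; last first.
    rewrite perm_sym -(cat1s i) -[[:: i]]/(seq.cat [::] [:: i]).
    rewrite (perm_catCA [:: i] [:: j] t) /= perm_cons perm_sym perm_sort.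
    exact: perm_refl.
  have /allP tj := order_path_min (@leI_trans N) st.
  rewrite /= (path_min_sorted _) ?(sort_sorted (@leI_total N)) //.
  apply/allP => k; rewrite mem_sort inE => /predU1P[->|/tj//].
  exact: ltnW.
Qed.

(** Insertion sort by [qalt_insert], one factor -q for each inversion. Hence on words of length N
    the function is fixed by its value at [enum 'I_N]. *)
Lemma qalt_sort v s : qalt v ->
  v s = if uniq s then algmap ((- q) ^+ ninv s) * v (sort (@leI N) s) else 0.
Proof.
elim: s v => [|i s IHs] v vA; first by rewrite /= algmap1 mul1r.
rewrite (IHs _ (qalt_cons i vA)) /=.
case: ifP => us; last by rewrite andbF.
rewrite (qalt_insert _ vA) ?(sort_sorted (@leI_total N)) ?sort_uniq //.
rewrite mem_sort andbT; case: ifP => _; first by rewrite mulr0.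
rewrite mulrA -algmapM addnC -exprD; congr (algmap (_ ^+ (_ + _)) * v _).
  by apply/seq.permP; rewrite perm_sort.
apply/esym/sort_leI; first exact: (sort_sorted (@leI_total N)).
by rewrite perm_sort perm_cons perm_sort.
Qed.

(* The coordinates of the q-antisymmetric tensor in V^(x)N.                    *)
Definition eps (s : seq 'I_N) : A := if uniq s then (- q) ^+ ninv s else 0.

Lemma qalt_eps : qalt (fun s => algmap (eps s)).
Proof.
split=> [s i t|s i k t ik]; rewrite /eps.
  rewrite cat_uniq /= inE eqxx !andbF; exact: rmorph0.
rewrite (_ : uniq (s ++ [:: k, i & t]) = uniq (s ++ [:: i, k & t])).
  by case: ifP => _; rewrite ?rmorph0 ?mulr0 // ninv_swap // exprS algmapM.
apply: perm_uniq; rewrite perm_cat2l.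
by rewrite -(cat1s k) -(cat1s i) (perm_catCA [:: k] [:: i] t).
Qed.
End QAlternating.

Section WordMatrix.
Variables (N : nat) (B : pzRingType).
Implicit Types (z : 'I_N -> 'I_N -> B) (s t : seq 'I_N).

(** The monomial z_{s1 t1} z_{s2 t2} ..., an entry of a tensor power of z; words of different
    lengths give the default 0. *)
Fixpoint zs z s t : B :=
  match s, t with
  | [::], [::] => 1
  | i :: s, j :: t => z i j * zs z s t
  | _, _ => 0
  end.

Lemma zs_rcons z s t i j : zs z (rcons s i) (rcons t j) = zs z s t * z i j.
Proof.
elim: s t => [|a s IHs] [|b t] /=.
- by rewrite mulr1 mul1r.
- by case: t => [|c t] /=; rewrite mulr0 mul0r.
- by case: s {IHs} => [|c s] /=; rewrite mulr0 mul0r.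
- by rewrite IHs mulrA.
Qed.

(** Coordinate s of the n-th tensor power of z applied to the tensor with coordinates e. *)
Definition wsum z n (e : seq 'I_N -> B) s : B :=
  \sum_(J : idx N n) zs z s (iseq J) * e (iseq J).

Lemma wsum_cons z n e i s :
  wsum z n.+1 e (i :: s) = \sum_j z i j * wsum z n (fun t => e (j :: t)) s.
Proof.
rewrite /wsum sum_idxS; apply: eq_bigr => j _; rewrite mulr_sumr.
by apply: eq_bigr => J _; rewrite /= mulrA.
Qed.
Lemma wsum_cons0 z e i s : wsum z 0 e (i :: s) = 0.
Proof. by rewrite /wsum sum_idx0 mul0r. Qed.
End WordMatrix.

Lemma zs_tr (N : nat) (B : pzRingType) (z : 'I_N -> 'I_N -> B) s t :
  zs (fun i j => z j i) s t = zs z t s.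
Proof. by elim: s t => [|i s IHs] [|j t] //=; rewrite IHs. Qed.

Section QuantumDet.
Variables (A : comUnitRingType) (q : A) (N : nat) (B : pzAlgType A).
Hypotheses (qU : q \is a GRing.unit) (q2U : 1 + q ^+ 2 \is a GRing.unit).
Implicit Types (z : 'I_N -> 'I_N -> B) (e : seq 'I_N -> B).

(** On degree-two tensors, q-antisymmetry is the eigenvector equation of [rmat] for the eigenvalue
    -1 (the other one is q^2). At a repeated index it reads (1 + q^2) w = 0, which is where [q2U]
    enters. *)
Lemma qalt_pair (w : 'I_N * 'I_N -> B) :
  (forall p, \sum_r algmap (rmat q p r) * w r = - w p) <->
  (forall i, w (i, i) = 0) /\
  (forall i k : 'I_N, (i < k)%N -> w (k, i) = algmap (- q) * w (i, k)).
Proof.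
have E p : \sum_r algmap (rmat q p r) * w r
    = algmap (q ^+ (1 + (p.1 == p.2))) * w (p.2, p.1)
      + algmap ((q ^+ 2 - 1) *+ (p.1 < p.2)%N) * w p.
  exact: (rmat_mull q (fun r _ => w r) p p).
split=> [wR|[w0 wN] [i k]].
  split=> [i|i k ik].
    have := wR (i, i); rewrite E /= eqxx ltnn rmorph0 mul0r addr0 => /eqP.
    rewrite -subr_eq0 opprK addrC -[X in X + _]mul1r -algmap1 -mulrDl -algmapD.
    move/eqP/(congr1 (fun u => algmap (1 + q ^+ 2)^-1 * u)).
    by rewrite mulr0 mulrA -algmapM mulVr // algmap1 mul1r.
  have := wR (i, k); rewrite E /= -val_eqE (ltn_eqF ik) ik mulr1n expr1.
  rewrite rmorphB rmorph1 mulrBl mul1r addrA => /(canRL (subrK _)).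
  rewrite addNr => /eqP; rewrite addr_eq0 => /eqP e.
  apply: (algmap_unitI qU); rewrite e mulrA -algmapM.
  by rewrite mulrN -expr2 rmorphN mulNr.
rewrite E /=; case: (ltngtP i k) => [ik|ki|/val_inj->].
- rewrite -val_eqE (ltn_eqF ik) expr1 mulr1n (wN _ _ ik) mulrA -algmapM.
  rewrite mulrN -expr2 rmorphB rmorph1 mulrBl mul1r rmorphN mulNr.
  by rewrite addrA addNr add0r.
- rewrite -val_eqE (gtn_eqF ki) expr1 rmorph0 mul0r addr0 (wN _ _ ki).
  by rewrite rmorphN mulNr opprK.
- by rewrite eqxx w0 !mulr0 addr0 oppr0.
Qed.

(** R commutes with z (x) z, so z (x) z preserves the -1 eigenspace of R. Letters before the
    adjacent pair are peeled off by induction, letters after it are absorbed in the vector. *)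
Lemma wsum_qalt z n e : qrel q z -> qalt q e -> qalt q (wsum z n e).
Proof.
move=> zR; suff H s : forall n e, qalt q e ->
    (forall i t, wsum z n e (s ++ [:: i, i & t]) = 0) /\
    (forall (i k : 'I_N) t, (i < k)%N -> wsum z n e (s ++ [:: k, i & t])
                       = algmap (- q) * wsum z n e (s ++ [:: i, k & t])).
  by move=> eA; split=> [s|s]; have [] := H s n e eA.
elim: s => [|a s IHs] {}n {}e eA; last first.
  case: n => [|n] /=; first by split=> *; rewrite !wsum_cons0 ?mulr0.
  split=> [i t|i k t ik]; rewrite !wsum_cons.
    by rewrite big1 // => j _; rewrite (IHs n _ (qalt_cons j eA)).1 mulr0.
  rewrite mulr_sumr; apply: eq_bigr => j _.
  by rewrite (IHs n _ (qalt_cons j eA)).2 // !mulrA algmapC.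
case: n => [|[|n]] /=.
- by split=> *; rewrite !wsum_cons0 ?mulr0.
- split=> [i t|i k t ik]; rewrite !wsum_cons.
    by rewrite big1 // => j _; rewrite wsum_cons0 mulr0.
  by rewrite !big1 ?mulr0 // => j _; rewrite wsum_cons0 mulr0.
suff H t : (forall i, wsum z n.+2 e [:: i, i & t] = 0) /\
    (forall i k : 'I_N, (i < k)%N -> wsum z n.+2 e [:: k, i & t]
                       = algmap (- q) * wsum z n.+2 e [:: i, k & t]).
  by split=> [i t|i k t]; [apply: (H t).1 | apply: (H t).2].
pose w p := wsum z n.+2 e [:: p.1, p.2 & t].
(* [w'] applies only the factors after the pair, so that [w] is z (x) z applied to [w']. *)
pose w' p := wsum z n (fun u => e [:: p.1, p.2 & u]) t.
have wE p : w p = \sum_r ten2 z p r * w' r.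
  rewrite /w wsum_cons; under eq_bigr => j _ do rewrite wsum_cons mulr_sumr.
  by rewrite pair_bigA; apply: eq_bigr => -[j l] _; rewrite mulrA.
have w'A : forall p, \sum_r algmap (rmat q p r) * w' r = - w' p.
  have [e0 eN] := eA.
  apply/qalt_pair; split=> [i|i k ik]; rewrite /w' /wsum.
    by rewrite big1 // => J _; rewrite (e0 [::]) mulr0.
  rewrite mulr_sumr; apply: eq_bigr => J _.
  by rewrite (eN [::] _ _ _ ik) !mulrA algmapC.
suff : forall p, \sum_r algmap (rmat q p r) * w r = - w p by move/qalt_pair.
move=> p; under eq_bigr => r _ do rewrite wE mulr_sumr.
rewrite exchange_big /=.
under eq_bigr => r _ do under eq_bigr => s _ do rewrite mulrA.
transitivity (\sum_r mm (cmat (rmat q)) (ten2 z) p r * w' r).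
  by apply: eq_bigr => r _; rewrite -mulr_suml.
rewrite zR; under eq_bigr => r _ do rewrite mulr_suml.
rewrite exchange_big wE -sumrN; apply: eq_bigr => r _.
rewrite -mulrN -w'A mulr_sumr.
by apply: eq_bigr => s _; rewrite mulrA.
Qed.

Definition ceps (s : seq 'I_N) : B := algmap (eps q s).

(** The determinant as the factor by which the N-th tensor power of z scales the q-antisymmetric
    tensor, read off at the sorted word; [qd_perm] compares it with the sum over permutations. *)
Definition qd z := wsum z N ceps (enum 'I_N).

(** By [qalt_sort] a q-antisymmetric tensor of degree N is a multiple of [ceps]. The degree m is
    kept apart from N so that it may be [N.-1.+1]. *)
Lemma wsum_ceps m z s : qrel q z -> m = N -> size s = m ->
  wsum z m ceps s = ceps s * qd z.
Proof.
move=> zR -> sN; rewrite (qalt_sort _ (wsum_qalt N zR (qalt_eps q N B))) //.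
rewrite /ceps /eps; case: ifP => us; last by rewrite rmorph0 mul0r.
by rewrite sort_uniq_full.
Qed.

Definition crem (k : 'I_N) : seq 'I_N := rem k (enum 'I_N).

Lemma crem_uniq (k : 'I_N) : uniq (crem k). Proof. exact/rem_uniq/enum_uniq. Qed.
Lemma mem_crem (k i : 'I_N) : (i \in crem k) = (i != k).
Proof. by rewrite mem_rem_uniq ?enum_uniq // !inE mem_enum andbT. Qed.
Lemma size_crem (k : 'I_N) : size (crem k) = N.-1.
Proof. by rewrite size_rem ?mem_enum // size_enum_ord. Qed.

Lemma epsU (s : seq 'I_N) : uniq s -> eps q s \is a GRing.unit.
Proof. by move=> us; rewrite /eps us unitrX // unitrN. Qed.

(** Apply [wsum_ceps] to the word formed by i and then all letters but k in order: its [eps] is 0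
    unless i = k, and a unit if i = k. Splitting off the first factor exhibits z times a matrix of
    q-cofactors. *)
Lemma laplace_right z : qrel q z ->
  exists r, mm z r = fun i k => mid i k * qd z.
Proof.
move=> zR.
exists (fun j k => algmap (eps q (k :: crem k))^-1
           * wsum z N.-1 (fun s => ceps (j :: s)) (crem k)).
apply/funext => i; apply/funext => k.
have N1 : N.-1.+1 = N by case: N i => [[]|].
rewrite /mm; under eq_bigr => j _ do rewrite mulrA -algmapC -mulrA.
rewrite -mulr_sumr -wsum_cons (wsum_ceps zR N1) /=; last first.
  by rewrite size_crem.
rewrite mulrA -algmapM /mid; have [->|ik] := eqVneq i k.
  by rewrite mulVr ?algmap1 // epsU //= crem_uniq mem_crem eqxx.
by rewrite /eps /= !mem_crem ik mulr0 rmorph0.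
Qed.

(** The same with i placed last and the last factor split off. The result is a left q-adjugate of
    the transpose of z, which is why [xGL_inverse] feeds it the transposed generators. *)
Lemma laplace_left z : qrel q z ->
  exists l, forall k i, \sum_j l k j * z i j = mid k i * qd z.
Proof.
move=> zR.
exists (fun k j => algmap (eps q (rcons (crem k) k))^-1
           * wsum z N.-1 (fun s => ceps (rcons s j)) (crem k)).
move=> k i; have N1 : N.-1.+1 = N by case: N i => [[]|].
transitivity (algmap (eps q (rcons (crem k) k))^-1
    * wsum z N.-1.+1 ceps (rcons (crem k) i)); last first.
  rewrite (wsum_ceps zR N1) ?size_rcons ?size_crem //.
  rewrite mulrA -algmapM /mid; have [->|ki] := eqVneq k i.
    by rewrite mulVr ?algmap1 // epsU // rcons_uniq crem_uniq mem_crem eqxx.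
  by rewrite /eps !rcons_uniq !mem_crem [i == k]eq_sym ki mulr0 rmorph0.
rewrite /wsum (sum_idx_rcons _ (fun s => zs z (rcons (crem k) i) s * ceps s)).
rewrite mulr_sumr; apply: eq_bigr => j _; rewrite -mulrA; congr (_ * _).
rewrite mulr_suml; apply: eq_bigr => J _.
by rewrite zs_rcons -!mulrA [ceps _ * _]algmapC.
Qed.

(** The sum of q^(2 l(sigma)) over S_N, that is, the q^2-factorial of N. *)
Definition eps_norm := \sum_(J : idx N N) eps q (iseq J) ^+ 2.

(* Both sides times eps_norm equal the sum of eps(I) z_IJ eps(J) over I and J. *)
Lemma qd_tr z : eps_norm \is a GRing.unit -> qrel q z ->
  qd (fun i j => z j i) = qd z.
Proof.
move=> nU zR; have zR' := qrel_tr zR.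
have sym : \sum_(I : idx N N) ceps (iseq I) * wsum z N ceps (iseq I)
  = \sum_(I : idx N N) ceps (iseq I) * wsum (fun i j => z j i) N ceps (iseq I).
  rewrite /wsum; under eq_bigr => I _ do rewrite mulr_sumr.
  rewrite exchange_big; apply: eq_bigr => I _; rewrite mulr_sumr.
  apply: eq_bigr => J _; rewrite zs_tr /ceps [LHS]algmapC [RHS]algmapC -!mulrA.
  by rewrite -!algmapM mulrC.
move: sym; under eq_bigr => I _.
  rewrite (wsum_ceps zR) ?size_iseq // mulrA -algmapM -expr2; over.
under [in RHS]eq_bigr => I _.
  rewrite (wsum_ceps zR') ?size_iseq // mulrA -algmapM -expr2; over.
rewrite -!mulr_suml -!rmorph_sum => /(congr1 (fun u => algmap eps_norm^-1 * u)).
by rewrite !mulrA -!algmapM mulVr // algmap1 !mul1r.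
Qed.
End QuantumDet.

Section FrozenDet.
Variable N : nat.

Lemma ninv_map (f : 'I_N -> 'I_N) (s : seq 'I_N) :
  sorted (fun i j : 'I_N => i < j)%N s ->
  ninv (map f s)
    = (\sum_(i <- s) count (fun j : 'I_N => (i < j) && (f j < f i)) s)%N.
Proof.
elim: s => [|a s IHs] /=; first by rewrite big_nil.
have lt_trans : transitive (fun i j : 'I_N => i < j)%N.
  by move=> i j k; apply: ltn_trans.
move=> sas; have /allP sa := order_path_min lt_trans sas.
rewrite big_cons ltnn add0n (IHs (path_sorted sas)) count_map; congr (_ + _)%N.
  by apply: eq_in_count => j /sa aj /=; rewrite aj.
by rewrite !big_seq; apply: eq_bigr => i /sa ai; rewrite (leq_gtF (ltnW ai)).
Qed.

Lemma inversions_ninv (s : 'S_N) : inversions s = ninv (map s (enum 'I_N)).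
Proof.
rewrite ninv_map; last first.
  by have := iota_ltn_sorted 0 N; rewrite -val_enum_ord sorted_map.
rewrite big_enum /= /inversions -sum1_card.
under [RHS]eq_bigr => i _.
  rewrite -sum1_count big_enum_cond /=; over.
rewrite pair_big_dep /=; apply: eq_bigl => -[i j].
by rewrite inE.
Qed.

Lemma zs_map (B : pzRingType) (z : 'I_N -> 'I_N -> B) (f : 'I_N -> 'I_N) s :
  zs z s (map f s) = \prod_(i <- s) z i (f i).
Proof. by elim: s => [|i s IHs] /=; rewrite ?big_nil // big_cons IHs. Qed.

Lemma map_nth_enum (s : seq 'I_N) : size s = N ->
  s = map (fun i : 'I_N => nth i s i) (enum 'I_N).
Proof.
case: N s => [|n] s sN; first by rewrite (size0nil sN); case: (enum _) => [|[]].
apply: (@eq_from_nth _ ord0); first by rewrite size_map size_enum_ord.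
move=> i; rewrite sN => ltin; rewrite (nth_map ord0) ?size_enum_ord //.
by rewrite (set_nth_default ord0) ?nth_enum_ord // sN.
Qed.

(** [eps] vanishes on words with a repeated letter, and the other words of length N are the one-line
    notations of permutations. *)
Lemma qd_perm (A : comUnitRingType) (q : A) (B : pzAlgType A)
    (z : 'I_N -> 'I_N -> B) :
  qd q z = \sum_(s : 'S_N) ((- q) ^+ inversions s) *%: \prod_(i < N) z i (s i).
Proof.
pose h (s : 'S_N) : idx N N :=
  projT1 (cid (@iseq_surj_size N N (map s (enum 'I_N))
                 (etrans (size_map _ _) (size_enum_ord _)))).
have hE s : iseq (h s) = map s (enum 'I_N) by rewrite /h; case: cid.
have h_inj : injective h.
  move=> s t /(congr1 (@iseq _ _)); rewrite !hE => /eq_in_map st.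
  by apply/permP => i; apply: st; rewrite mem_enum.
have hP J : uniq (iseq J) = (J \in [set h s | s in [set: 'S_N]]).
  apply/idP/imsetP => [uJ|[s _ ->]]; last first.
    by rewrite hE map_inj_uniq ?enum_uniq //; apply: perm_inj.
  pose g (i : 'I_N) := nth i (iseq J) i.
  have g_inj : injective g.
    move=> i j; rewrite /g (set_nth_default i j) ?size_iseq // => /eqP.
    by rewrite nth_uniq ?size_iseq // => /eqP/val_inj.
  exists (perm g_inj) => //; apply: (@iseq_inj N N); rewrite hE.
  rewrite {1}(map_nth_enum (size_iseq J)).
  by apply: eq_map => i; rewrite permE.
rewrite /qd /wsum (bigID (fun J => uniq (iseq J))) /= [X in _ + X]big1 ?addr0.
  rewrite (eq_bigl _ _ hP) big_imset /=; last by move=> s t _ _; apply: h_inj.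
  apply: eq_big => [s|s _]; first by rewrite finset.inE.
  rewrite hE zs_map [index_enum _]unlock -enumT /ceps /eps map_inj_uniq ?enum_uniq; last first.
    exact: perm_inj.
  by rewrite -algmapC inversions_ninv.
by move=> J /negPf uJ; rewrite /ceps /eps uJ rmorph0 mulr0.
Qed.
End FrozenDet.

(** * The Hopf algebra of GL_q *)

Section PresentedRel.
Variables (A : comPzRingType) (G : Type) (rel : term A G -> term A G -> Prop).

Lemma teval_pgen t : teval (pgen rel) t = \pi_(presented rel)%qT t.
Proof.
elim: t => [g|a|s IHs t IHt|s IHs t IHt] //=; rewrite IHs IHt.
  exact: Defs.pi_add.
exact: Defs.pi_mul.
Qed.

Lemma pgen_satisfies : satisfies rel (pgen rel).
Proof.
by move=> s t st; rewrite !teval_pgen; apply/presentedP; apply: cong_rel.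
Qed.
End PresentedRel.

Section TensorHom.
Variable A : comPzRingType.
Implicit Types U V W : pzAlgType A.

Lemma tpureM U V (u u' : U) (v v' : V) :
  tpure u v * tpure u' v' = tpure (u * u') (v * v').
Proof. exact: tmul_pure. Qed.

Lemma tpure0l U V (v : V) : tpure (0 : U) v = 0.
Proof. by apply: (@addrI _ (tpure 0 v)); rewrite -tpureDl !addr0. Qed.
Lemma tpure0r U V (u : U) : tpure u (0 : V) = 0.
Proof. by apply: (@addrI _ (tpure u 0)); rewrite -tpureDr !addr0. Qed.

Lemma tpure_suml U V I r (P : pred I) (F : I -> U) (v : V) :
  tpure (\sum_(i <- r | P i) F i) v = \sum_(i <- r | P i) tpure (F i) v.
Proof. exact: (big_morph (fun u => tpure u v) (fun u u' => tpureDl u u' v) (tpure0l _ v)). Qed.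
Lemma tpure_sumr U V I r (P : pred I) (F : I -> V) (u : U) :
  tpure u (\sum_(i <- r | P i) F i) = \sum_(i <- r | P i) tpure u (F i).
Proof. exact: (big_morph (fun v => tpure u v) (fun v v' => tpureDr u v v') (tpure0r _ u)). Qed.

Lemma algmap_tensor U V (a : A) :
  algmap a = tpure (algmap a) 1 :> tensor U V.
Proof. by []. Qed.
Lemma algmap_tpure1 U V (a : A) :
  algmap a = tpure 1 (algmap a) :> tensor U V.
Proof.
rewrite algmap_tensor -[algmap a in LHS]mulr1 -[X in _ = tpure _ X]mulr1.
exact: tpureZ.
Qed.
Lemma algmap_mul_tpure U V (a : A) (u : U) (v : V) :
  algmap a * tpure u v = tpure (algmap a * u) v.
Proof. by rewrite algmap_tensor tpureM mul1r. Qed.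
Lemma algmap_mul_tpurer U V (a : A) (u : U) (v : V) :
  algmap a * tpure u v = tpure u (algmap a * v).
Proof. by rewrite algmap_tpure1 tpureM mul1r. Qed.

Lemma tpure_l_hom U V : is_alg_hom (fun u : U => tpure u 1 : tensor U V).
Proof.
by split=> [u u'|u u'|a] //; [rewrite tpureDl | rewrite tpureM mulr1].
Qed.
Lemma tpure_r_hom U V : is_alg_hom (fun v : V => tpure 1 v : tensor U V).
Proof.
split=> [u u'|u u'|a]; first by rewrite tpureDr.
  by rewrite tpureM mulr1.
by rewrite algmap_tpure1.
Qed.

Lemma tlift_sum U V (W : zmodType) (f : U -> V -> W) : balanced f ->
  forall I r (P : pred I) (F : I -> tensor U V),
  tlift f (\sum_(i <- r | P i) F i) = \sum_(i <- r | P i) tlift f (F i).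
Proof.
by move=> fB I r P F; apply: (big_morph _ (tliftD fB) (tlift0 fB)).
Qed.

Lemma tlift_eq U V (W : zmodType) (f g : tensor U V -> W) :
  (forall x y, f (x + y) = f x + f y) -> (forall x y, g (x + y) = g x + g y) ->
  (forall u v, f (tpure u v) = g (tpure u v)) -> f =1 g.
Proof.
move=> fD gD fg; elim/tensor_ind=> [|x y IHx IHy|//].
  have f0 : f 0 = 0 by apply: (@addrI _ (f 0)); rewrite -fD !addr0.
  have g0 : g 0 = 0 by apply: (@addrI _ (g 0)); rewrite -gD !addr0.
  by rewrite f0 g0.
by rewrite fD gD IHx IHy.
Qed.

Section Tmap.
Variables (U V U' V' : pzAlgType A) (f : U -> U') (g : V -> V').
Hypotheses (fH : is_alg_hom f) (gH : is_alg_hom g).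

Lemma tmap_bal : balanced (fun u v => tpure (f u) (g v)).
Proof.
split=> [u u' v|u v v'|a u v].
- by rewrite (homD fH) tpureDl.
- by rewrite (homD gH) tpureDr.
- by rewrite (homZ fH) (homZ gH) tpureZ.
Qed.

Lemma tmap_pure u v : tmap f g (tpure u v) = tpure (f u) (g v).
Proof. exact: tlift_pure tmap_bal _ _. Qed.

Lemma tmapD : {morph tmap f g : x y / x + y}.
Proof. exact: tliftD tmap_bal. Qed.

Lemma tmap_hom : is_alg_hom (tmap f g).
Proof.
split; [exact: tmapD | | ].
  move=> x y; elim/tensor_ind: x => [|x x' IHx IHx'|u v].
  - by rewrite mul0r /tmap (tlift0 tmap_bal) mul0r.
  - by rewrite mulrDl !tmapD IHx IHx' mulrDl.
  elim/tensor_ind: y => [|y y' IHy IHy'|u' v'].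
  - by rewrite mulr0 /tmap (tlift0 tmap_bal) mulr0.
  - by rewrite mulrDr !tmapD IHy IHy' mulrDr.
  by rewrite tpureM !tmap_pure (homM fH) (homM gH) tpureM.
by move=> a; rewrite !algmap_tensor tmap_pure (homA fH) (hom1 gH).
Qed.
End Tmap.
End TensorHom.

Section AdjoinHom.
Variables (A : comPzRingType) (B C : pzAlgType A) (b : B).

Lemma adjoin_in_hom : is_alg_hom (@adjoin_in A B b).
Proof.
have R := @pgen_satisfies _ _ (@adjoin_rel A B b).
split=> [x y|x y|a].
- exact: R (adjoin_D b x y).
- exact: R (adjoin_M b x y).
- exact: R (adjoin_cst b a).
Qed.

Lemma adjoin_inV : adjoin_in b b * adjoin_invb b = 1.
Proof.
have := @pgen_satisfies _ _ _ _ _ (adjoin_V b) => /= ->; exact: algmap1.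
Qed.
Lemma adjoin_inVl : adjoin_invb b * adjoin_in b b = 1.
Proof.
have := @pgen_satisfies _ _ _ _ _ (adjoin_Vl b) => /= ->; exact: algmap1.
Qed.

Variables (f : B -> C) (c : C).
Hypotheses (fH : is_alg_hom f) (fbc : f b * c = 1) (cfb : c * f b = 1).

Lemma adjoin_satisfies :
  satisfies (@adjoin_rel A B b) (fun g => if g is Some x then f x else c).
Proof.
move=> s t; case=> {s t} [a|x y|x y||] /=; rewrite ?algmap1 //.
- exact: homA.
- exact: homD.
- exact: homM.
Qed.

Lemma adjoin_lift_hom : is_alg_hom (@adjoin_lift A B b C f c).
Proof. exact: plift_alg_hom adjoin_satisfies. Qed.
Lemma adjoin_lift_in x : adjoin_lift f c (adjoin_in b x) = f x.
Proof. exact: (plift_pgen adjoin_satisfies (Some x)). Qed.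
Lemma adjoin_lift_invb : adjoin_lift f c (adjoin_invb b) = c.
Proof. exact: (plift_pgen adjoin_satisfies None). Qed.
End AdjoinHom.

Section QrelClosure.
Variables (A : comUnitRingType) (q : A) (N : nat).

Lemma qrel_hom (B C : pzAlgType A) (f : B -> C) (z : 'I_N -> 'I_N -> B) :
  is_alg_hom f -> qrel q z -> qrel q (fun i j => f (z i j)).
Proof.
move=> fH /qrelE zR; apply/qrelE => i k j l.
have := congr1 f (zR i k j l).
by rewrite !(homD fH, homM fH, homA fH).
Qed.

(** When the entries of a commute with those of b, the matrix ab (x) ab factors as (a (x) a)(b (x)
    b), and R passes through both factors. This makes the comultiplication respect the relations. *)
Lemma qrel_mul (B : pzAlgType A) (a b : 'I_N -> 'I_N -> B) :
  (forall i j k l, a i j * b k l = b k l * a i j) ->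
  qrel q a -> qrel q b -> qrel q (mm a b).
Proof.
move=> abC aR bR.
have E : ten2 (mm a b) = mm (ten2 a) (ten2 b).
  apply/funext => p; apply/funext => r; rewrite /ten2 /mm mulr_suml.
  under eq_bigr => i _ do rewrite mulr_sumr.
  rewrite pair_bigA; apply: eq_bigr => -[i k] _ /=.
  by rewrite -!mulrA; congr (_ * _); rewrite !mulrA abC.
by rewrite /qrel E -mmA aR mmA bR mmA.
Qed.

Lemma zs_hom (B C : pzAlgType A) (f : B -> C) (z : 'I_N -> 'I_N -> B) s t :
  is_alg_hom f -> f (zs z s t) = zs (fun i j => f (z i j)) s t.
Proof.
move=> fH; elim: s t => [|i s IHs] [|j t] /=; rewrite ?(hom0 fH) ?(hom1 fH) //.
by rewrite (homM fH) IHs.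
Qed.

Lemma zs_mul (B : pzAlgType A) (a b : 'I_N -> 'I_N -> B) n (I : idx N n) t :
  (forall i j k l, a i j * b k l = b k l * a i j) ->
  zs (mm a b) (iseq I) t
    = \sum_(K : idx N n) zs a (iseq I) (iseq K) * zs b (iseq K) t.
Proof.
move=> abC.
have zaC i j s u : zs a s u * b i j = b i j * zs a s u.
  elim: s u => [|k s IHs] [|l u] /=; rewrite ?mul0r ?mulr0 ?mul1r ?mulr1 //.
  by rewrite -mulrA IHs !mulrA abC.
elim: n I t => [|n IHn] I [|j t].
- by rewrite sum_idx0 /= mulr1.
- by rewrite sum_idx0 /= mulr0.
- by rewrite /= big1 // => K _; rewrite mulr0.
case: I => i I; rewrite sum_idxS /= IHn /mm mulr_suml.
apply: eq_bigr => k _; rewrite mulr_sumr; apply: eq_bigr => K _.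
by rewrite -!mulrA; congr (_ * _); rewrite !mulrA zaC.
Qed.
End QrelClosure.

Section Opposite.
Variables (A : comPzRingType) (B : pzAlgType A).

Lemma algmapM_op : {morph (@algmap A B : A -> B^c) : a b / a * b}.
Proof. by move=> a b; rewrite mulrC algmapM. Qed.
Lemma algmapC_op (a : A) (v : B^c) :
  @GRing.mul B^c (algmap a : B) v = @GRing.mul B^c v (algmap a : B).
Proof. exact: (esym (@algmapC A B a v)). Qed.
HB.instance Definition _ := GRing.PzRing.on B^c.
(** With the opposite ring an A-algebra, anti-homomorphisms such as the antipode are homomorphisms
    into [B^c], and universal properties apply to them. *)
HB.instance Definition _ :=
  isPzAlgebra.Build A B^c (@algmapD A B) algmapM_op (@algmap1 A B) algmapC_op.
End Opposite.

Section Convolution.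
Variables (A : comPzRingType) (U B : pzAlgType A) (S : U -> B) (g : U -> B).
Hypotheses (SH : @is_alg_hom A U B^c S) (gH : is_alg_hom g).

Lemma anti_mul u v : S (u * v) = S v * S u. Proof. exact: (homM SH). Qed.

Lemma conv_bal_l : balanced (fun h1 h2 => S h1 * g h2).
Proof.
split=> [u u' v|u v v'|a u v].
- by rewrite (homD SH) mulrDl.
- by rewrite (homD gH) mulrDr.
- by rewrite /ascale anti_mul (homM gH) (homA SH) (homA gH) mulrA.
Qed.

Lemma conv_bal_r : balanced (fun h1 h2 => g h1 * S h2).
Proof.
split=> [u u' v|u v v'|a u v].
- by rewrite (homD gH) mulrDl.
- by rewrite (homD SH) mulrDr.
- rewrite /ascale anti_mul (homM gH) (homA SH) (homA gH) mulrA.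
  by rewrite -[RHS]algmapC mulrA.
Qed.

Local Notation ml := (tlift (fun h1 h2 => S h1 * g h2)).
Local Notation mr := (tlift (fun h1 h2 => g h1 * S h2)).

(** In S(t'_1) S(t_1) g(t_2) g(t'_2) the inner pair collapses to the central scalar c. Hence the
    antipode identities need checking on generators only. *)
Lemma conv_mul_l t t' (c : A) : ml t = algmap c -> ml (t * t') = algmap c * ml t'.
Proof.
move=> tc; have bal := conv_bal_l.
have mlD := tliftD bal; have ml0 := tlift0 bal; have mlp := tlift_pure bal.
elim/tensor_ind: t' => [|x y IHx IHy|u' v'].
- by rewrite mulr0 ml0 mulr0.
- by rewrite mulrDr !mlD IHx IHy mulrDr.
rewrite mlp algmapC -mulrA -algmapC mulrA -[RHS]mulrA -tc.
elim/tensor_ind: t {tc} => [|x y IHx IHy|u v].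
- by rewrite mul0r ml0 mul0r mulr0.
- by rewrite mulrDl !mlD IHx IHy mulrDl mulrDr.
by rewrite tpureM !mlp anti_mul (homM gH) !mulrA.
Qed.

Lemma conv_mul_r t t' (c : A) : mr t' = algmap c -> mr (t * t') = mr t * algmap c.
Proof.
move=> tc; have bal := conv_bal_r.
have mrD := tliftD bal; have mr0 := tlift0 bal; have mrp := tlift_pure bal.
elim/tensor_ind: t => [|x y IHx IHy|u v].
- by rewrite mul0r mr0 mul0r.
- by rewrite mulrDl !mrD IHx IHy mulrDl.
rewrite mrp -mulrA -algmapC -tc.
elim/tensor_ind: t' {tc} => [|x y IHx IHy|u' v'].
- by rewrite mulr0 mr0 mul0r mulr0.
- by rewrite mulrDr !mrD IHx IHy mulrDl mulrDr.
by rewrite tpureM !mrp anti_mul (homM gH) !mulrA.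
Qed.
End Convolution.

Lemma zs_diag (N : nat) (B : pzRingType) (d : 'I_N -> B) s t :
  zs (fun i j => if i == j then d i else 0) s t
    = if s == t then \prod_(i <- s) d i else 0.
Proof.
elim: s t => [|i s IHs] [|j t] //=; first by rewrite big_nil.
rewrite eqseq_cons IHs big_cons; case: eqP => _ /=; last by rewrite mul0r.
by case: ifP => _; rewrite ?mulr0.
Qed.

Section HopfGL.
Variables (A : comUnitRingType) (q : A) (N : nat).
Hypotheses (qU : q \is a GRing.unit) (q2U : 1 + q ^+ 2 \is a GRing.unit).
Hypothesis nU : eps_norm q N \is a GRing.unit.

Local Notation x := (@xM A q N).
Local Notation OM := (OM q N).
Local Notation OGL := (OGL q N).
Local Notation inGL := (@inGL A q N).
Local Notation det := (qdet q N).
Local Notation detV := (qdetV q N).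

Lemma xM_qrel : qrel q x.
Proof.
apply/(qmat_satisfies qU (pgen (@qmat_rel A q N))).
exact: pgen_satisfies.
Qed.

(** Serves the counit, the evaluation at a diagonal point and the restriction to the torus. *)
Lemma qrel_diag (B : pzAlgType A) (d : 'I_N -> B) :
  (forall i j, d i * d j = d j * d i) ->
  qrel q (fun i j => if i == j then d i else 0).
Proof.
move=> dC.
apply/(qmat_satisfies qU (fun g => if g.1 == g.2 then d g.1 else 0)).
have zero (i k j l : 'I_N) : (i < k)%N -> (j < l)%N ->
    (if i == l then d i else 0) * (if k == j then d k else 0) = 0.
  move=> ik jl; case: eqP => [il|_]; last by rewrite mul0r.
  case: eqP => [kj|_]; last by rewrite mulr0.
  by have := ltn_trans ik; rewrite kj il => /(_ _ jl); rewrite ltnn.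
move=> s t; case=> {s t} [i j l jl|i k j ik|i k j l ik jl|i k j l ik jl] /=.
- have [ij|_] := eqVneq i j; last by rewrite mul0r mulr0 mulr0.
  by have [il|_] := eqVneq i l; rewrite ?mulr0 ?mul0r ?mulr0 // -ij il ltnn in jl *.
- have [ij|_] := eqVneq i j; last by rewrite mul0r mulr0 mulr0.
  by have [kj|_] := eqVneq k j; rewrite ?mulr0 ?mul0r ?mulr0 // kj ij ltnn in ik *.
- rewrite zero //; case: eqP => [kj|_]; last by rewrite mul0r.
  case: eqP => [il|_]; last by rewrite mulr0.
  by have := ltn_trans ik; rewrite kj il => /(_ _ jl); rewrite ltnn.
- rewrite (zero _ _ _ _ ik jl) [RHS]mulr0 rmorphN1 mulN1r; apply/eqP; rewrite subr_eq0; apply/eqP.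
  by case: eqP => _; case: eqP => _; rewrite ?mul0r ?mulr0.
Qed.

Lemma ninv_enum : ninv (enum 'I_N) = 0%N.
Proof.
have := inversions_ninv (1%g : 'S_N).
rewrite (eq_map (g := id)) ?map_id => [<-|i]; last by rewrite perm1.
apply/eqP; rewrite cards_eq0; apply/eqP/setP => -[i j].
rewrite !finset.inE !perm1 /=; apply/negbTE/negP => /andP[ij].
by rewrite ltnNge (ltnW ij).
Qed.

Lemma eps_enum : eps q (enum 'I_N) = 1.
Proof. by rewrite /eps enum_uniq ninv_enum. Qed.

Lemma qd_diag (B : pzAlgType A) (d : 'I_N -> B) :
  qd q (fun i j => if i == j then d i else 0) = \prod_(i < N) d i.
Proof.
have [J JE] := iseq_surj_size (size_enum_ord N).
rewrite /qd /wsum (bigD1 J) //= big1 => [|J' /eqP JJ'].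
  rewrite JE zs_diag eqxx /ceps eps_enum algmap1 mulr1 addr0.
  by rewrite [index_enum _]unlock -enumT.
rewrite zs_diag; case: eqP => [e|_]; last by rewrite mul0r.
by case: JJ'; apply: (@iseq_inj N N); rewrite JE.
Qed.

Lemma qdetE : det = qd q x. Proof. by rewrite qd_perm. Qed.

Lemma qd_hom (B C : pzAlgType A) (f : B -> C) (z : 'I_N -> 'I_N -> B) :
  is_alg_hom f -> f (qd q z) = qd q (fun i j => f (z i j)).
Proof.
move=> fH; rewrite /qd /wsum (hom_sum fH); apply: eq_bigr => J _.
by rewrite (homM fH) (zs_hom _ _ _ fH) /ceps (homA fH).
Qed.

Lemma comulM_mm :
  (fun i j => \sum_k tpure (x i k) (x k j) : tensor OM OM)
    = mm (fun i k => tpure (x i k) 1) (fun k j => tpure 1 (x k j)).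
Proof.
apply/funext => i; apply/funext => j; apply: eq_bigr => k _.
by rewrite tpureM mulr1 mul1r.
Qed.

Lemma tpure_lrC (U V : pzAlgType A) (u : U) (v : V) :
  tpure u 1 * tpure 1 v = tpure 1 v * tpure u 1.
Proof. by rewrite !tpureM !mulr1 !mul1r. Qed.

Lemma comulM_satisfies : satisfies (@qmat_rel A q N)
  (fun g => \sum_k tpure (x g.1 k) (x k g.2) : tensor OM OM).
Proof.
apply/(qmat_satisfies qU (fun g => \sum_k tpure (x g.1 k) (x k g.2))).
rewrite comulM_mm; apply: qrel_mul => [i j k l||].
- exact: tpure_lrC.
- exact: qrel_hom (tpure_l_hom _ _) xM_qrel.
- exact: qrel_hom (tpure_r_hom _ _) xM_qrel.
Qed.

Lemma comulM_hom : is_alg_hom (@comulM A q N).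
Proof. exact: plift_alg_hom comulM_satisfies. Qed.
Lemma comulM_xM i j : comulM (x i j) = \sum_k tpure (x i k) (x k j).
Proof. exact: (plift_pgen comulM_satisfies). Qed.

Lemma comulM_zs n (I : idx N n) t : comulM (zs x (iseq I) t)
  = \sum_(K : idx N n) tpure (zs x (iseq I) (iseq K)) (zs x (iseq K) t).
Proof.
rewrite (zs_hom _ _ _ comulM_hom).
rewrite (_ : (fun i j => _) = (fun i j => \sum_k tpure (x i k) (x k j))); last first.
  by apply/funext => i; apply/funext => j; rewrite comulM_xM.
rewrite comulM_mm zs_mul => [|i j k l]; last exact: tpure_lrC.
apply: eq_bigr => K _.
rewrite -(zs_hom _ _ _ (tpure_l_hom _ _)) -(zs_hom _ _ _ (tpure_r_hom _ _)).
by rewrite tpureM mulr1 mul1r.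
Qed.

(** The comultiplication gives the product of two commuting copies of X. The second copy scales the
    q-antisymmetric tensor by its determinant (the inner use of [wsum_ceps]), then the first copy
    does the same. *)
Lemma comulM_det : comulM det = tpure det det.
Proof.
have [I IE] := iseq_surj_size (size_enum_ord N).
rewrite qdetE {1}/qd /wsum (hom_sum comulM_hom) -IE.
under eq_bigr => J _.
  rewrite (homM comulM_hom) comulM_zs /ceps (homA comulM_hom) -algmapC mulr_sumr.
  over.
rewrite exchange_big /=.
under eq_bigr => K _.
  under eq_bigr => J _ do rewrite algmap_mul_tpurer algmapC.
  rewrite -tpure_sumr -/(wsum x N (@ceps A q N OM) (iseq K)).
  rewrite (wsum_ceps qU q2U xM_qrel) ?size_iseq // -algmap_mul_tpurer.
  rewrite algmap_mul_tpure algmapC.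
  over.
by rewrite -tpure_suml /qd -IE.
Qed.

Lemma counitM_satisfies : satisfies (@qmat_rel A q N)
  (fun g => (g.1 == g.2)%:R : A^o).
Proof.
apply/(qmat_satisfies qU (fun g => (g.1 == g.2)%:R : A^o)).
have := @qrel_diag A^o (fun=> 1) (fun _ _ => erefl).
congr (qrel q _); apply/funext => i; apply/funext => j /=.
by case: (i == j).
Qed.

Lemma counitM_hom : is_alg_hom (@counitM A q N).
Proof. exact: plift_alg_hom counitM_satisfies. Qed.
Lemma counitM_xM i j : counitM (x i j) = (i == j)%:R.
Proof. exact: (plift_pgen counitM_satisfies). Qed.

Lemma counitM_det : counitM det = 1.
Proof.
rewrite qdetE (qd_hom _ counitM_hom).
rewrite (_ : (fun i j => _) = (fun i j => if i == j then 1 else 0)).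
  by rewrite qd_diag big1.
apply/funext => i; apply/funext => j; rewrite counitM_xM.
by case: (i == j).
Qed.

Lemma inGL_hom : is_alg_hom inGL. Proof. exact: adjoin_in_hom. Qed.

Lemma det_detV : inGL det * detV = 1. Proof. exact: adjoin_inV. Qed.
Lemma detV_det : detV * inGL det = 1. Proof. exact: adjoin_inVl. Qed.

Lemma comulGL_rel :
  (tmap inGL inGL \o @comulM A q N) det * tpure detV detV = 1 /\
  tpure detV detV * (tmap inGL inGL \o @comulM A q N) det = 1.
Proof.
rewrite /= comulM_det (tmap_pure inGL_hom inGL_hom) !tpureM.
by rewrite !det_detV !detV_det.
Qed.

Lemma comulGL_hom : is_alg_hom (@comulGL A q N).
Proof.
apply: adjoin_lift_hom; [|exact: comulGL_rel.1|exact: comulGL_rel.2].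
exact: alg_hom_comp (tmap_hom inGL_hom inGL_hom) comulM_hom.
Qed.
Lemma comulGL_in h : comulGL (inGL h) = tmap inGL inGL (comulM h).
Proof.
apply: adjoin_lift_in; [|exact: comulGL_rel.1|exact: comulGL_rel.2].
exact: alg_hom_comp (tmap_hom inGL_hom inGL_hom) comulM_hom.
Qed.
Lemma comulGL_detV : comulGL detV = tpure detV detV.
Proof.
apply: adjoin_lift_invb; [|exact: comulGL_rel.1|exact: comulGL_rel.2].
exact: alg_hom_comp (tmap_hom inGL_hom inGL_hom) comulM_hom.
Qed.

Lemma counitGL_rel : @counitM A q N det * 1 = 1 /\ 1 * @counitM A q N det = 1.
Proof. by rewrite mulr1 mul1r counitM_det. Qed.
Lemma counitGL_hom : is_alg_hom (@counitGL A q N).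
Proof. exact: adjoin_lift_hom counitM_hom counitGL_rel.1 counitGL_rel.2. Qed.
Lemma counitGL_in h : counitGL (inGL h) = counitM h.
Proof. exact: (adjoin_lift_in counitM_hom counitGL_rel.1 counitGL_rel.2). Qed.
Lemma counitGL_detV : @counitGL A q N detV = 1.
Proof. exact: (adjoin_lift_invb counitM_hom counitGL_rel.1 counitGL_rel.2). Qed.

Definition xGL i j : OGL := inGL (x i j).

Lemma xGL_qrel : qrel q xGL.
Proof. exact: qrel_hom inGL_hom xM_qrel. Qed.

Lemma qd_xGL : qd q xGL = inGL det.
Proof. by rewrite qdetE (qd_hom _ inGL_hom). Qed.

(** [laplace_right] gives a right inverse. [laplace_left] for the transposed generators, whose
    determinant is the same by [qd_tr], gives a left inverse, and the two must agree. *)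
Lemma xGL_inverse : exists y, mm xGL y = mid /\ mm y xGL = mid.
Proof.
have [r rE] := laplace_right qU q2U xGL_qrel.
have [l lE] := laplace_left qU q2U (qrel_tr xGL_qrel).
rewrite (qd_tr qU q2U nU xGL_qrel) qd_xGL in lE; rewrite qd_xGL in rE.
pose r' j k := r j k * detV; pose l' k j := detV * l k j.
have r'E : mm xGL r' = mid.
  apply/funext => i; apply/funext => k.
  have := congr1 (fun M => M i k) rE; rewrite /mm /r' => e.
  under eq_bigr => j _ do rewrite mulrA.
  by rewrite -mulr_suml e -mulrA det_detV mulr1.
have l'E : mm l' xGL = mid.
  apply/funext => k; apply/funext => i; rewrite /mm /l'.
  under eq_bigr => j _ do rewrite -mulrA.
  rewrite -mulr_sumr lE /mid; case: (k == i).
    by rewrite mul1r detV_det.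
  by rewrite mul0r mulr0.
by exists l'; split=> //; rewrite (mm_inv_uniq l'E r'E).
Qed.
End HopfGL.

(** * The antipode *)

Section Antipode.
Variables (A : comUnitRingType) (q : A) (N : nat).
Hypotheses (qU : q \is a GRing.unit) (q2U : 1 + q ^+ 2 \is a GRing.unit).

Local Notation x := (@xM A q N).
Local Notation OM := (OM q N).
Local Notation OGL := (OGL q N).
Local Notation inGL := (@inGL A q N).
Local Notation det := (qdet q N).
Local Notation detV := (qdetV q N).
Local Notation xGL := (@xGL A q N).

Inductive wordM : OM -> Prop :=
| wordM1 : wordM 1
| wordMx w i j : wordM w -> wordM (w * x i j).

Lemma wordMM u v : wordM u -> wordM v -> wordM (u * v).
Proof.
move=> uW; elim=> [|w i j _ IHw]; first by rewrite mulr1.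
by rewrite mulrA; apply: wordMx.
Qed.

Lemma OM_span h : lspan wordM h.
Proof.
elim/presented_ind: h => [a|[i j]|u v uW vW|u v uW vW].
- by rewrite -[algmap a]mulr1; apply: lspanZ; apply: wordM1.
- by apply: lspan_in; rewrite -[pgen _ _]mul1r; apply: wordMx wordM1.
- exact: lspanD.
- exact: lspan_mul wordMM uW vW.
Qed.

Lemma wordM_zs w : wordM w ->
  exists n (I J : idx N n), w = zs x (iseq I) (iseq J).
Proof.
elim=> [|{}w i j _ [n [I [J ->]]]]; first by exists 0%N, tt, tt.
have [I' IE] : exists I' : idx N n.+1, iseq I' = rcons (iseq I) i.
  by apply: iseq_surj_size; rewrite size_rcons size_iseq.
have [J' JE] : exists J' : idx N n.+1, iseq J' = rcons (iseq J) j.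
  by apply: iseq_surj_size; rewrite size_rcons size_iseq.
by exists n.+1, I', J'; rewrite IE JE zs_rcons.
Qed.

Section Inverse.
Variable y : 'I_N -> 'I_N -> OGL.
Hypotheses (xy : mm xGL y = mid) (yx : mm y xGL = mid).

(** The inverse of X_1 X_2 is Y_2 Y_1, with the factors in the opposite order. R commutes with it as
    well, and this is the R-matrix relation for y in the opposite algebra. *)
Lemma y_qrel : @qrel A q N OGL^c y.
Proof.
pose P (p r : 'I_N * 'I_N) := y p.2 r.2 * y p.1 r.1.
have sum_xy i j : \sum_k xGL i k * y k j = (i == j)%:R.
  by rewrite -[LHS]/(mm xGL y i j) xy.
have sum_yx i j : \sum_k y i k * xGL k j = (i == j)%:R.
  by rewrite -[LHS]/(mm y xGL i j) yx.
have XP : mm (ten2 xGL) P = mid.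
  apply/funext => -[i k]; apply/funext => -[j l]; rewrite /mm /ten2 /P /=.
  rewrite -(pair_bigA _ (fun a b => xGL i a * xGL k b * (y b l * y a j))) /=.
  under eq_bigr => a _.
    under eq_bigr => b _ do rewrite -mulrA (mulrA (xGL k b)).
    rewrite -mulr_sumr -mulr_suml sum_xy; over.
  rewrite /mid xpair_eqE; case: (k == l); last first.
    by rewrite andbF big1 // => a _; rewrite mul0r mulr0.
  by under eq_bigr => a _ do rewrite mul1r; rewrite sum_xy andbT.
have PX : mm P (ten2 xGL) = mid.
  apply/funext => -[i k]; apply/funext => -[j l]; rewrite /mm /ten2 /P /=.
  rewrite -(pair_bigA _ (fun a b => y k b * y i a * (xGL a j * xGL b l))) /=.
  rewrite exchange_big /=; under eq_bigr => b _.
    under eq_bigr => a _ do rewrite -mulrA (mulrA (y i a)).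
    rewrite -mulr_sumr -mulr_suml sum_yx; over.
  rewrite /mid xpair_eqE; case: (i == j); last first.
    by rewrite big1 // => a _; rewrite mul0r mulr0.
  by under eq_bigr => a _ do rewrite mul1r; rewrite sum_yx.
have RP := mm_comm_inv XP PX (xGL_qrel N qU).
apply/qrelE => i k j l.
have := congr1 (fun M => M (i, k) (j, l)) RP.
rewrite rmat_mull rmat_mulr /P /= => e.
rewrite -[LHS]/(y i l * y k j * algmap (q ^+ (1 + (i == k)))
             + y k l * y i j * algmap ((q ^+ 2 - 1) *+ (i < k)%N)).
rewrite -[RHS]/(y k j * y i l * algmap (q ^+ (1 + (j == l)))
             + y k l * y i j * algmap ((q ^+ 2 - 1) *+ (j < l)%N)).
by rewrite -!algmapC.
Qed.

Definition SM : OM -> OGL := plift (fun g => y g.1 g.2 : OGL^c).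

Lemma SM_satisfies : satisfies (@qmat_rel A q N) (fun g => y g.1 g.2 : OGL^c).
Proof. exact/(qmat_satisfies qU (fun g => y g.1 g.2 : OGL^c))/y_qrel. Qed.
Lemma SM_hom : @is_alg_hom A OM OGL^c SM.
Proof. exact: plift_alg_hom SM_satisfies. Qed.
Lemma SM_xM i j : SM (x i j) = y i j.
Proof. exact: (plift_pgen SM_satisfies). Qed.
Lemma SMM u v : SM (u * v) = SM v * SM u. Proof. exact: anti_mul SM_hom _ _. Qed.

Lemma SM_convl h :
  tlift (fun h1 h2 => SM h1 * inGL h2) (comulM h) = algmap (counitM h : A).
Proof.
have bal := conv_bal_l SM_hom (inGL_hom q N).
have cH := comulM_hom N qU; have eH := counitM_hom N qU.
elim/presented_ind: h => [a|[i j]|u v IHu IHv|u v IHu IHv].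
- rewrite (homA cH) algmap_tensor (tlift_pure bal) (homA eH).
  by rewrite (homA SM_hom) (hom1 (inGL_hom q N)) mulr1.
- rewrite -[pgen _ _]/(x i j) (comulM_xM qU) (tlift_sum bal) (counitM_xM qU).
  under eq_bigr => k _ do rewrite (tlift_pure bal) SM_xM.
  by rewrite -[LHS]/(mm y xGL i j) yx rmorph_nat.
- by rewrite (homD cH) (tliftD bal) IHu IHv (homD eH) rmorphD.
- rewrite (homM cH) (conv_mul_l SM_hom (inGL_hom q N) _ IHu) IHv.
  by rewrite (homM eH) rmorphM.
Qed.

Lemma SM_convr h :
  tlift (fun h1 h2 => inGL h1 * SM h2) (comulM h) = algmap (counitM h : A).
Proof.
have bal := conv_bal_r SM_hom (inGL_hom q N).
have cH := comulM_hom N qU; have eH := counitM_hom N qU.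
elim/presented_ind: h => [a|[i j]|u v IHu IHv|u v IHu IHv].
- rewrite (homA cH) algmap_tensor (tlift_pure bal) (homA eH).
  by rewrite (hom1 SM_hom) mulr1 (homA (inGL_hom q N)).
- rewrite -[pgen _ _]/(x i j) (comulM_xM qU) (tlift_sum bal) (counitM_xM qU).
  under eq_bigr => k _ do rewrite (tlift_pure bal) SM_xM.
  by rewrite -[LHS]/(mm xGL y i j) xy rmorph_nat.
- by rewrite (homD cH) (tliftD bal) IHu IHv (homD eH) rmorphD.
- rewrite (homM cH) (conv_mul_r SM_hom (inGL_hom q N) _ IHv) IHu.
  by rewrite (homM eH) rmorphM.
Qed.

(** det is group-like with counit 1, so the convolution identity reads S(det) det = 1. *)
Lemma SM_det : SM det = detV.
Proof.
have := SM_convl det; rewrite (comulM_det N qU q2U) (counitM_det N qU) algmap1.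
rewrite (tlift_pure (conv_bal_l SM_hom (inGL_hom q N))) => e.
by rewrite -[LHS]mulr1 -(det_detV q N) mulrA e mul1r.
Qed.

Definition SGL : OGL -> OGL := @adjoin_lift A OM det OGL^c SM (inGL det).

Lemma SGL_rel : @GRing.mul OGL^c (SM det) (inGL det) = 1 /\
  @GRing.mul OGL^c (inGL det) (SM det) = 1.
Proof.
rewrite SM_det; split; first exact: det_detV.
exact: detV_det.
Qed.
Lemma SGL_hom : @is_alg_hom A OGL OGL^c SGL.
Proof. exact: adjoin_lift_hom SM_hom SGL_rel.1 SGL_rel.2. Qed.
Lemma SGL_in h : SGL (inGL h) = SM h.
Proof. exact: (adjoin_lift_in SM_hom SGL_rel.1 SGL_rel.2). Qed.
Lemma SGL_detV : SGL detV = inGL det.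
Proof. exact: (adjoin_lift_invb SM_hom SGL_rel.1 SGL_rel.2). Qed.

Lemma id_alg_hom (U : pzAlgType A) : is_alg_hom (@id U). Proof. by []. Qed.

(** [antipode] is picked by choice among the maps satisfying [is_antipode]; an explicit one shows
    that the choice does not fall back on its default. Products are handled by [conv_mul_l] and
    [conv_mul_r]. *)
Lemma SGL_antipode : is_antipode SGL.
Proof.
have cH := comulGL_hom N qU q2U; have eH := counitGL_hom N qU.
have iH := id_alg_hom OGL.
split.
- split=> [u v|a u]; first exact: (homD SGL_hom).
  rewrite /ascale (anti_mul SGL_hom) (homA SGL_hom).
  exact: esym (algmapC _ _).
- have bal := conv_bal_l SGL_hom iH.
  elim/presented_ind=> [a|[h|]|u v IHu IHv|u v IHu IHv].
  + rewrite (homA cH) algmap_tensor (tlift_pure bal) (homA eH) mulr1.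
    exact: (homA SGL_hom).
  + rewrite -[pgen _ _]/(inGL h) (comulGL_in qU q2U) (counitGL_in qU) -SM_convl.
    apply: (@tlift_eq _ _ _ _ (fun t => tlift _ (tmap inGL inGL t))) => [s t|s t|u v].
    * by rewrite (tmapD (inGL_hom q N) (inGL_hom q N)) (tliftD bal).
    * exact: tliftD (conv_bal_l SM_hom (inGL_hom q N)) _ _.
    rewrite (tmap_pure (inGL_hom q N) (inGL_hom q N)) (tlift_pure bal) SGL_in.
    by rewrite (tlift_pure (conv_bal_l SM_hom (inGL_hom q N))).
  + rewrite -[pgen _ _]/detV (comulGL_detV N qU q2U) (counitGL_detV N qU).
    by rewrite (tlift_pure bal) SGL_detV det_detV algmap1.
  + by rewrite (homD cH) (tliftD bal) IHu IHv (homD eH) rmorphD.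
  + by rewrite (homM cH) (conv_mul_l SGL_hom iH _ IHu) IHv (homM eH) rmorphM.
- have bal := conv_bal_r SGL_hom iH.
  elim/presented_ind=> [a|[h|]|u v IHu IHv|u v IHu IHv].
  + rewrite (homA cH) algmap_tensor (tlift_pure bal) (homA eH).
    by rewrite (hom1 SGL_hom) mulr1.
  + rewrite -[pgen _ _]/(inGL h) (comulGL_in qU q2U) (counitGL_in qU) -SM_convr.
    apply: (@tlift_eq _ _ _ _ (fun t => tlift _ (tmap inGL inGL t))) => [s t|s t|u v].
    * by rewrite (tmapD (inGL_hom q N) (inGL_hom q N)) (tliftD bal).
    * exact: tliftD (conv_bal_r SM_hom (inGL_hom q N)) _ _.
    rewrite (tmap_pure (inGL_hom q N) (inGL_hom q N)) (tlift_pure bal) SGL_in.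
    by rewrite (tlift_pure (conv_bal_r SM_hom (inGL_hom q N))).
  + rewrite -[pgen _ _]/detV (comulGL_detV N qU q2U) (counitGL_detV N qU).
    by rewrite (tlift_pure bal) SGL_detV detV_det algmap1.
  + by rewrite (homD cH) (tliftD bal) IHu IHv (homD eH) rmorphD.
  + by rewrite (homM cH) (conv_mul_r SGL_hom iH _ IHv) IHu (homM eH) rmorphM.
Qed.

Lemma is_antipode_antipode : is_antipode (@antipode A q N).
Proof.
apply: (@xgetPex _ (fun=> 0) [set S | is_antipode S]).
by exists SGL; apply: SGL_antipode.
Qed.

(* Both maps send the matrix of words of length n to its inverse.              *)
Lemma antipode_in h : antipode (inGL h) = SM h.
Proof.
have [[SD SZ] Sl _] := is_antipode_antipode.
have S0 : @antipode A q N 0 = 0.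
  by apply: (@addrI _ (@antipode A q N 0)); rewrite -SD !addr0.
have iH := inGL_hom q N.
elim: (OM_span h) => [|u v _ IHu _ IHv|a u uW].
- by rewrite (hom0 iH) S0 (hom0 SM_hom).
- by rewrite (homD iH) SD IHu IHv (homD SM_hom).
rewrite (homM iH) (homA iH) (SZ a) SMM (homA SM_hom) -[RHS]algmapC.
congr (_ * _).
have [n [I [J ->]]] := wordM_zs uW.
pose X (I J : idx N n) := inGL (zs x (iseq I) (iseq J)).
pose S1 (I J : idx N n) := @antipode A q N (X I J).
pose S2 (I J : idx N n) := SM (zs x (iseq I) (iseq J)).
have zs_counit (I' J' : idx N n) :
    counitM (zs x (iseq I') (iseq J')) = (I' == J')%:R.
  rewrite (zs_hom _ _ _ (counitM_hom N qU)).
  rewrite (_ : (fun i j => _) = (fun i j => if i == j then 1 else 0)).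
    rewrite zs_diag (inj_eq (@iseq_inj N n)) big1 //.
    by case: (I' == J').
  apply/funext => i; apply/funext => j; rewrite (counitM_xM qU).
  by case: (i == j).
suff : S1 = S2 by move=> /(congr1 (fun M => M I J)).
apply: (@mm_inv_uniq _ _ X).
  apply/funext => I'; apply/funext => J'.
  have bal : balanced (fun h1 h2 => @antipode A q N h1 * h2).
    split=> [u' v w|u' v w|b v w].
    - by rewrite SD mulrDl.
    - by rewrite mulrDr.
    - by rewrite SZ /ascale -mulrA [RHS]mulrA -algmapC mulrA.
  have := Sl (X I' J'); rewrite (counitGL_in qU) zs_counit.
  rewrite (comulGL_in qU q2U) (comulM_zs qU) (hom_sum (tmap_hom iH iH)).
  rewrite (tlift_sum bal) rmorph_nat => e; apply: etrans e; apply: eq_bigr => K _.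
  by rewrite (tmap_pure iH iH) (tlift_pure bal).
apply/funext => I'; apply/funext => J'.
have := SM_convr (zs x (iseq I') (iseq J')).
rewrite zs_counit rmorph_nat => e; apply: etrans e.
have bal := conv_bal_r SM_hom iH.
rewrite (comulM_zs qU) (tlift_sum bal); apply: eq_bigr => K _.
by rewrite (tlift_pure bal).
Qed.
End Inverse.
End Antipode.

(** * The co-orbit map *)

Section Coorbit.
Variables (A : comUnitRingType) (q : A) (N : nat).
Hypotheses (qU : q \is a GRing.unit) (q2U : 1 + q ^+ 2 \is a GRing.unit).

Local Notation x := (@xM A q N).
Local Notation OM := (OM q N).
Local Notation OGL := (OGL q N).
Local Notation OD := (OD A N).
Local Notation inGL := (@inGL A q N).
Local Notation det := (qdet q N).
Local Notation detV := (qdetV q N).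
Local Notation xGL := (@xGL A q N).

Variable y : 'I_N -> 'I_N -> OGL.
Hypotheses (xy : mm xGL y = mid) (yx : mm y xGL = mid).
Local Notation SM := (SM y).

Variable xi : 'M[A]_N.
Hypothesis xi_diag : is_diag_mx xi.

Lemma xi_diagE i j : xi i j = if i == j then xi i i else 0.
Proof.
case: eqP => [->//|/eqP ij]; have /is_diag_mxP := xi_diag; apply.
by apply: contra_neq ij => /val_inj.
Qed.

Lemma ev_satisfies : satisfies (@qmat_rel A q N) (fun g => xi g.1 g.2 : A^o).
Proof.
apply/(qmat_satisfies qU (fun g => xi g.1 g.2 : A^o)).
have := @qrel_diag A q N qU A^o (fun i => xi i i) (fun i j => mulrC _ _).
by congr (qrel q _); apply/funext => i; apply/funext => j; rewrite /= [RHS]xi_diagE.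
Qed.

Lemma ev_hom : is_alg_hom (@ev A q N xi).
Proof. exact: plift_alg_hom ev_satisfies. Qed.
Lemma ev_xM i j : @ev A q N xi (x i j) = xi i j.
Proof. exact: (plift_pgen ev_satisfies). Qed.

Let ev_act (h : OM) (g : OGL) : OGL := (ev xi h : A) *%: g.
Let twist (h3 h1 h2 : OM) : tensor OM OGL := tpure h2 (SM h1 * inGL h3).
Let contract (h12 : tensor OM OM) (h3 : OM) := tlift (twist h3) h12.
(** What the co-orbit map does after the iterated comultiplication, as a map on the threefold tensor
    product, where it can be computed on pure tensors. *)
Let coorbit2 (t : tensor (tensor OM OM) OM) := tlift ev_act (tlift contract t).

Lemma coorbitE h : coorbit q xi h = coorbit2 (tmap (@comulM A q N) id (comulM h)).
Proof.
rewrite /coorbit /betaM /coorbit2 /contract /twist.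
congr (tlift _ (tlift _ _)); apply/funext => h12; apply/funext => h3.
congr (tlift _ _); apply/funext => h1; apply/funext => h2.
by rewrite (antipode_in qU q2U xy yx).
Qed.

Let ev_act_bal : balanced ev_act.
Proof.
split=> [u u' v|u v v'|a u v]; rewrite /ev_act /ascale.
- by rewrite (homD ev_hom) rmorphD mulrDl.
- by rewrite mulrDr.
- by rewrite (homM ev_hom) (homA ev_hom) [X in algmap X * _]mulrC rmorphM -mulrA.
Qed.

Let twist_bal h3 : balanced (twist h3).
Proof.
have SH := SM_hom qU xy yx.
split=> [u u' v|u v v'|a u v]; rewrite /twist.
- by rewrite (homD SH) mulrDl tpureDr.
- by rewrite tpureDl.
- rewrite tpureZ {1}/ascale (SMM qU xy yx) (homA SH); congr tpure.
  by rewrite -[_ * algmap a]algmapC -mulrA.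
Qed.

Let contract_bal : balanced contract.
Proof.
split=> [u u' v|u v v'|a u v]; rewrite /contract.
- exact: tliftD (twist_bal _) _ _.
- rewrite /tlift -big_split; apply: eq_bigr => p _.
  by rewrite /twist (homD (inGL_hom q N)) mulrDr tpureDr.
- pose Z t := (a *%: t : tensor OM OM).
  apply: (@tlift_eq _ _ _ _ (fun t => tlift (twist v) (Z t))) => [s t|s t|h1 h2].
  + by rewrite /Z /ascale mulrDr (tliftD (twist_bal _)).
  + exact: tliftD (twist_bal _) _ _.
  rewrite /Z /ascale algmap_mul_tpurer !(tlift_pure (twist_bal _)) /twist.
  by rewrite -[algmap a * h2]/(a *%: h2) tpureZ (homZ (inGL_hom q N)) ascaleAr.
Qed.

Let coorbit2D s t : coorbit2 (s + t) = coorbit2 s + coorbit2 t.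
Proof. by rewrite /coorbit2 (tliftD contract_bal) (tliftD ev_act_bal). Qed.
Let coorbit2_0 : coorbit2 0 = 0.
Proof. by apply: (@addrI _ (coorbit2 0)); rewrite -coorbit2D !addr0. Qed.

Let coorbit2_pure h1 h2 h3 : coorbit2 (tpure (tpure h1 h2) h3)
  = algmap (ev xi h2 : A) * (SM h1 * inGL h3).
Proof.
by rewrite /coorbit2 (tlift_pure contract_bal) /contract
  (tlift_pure (twist_bal _)) (tlift_pure ev_act_bal).
Qed.

(** S reverses products, so a right factor of the argument wraps around the value, with S(h_1) on
    its left and h_3 on its right. *)
Let coorbit2_mul t h1 h2 h3 : coorbit2 (t * tpure (tpure h1 h2) h3)
  = algmap (ev xi h2 : A) * (SM h1 * coorbit2 t * inGL h3).
Proof.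
elim/tensor_ind: t => [|s t IHs IHt|t g3].
- by rewrite mul0r coorbit2_0 mulr0 mul0r mulr0.
- by rewrite mulrDl !coorbit2D IHs IHt !(mulrDr, mulrDl).
rewrite tpureM.
elim/tensor_ind: t => [|s t IHs IHt|g1 g2].
- by rewrite mul0r !tpure0l coorbit2_0 mulr0 mul0r mulr0.
- by rewrite mulrDl !tpureDl !coorbit2D IHs IHt !(mulrDr, mulrDl).
rewrite tpureM !coorbit2_pure (homM ev_hom) (SMM qU xy yx) (homM (inGL_hom q N)).
rewrite mulrC rmorphM -!mulrA; congr (_ * _).
by rewrite [LHS]mulrA [algmap _ * SM _]algmapC -!mulrA.
Qed.

Lemma coorbitD h h' : coorbit q xi (h + h') = coorbit q xi h + coorbit q xi h'.
Proof.
have cH := comulM_hom N qU.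
by rewrite !coorbitE (homD cH) (tmapD cH (id_alg_hom OM)) coorbit2D.
Qed.

(** The iterated coproduct of x_ij is the sum of x_ik (x) x_kl (x) x_lj, and evaluation at the
    diagonal xi keeps only l = k. *)
Lemma coorbit_mulx h i j : coorbit q xi (h * x i j)
  = \sum_k algmap (xi k k) * (y i k * coorbit q xi h * xGL k j).
Proof.
have cH := comulM_hom N qU; have iH := id_alg_hom OM.
rewrite !coorbitE (homM cH) (homM (tmap_hom cH iH)) (comulM_xM qU).
rewrite (hom_sum (tmap_hom cH iH)) mulr_sumr.
rewrite (big_morph _ coorbit2D coorbit2_0); apply: eq_bigr => k _.
rewrite (tmap_pure cH iH) (comulM_xM qU) tpure_suml mulr_sumr.
rewrite (big_morph _ coorbit2D coorbit2_0) (bigD1 k) //= big1 => [|l lk].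
  by rewrite addr0 coorbit2_mul ev_xM (SM_xM qU xy yx).
by rewrite coorbit2_mul ev_xM xi_diagE (negPf lk) rmorph0 mul0r.
Qed.

Lemma coorbitA (a : A) : coorbit q xi (algmap a) = algmap a.
Proof.
have cH := comulM_hom N qU; have iH := id_alg_hom OM.
rewrite coorbitE (homA cH) (homA (tmap_hom cH iH)) !algmap_tensor coorbit2_pure.
rewrite (homA (SM_hom qU xy yx)) (hom1 ev_hom) (hom1 (inGL_hom q N)).
by rewrite rmorph1 mul1r mulr1.
Qed.

Lemma coorbitZ (a : A) h : coorbit q xi (algmap a * h) = algmap a * coorbit q xi h.
Proof.
have cH := comulM_hom N qU; have iH := id_alg_hom OM.
rewrite !coorbitE (homM cH) (homM (tmap_hom cH iH)) (homA cH).
rewrite (homA (tmap_hom cH iH)) algmapC !algmap_tensor coorbit2_mul.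
rewrite (homA (SM_hom qU xy yx)) (hom1 ev_hom) (hom1 (inGL_hom q N)).
by rewrite rmorph1 mul1r mulr1.
Qed.

Local Notation Im := (range (coorbit q xi)).

Lemma Im_D u v : Im u -> Im v -> Im (u + v).
Proof. by move=> [h _ <-] [h' _ <-]; exists (h + h') => //; rewrite coorbitD. Qed.
Lemma Im_Z a u : Im u -> Im (algmap a * u).
Proof. by move=> [h _ <-]; exists (algmap a * h) => //; rewrite coorbitZ. Qed.
Lemma Im_1 : Im 1.
Proof. by exists 1 => //; rewrite -[1](rmorph1 (@algmap A OM)) coorbitA rmorph1. Qed.
Lemma Im_T i j u : Im u -> Im (\sum_k algmap (xi k k) * (y i k * u * xGL k j)).
Proof. by move=> [h _ <-]; exists (h * x i j) => //; rewrite coorbit_mulx. Qed.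
End Coorbit.

(** * Straightening and torus weights *)

Section Straightening.
Variables (A : comUnitRingType) (q : A) (N : nat) (B : pzAlgType A).
Hypothesis qU : q \is a GRing.unit.
Variables x y : 'I_N -> 'I_N -> B.
Hypotheses (xR : qrel q x) (xy : mm x y = mid) (yx : mm y x = mid).

Lemma sum_xy i j : \sum_k x i k * y k j = (i == j)%:R.
Proof. by rewrite -[LHS]/(mm x y i j) xy. Qed.
Lemma sum_yx i j : \sum_k y i k * x k j = (i == j)%:R.
Proof. by rewrite -[LHS]/(mm y x i j) yx. Qed.

Local Notation al i j := (algmap (q ^+ (1 + (i == j :> 'I_N))) : B).
Local Notation be i j := (algmap ((q ^+ 2 - 1) *+ ((i : 'I_N) < (j : 'I_N))%N) : B).

(* The R-matrix relation R X1 X2 = X1 X2 R rewritten as                        *)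
(* X1^-1 R X1 = X2 R X2^-1.                                                    *)
Lemma cross_relation a b c d :
  al d b * (y a d * x b c) + (b == d)%:R * (\sum_p be p b * (y a p * x p c))
  = al c a * (x b c * y a d) + (a == c)%:R * (\sum_t be c t * (x b t * y t d)).
Proof.
have E p t : al p b * (x b c * x p t) + be p b * (x p c * x b t)
           = al c t * (x p t * x b c) + be c t * (x p c * x b t).
  have := congr1 (fun M => M (p, b) (c, t)) xR.
  by rewrite rmat_mull rmat_mulr.
pose L := \sum_p y a p *
  \sum_t (al p b * (x b c * x p t) + be p b * (x p c * x b t)) * y t d.
pose R := \sum_p y a p *
  \sum_t (al c t * (x p t * x b c) + be c t * (x p c * x b t)) * y t d.
have : L = R.
  by apply: eq_bigr => p _; congr (_ * _); apply: eq_bigr => t _; rewrite E.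
have -> : L = al d b * (y a d * x b c)
    + (b == d)%:R * (\sum_p be p b * (y a p * x p c)).
  rewrite /L; under eq_bigr => p _.
    under eq_bigr => t _ do rewrite mulrDl -!mulrA.
    rewrite big_split /= -!mulr_sumr !sum_xy mulrDr.
    rewrite !(mulrA (y a p)) -!(algmapC _ (y a p)) -!mulrA.
    rewrite (mulrA (y a p)) (mulrA (y a p)).
    over.
  rewrite big_split /=; congr (_ + _).
    rewrite (bigD1 d) //= eqxx mulr1 big1 ?addr0 // => p /negPf->.
    by rewrite !mulr0.
  case: (b == d); last by rewrite mul0r big1 // => p _; rewrite !mulr0.
  by rewrite mul1r; apply: eq_bigr => p _; rewrite !mulr1.
rewrite {}/L.
have -> : R = al c a * (x b c * y a d)
    + (a == c)%:R * (\sum_t be c t * (x b t * y t d)).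
  rewrite /R; under eq_bigr => p _ do rewrite mulr_sumr.
  rewrite exchange_big /=; under eq_bigr => t _.
    under eq_bigr => p _.
      rewrite mulrDl mulrDr -!mulrA.
      rewrite !(mulrA (y a p) (algmap _)) -!(algmapC _ (y a p)) -!mulrA.
      rewrite (mulrA (y a p)) (mulrA (y a p) (x p c)).
      over.
    rewrite big_split /= -!mulr_sumr -!mulr_suml !sum_yx.
    over.
  rewrite big_split /=; congr (_ + _).
    rewrite (bigD1 a) //= eqxx mul1r big1 ?addr0 // => t ta.
    by rewrite [a == t]eq_sym (negPf ta) mul0r mulr0.
  case: (a == c); last by rewrite mul0r big1 // => t _; rewrite mul0r mulr0.
  by rewrite mul1r; apply: eq_bigr => t _; rewrite mul1r.
by [].
Qed.

(** [cross_relation] expresses x_bc y_ad by products of the form yx, up to terms x_bt y_td with t >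
    c that appear only if a = c. Descending induction on c removes these. *)
Lemma straighten a b c d :
  lspan (fun w => exists i j k l, w = y i j * x k l) (x b c * y a d).
Proof.
set Q := lspan _.
have QD u v : Q u -> Q v -> Q (u + v) by apply: lspanD.
have QN u : Q u -> Q (- u).
  by rewrite -[- u]mulN1r -(rmorphN1 (@algmap A B)); apply: lspan_scale.
have Qyx i j k l : Q (y i j * x k l) by apply: lspan_in; exists i, j, k, l.
have QL a' b' c' d' : Q (al d' b' * (y a' d' * x b' c')
    + (b' == d')%:R * (\sum_p be p b' * (y a' p * x p c'))).
  apply: QD; first by apply: lspan_scale; apply: Qyx.
  rewrite -(rmorph_nat (@algmap A B)); apply: lspan_scale.
  by apply: lspan_sum => p _; apply: lspan_scale; apply: Qyx.
have alU (e : bool) : q ^+ (1 + e) \is a GRing.unit by rewrite unitrX.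
have solve (e : bool) u : Q (algmap (q ^+ (1 + e)) * u) -> Q u.
  move=> /(lspan_scale (q ^+ (1 + e))^-1).
  by rewrite mulrA -algmapM mulVr // algmap1 mul1r.
move: {2}(N - c)%N (leqnn (N - c)) => n; elim: n a b c d => [|n IHn] a b c d.
  by rewrite leqn0 subn_eq0 leqNgt ltn_ord.
move=> cn; have := QL a b c d; rewrite cross_relation.
have [->|ac] := eqVneq a c; last by rewrite mul0r addr0; apply: solve.
rewrite mul1r => Qs; apply: (solve true).
rewrite -[_ * _](addrK (\sum_t be c t * (x b t * y t d))).
apply: (QD _ _ Qs); apply: QN; apply: lspan_sum => t _.
case: (ltnP c t) => ct; last by rewrite mulr0n rmorph0 mul0r; apply: lspan0.
apply: lspan_scale; apply: IHn.
rewrite -ltnS; apply: leq_trans cn; rewrite ltn_sub2l //.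
Qed.

(** The weights of the quantum trace: up to an overall power of q, the diagonal of the matrix
    usually written q^(2 rho). *)
Definition qweight (t : nat) : A := q ^+ (2 * (N - t.+1)).

(** The sum telescopes, since (q^2 - 1) [qweight c] = q^(2(N - c)) - q^(2(N - c - 1)). *)
Lemma qweight_sum (t : 'I_N) :
  q ^+ 2 * qweight t + \sum_(c < N) (q ^+ 2 - 1) *+ (c < t)%N * qweight c
  = q ^+ (2 * N).
Proof.
have -> : \sum_(c < N) (q ^+ 2 - 1) *+ (c < t)%N * qweight c
        = \sum_(c < t) (q ^+ 2 - 1) * qweight c.
  rewrite (big_ord_widen N (fun c => (q ^+ 2 - 1) * qweight c) (ltnW (ltn_ord t))).
  rewrite [RHS]big_mkcond; apply: eq_bigr => c _.
  by case: ifP => _; rewrite ?mulr1n // mulr0n mul0r.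
have W m : (m < N)%N -> q ^+ 2 * qweight m = q ^+ (2 * (N - m)).
  by move=> mN; rewrite /qweight -exprD -[in LHS]mulnS subnSK.
rewrite W //; have : (t <= N)%N by apply: ltnW.
elim: (t : nat) => [|m IHm] mN; first by rewrite big_ord0 addr0 subn0.
rewrite big_ord_recr /= -[RHS](IHm (ltnW mN)) mulrBl mul1r W // /qweight.
by rewrite addrCA [in RHS]addrC; congr (_ + _); rewrite addrC subrK.
Qed.

(* Setting a = c in cross_relation and summing over c with the weights         *)
(* qweight c, which make the coefficients of its right-hand side constant.     *)
Lemma qtrace (p r : 'I_N) :
  \sum_(i < N) algmap (qweight i) * (y i p * x r i) = (p == r)%:R * algmap (qweight p).
Proof.
pose Z (p r : 'I_N) := \sum_(i < N) algmap (qweight i) * (y i p * x r i).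
have E b d : al d b * Z d b + (b == d)%:R * (\sum_p be p b * Z p p)
             = (b == d)%:R * algmap (q ^+ (2 * N)).
  pose L := \sum_(c < N) algmap (qweight c) * (al d b * (y c d * x b c)
    + (b == d)%:R * (\sum_p be p b * (y c p * x p c))).
  pose R := \sum_(c < N) algmap (qweight c) * (al c c * (x b c * y c d)
    + (c == c)%:R * (\sum_t be c t * (x b t * y t d))).
  have : L = R by apply: eq_bigr => c _; rewrite cross_relation.
  have -> : L = al d b * Z d b + (b == d)%:R * (\sum_p be p b * Z p p).
    rewrite /L; under eq_bigr => c _ do rewrite mulrDr.
    rewrite big_split /=; congr (_ + _).
      rewrite /Z mulr_sumr; apply: eq_bigr => c _.
      by rewrite !mulrA -!algmapM mulrC.
    case: (b == d); last by rewrite mul0r big1 // => c _; rewrite mul0r mulr0.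
    rewrite mul1r; under eq_bigr => c _ do rewrite mul1r mulr_sumr.
    rewrite exchange_big /=; apply: eq_bigr => c _; rewrite /Z mulr_sumr.
    by apply: eq_bigr => c' _; rewrite !mulrA -!algmapM mulrC.
  move=> ->; rewrite /R.
  under eq_bigr => c _ do rewrite eqxx mul1r mulrDr mulr_sumr.
  rewrite big_split /= exchange_big -big_split /=.
  rewrite -(sum_xy b d) mulr_suml; apply: eq_bigr => t _.
  rewrite -[RHS]algmapC -(qweight_sum t) rmorphD mulrDl.
  rewrite rmorph_sum mulr_suml; congr (_ + _); first by rewrite mulrA -algmapM mulrC.
  by apply: eq_bigr => c _; rewrite mulrA -algmapM mulrC.
rewrite -/(Z p r); have [->|pr] := eqVneq p r; last first.
  have := E r p; rewrite (negPf pr) eq_sym (negPf pr) !mul0r addr0 addn0 expr1.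
  by move=> e; apply: (algmap_unitI qU); rewrite e mulr0.
(* [E r r] determines Z r r from the Z p p with p < r, hence an induction on a bound for r. *)
rewrite mul1r; move: {2}(r : nat) (leqnn r) => n.
elim: n r => [|n IHn] r rn; have := E r r; rewrite eqxx !mul1r.
all: rewrite -(qweight_sum r) rmorphD rmorph_sum.
  rewrite !big1 => [|c _|c _]; try by rewrite leqn0 in rn; rewrite (eqP rn) ltn0 ?mul0r ?rmorph0 ?mul0r.
  rewrite !addr0 => e; apply: (algmap_unitI (unitrX 2 qU)).
  by rewrite -algmapM; apply: e.
have -> : \sum_p0 be p0 r * Z p0 p0 = \sum_(c < N) algmap ((q ^+ 2 - 1) *+ (c < r)%N * qweight c).
  apply: eq_bigr => c _; case: (ltnP c r) => cr; last by rewrite !mulr0n mul0r rmorph0 mul0r.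
  by rewrite IHn ?algmapM // -ltnS (leq_trans cr).
move=> /addIr e; apply: (algmap_unitI (unitrX 2 qU)).
by rewrite -algmapM; apply: e.
Qed.
End Straightening.

Section Spanning.
Variables (A : comUnitRingType) (q : A) (N : nat).
Hypotheses (qU : q \is a GRing.unit) (q2U : 1 + q ^+ 2 \is a GRing.unit).

Local Notation x := (@xM A q N).
Local Notation OM := (OM q N).
Local Notation OGL := (OGL q N).
Local Notation inGL := (@inGL A q N).
Local Notation det := (qdet q N).
Local Notation detV := (qdetV q N).
Local Notation xGL := (@xGL A q N).

Variable y : 'I_N -> 'I_N -> OGL.
Hypotheses (xy : mm xGL y = mid) (yx : mm y xGL = mid).

Definition yprod (u : seq ('I_N * 'I_N)) : OGL := \prod_(p <- u) y p.1 p.2.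
Definition xprod (v : seq ('I_N * 'I_N)) : OGL := \prod_(p <- v) xGL p.1 p.2.
Definition yxword (w : OGL) := exists u v, w = yprod u * xprod v.

Lemma yxword_mull i j w : lspan yxword w -> lspan yxword (y i j * w).
Proof.
apply: lspan_mull => _ [u [v ->]]; apply: lspan_in; exists ((i, j) :: u), v.
by rewrite /yprod big_cons mulrA.
Qed.

Lemma yxword_mulrx i j w : lspan yxword w -> lspan yxword (w * xGL i j).
Proof.
apply: lspan_mulr => _ [u [v ->]]; apply: lspan_in; exists u, (rcons v (i, j)).
by rewrite /xprod big_rcons mulrA.
Qed.

(** The new y travels left through the x's by [straighten]; the x left behind at each exchange is
    multiplied back on the right. *)
Lemma yxword_mulry a d w : lspan yxword w -> lspan yxword (w * y a d).
Proof.
apply: lspan_mulr => _ [u [v ->]].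
elim: u => [|[i j] u IHu]; last first.
  by rewrite /yprod big_cons -!mulrA; apply: yxword_mull; rewrite mulrA.
rewrite /yprod big_nil mul1r.
elim/last_ind: v a d => [|v [b c] IHv] a d.
  rewrite /xprod big_nil mul1r; apply: lspan_in; exists [:: (a, d)], [::].
  by rewrite /yprod /xprod big_seq1 big_nil mulr1.
rewrite /xprod big_rcons /= -mulrA -/(xprod v).
apply: lspan_mull (straighten qU (xGL_qrel N qU) xy yx a b c d) => _ [i [j [k [l ->]]]].
by rewrite mulrA; apply: yxword_mulrx.
Qed.

Lemma yxword_mul u v : lspan yxword u -> lspan yxword v -> lspan yxword (u * v).
Proof.
move=> uS; apply: lspan_mull => _ [s [t ->]].
rewrite mulrA; elim/last_ind: t => [|t [i j] IHt]; last first.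
  by rewrite /xprod big_rcons /= mulrA; apply: yxword_mulrx.
rewrite /xprod big_nil mulr1; elim/last_ind: s => [|s [i j] IHs].
  by rewrite /yprod big_nil mulr1.
by rewrite /yprod big_rcons /= mulrA; apply: yxword_mulry.
Qed.

Lemma yxword_alg (a : A) : lspan yxword (algmap a).
Proof.
rewrite -[algmap a]mulr1; apply: lspanZ; exists [::], [::].
by rewrite /yprod /xprod !big_nil mulr1.
Qed.

(** The inverse of det is S(det), a polynomial in the y_ij, so all generators lie in the span, which
    is closed under products by [yxword_mul]. *)
Lemma OGL_span h : lspan yxword h.
Proof.
have S1 : lspan yxword 1 by rewrite -[1](rmorph1 (@algmap A OGL)); apply: yxword_alg.
elim/presented_ind: h => [a|[h|]|u v|u v].
- exact: yxword_alg.
- rewrite -[pgen _ _]/(inGL h); have iH := inGL_hom q N.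
  elim/presented_ind: h => [a|[i j]|u v uS vS|u v uS vS].
  + by rewrite (homA iH); apply: yxword_alg.
  + by rewrite -[inGL _]mul1r; apply: (yxword_mulrx i j).
  + by rewrite (homD iH); apply: lspanD.
  + by rewrite (homM iH); apply: yxword_mul.
- rewrite -[pgen _ _]/detV -(SM_det qU q2U xy yx).
  have SH := SM_hom qU xy yx.
  elim/presented_ind: det => [a|[i j]|u v uS vS|u v uS vS].
  + by rewrite (homA SH); apply: yxword_alg.
  + by rewrite -[pgen _ _]/(x i j) (SM_xM qU xy yx) -[y i j]mulr1; apply: yxword_mull.
  + by rewrite (homD SH); apply: lspanD.
  + by rewrite (SMM qU xy yx); apply: yxword_mul.
- exact: lspanD.
- exact: yxword_mul.
Qed.

Local Notation OD := (OD A N).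

Lemma tD_comm (g h : 'I_N + 'I_N) :
  pgen (@torus_rel A N) g * pgen (@torus_rel A N) h
  = pgen (@torus_rel A N) h * pgen (@torus_rel A N) g.
Proof. exact: (pgen_satisfies (torus_comm A g h)). Qed.

Lemma tDK (i : 'I_N) : tD A i * tDV A i = 1.
Proof.
by have /= := pgen_satisfies (torus_V A i); rewrite algmap1.
Qed.

Lemma tDVK (i : 'I_N) : tDV A i * tD A i = 1.
Proof. by rewrite [LHS]tD_comm; apply: tDK. Qed.

Lemma prod_mul_inv (B : pzRingType) I (r : seq I) (a b : I -> B) :
  (forall i, a i * b i = 1) -> (forall i j, b i * a j = a j * b i) ->
  (forall i j, b i * b j = b j * b i) ->
  (\prod_(i <- r) a i) * (\prod_(i <- r) b i) = 1.
Proof.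
move=> ab ba bb; elim: r => [|i r IHr]; first by rewrite !big_nil mulr1.
have bC : b i * \prod_(j <- r) a j = \prod_(j <- r) a j * b i.
  elim: r {IHr} => [|j r IHr]; first by rewrite !big_nil mulr1 mul1r.
  by rewrite !big_cons mulrA ba -mulrA IHr mulrA.
by rewrite !big_cons -mulrA (mulrA _ (b i)) -bC -mulrA IHr mulr1.
Qed.

Lemma piM_satisfies : satisfies (@qmat_rel A q N)
  (fun g => if g.1 == g.2 then tD A g.1 else 0).
Proof.
apply/(qmat_satisfies qU (fun g => if g.1 == g.2 then tD A g.1 else 0)).
by apply: (qrel_diag qU) => i j; apply: tD_comm.
Qed.

Lemma piM_hom : is_alg_hom (@piM A q N).
Proof. exact: plift_alg_hom piM_satisfies. Qed.
Lemma piM_xM i j : piM (x i j) = if i == j then tD A i else 0.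
Proof. exact: (plift_pgen piM_satisfies). Qed.

Lemma piM_det : piM det = \prod_(i < N) tD A i.
Proof.
rewrite qdetE (qd_hom q _ piM_hom) -(qd_diag q); congr (qd q _).
by apply/funext => i; apply/funext => j; rewrite piM_xM.
Qed.

Lemma piD_rel : piM det * \prod_(i < N) tDV A i = 1 /\
  \prod_(i < N) tDV A i * piM det = 1.
Proof.
rewrite piM_det; split; apply: prod_mul_inv => *; try exact: tD_comm.
  exact: tDK.
exact: tDVK.
Qed.

Lemma piD_hom : is_alg_hom (@piD A q N).
Proof. exact: adjoin_lift_hom piM_hom piD_rel.1 piD_rel.2. Qed.
Lemma piD_in h : piD (inGL h) = piM h.
Proof. exact: (adjoin_lift_in piM_hom piD_rel.1 piD_rel.2). Qed.

Definition Dcoact (f : OGL) := tmap (@piD A q N) id (comulGL f).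

Lemma Dcoact_hom : is_alg_hom Dcoact.
Proof. exact: alg_hom_comp (tmap_hom piD_hom (id_alg_hom OGL)) (comulGL_hom N qU q2U). Qed.

Lemma Dcoact_x i j : Dcoact (xGL i j) = tpure (tD A i) (xGL i j).
Proof.
have iH := inGL_hom q N.
rewrite /Dcoact (comulGL_in qU q2U) (comulM_xM qU) (hom_sum (tmap_hom iH iH)).
rewrite (hom_sum (tmap_hom piD_hom (id_alg_hom OGL))) (bigD1 i) //= big1.
  by rewrite addr0 (tmap_pure iH iH) (tmap_pure piD_hom (id_alg_hom OGL)) piD_in piM_xM eqxx.
move=> k ki; rewrite (tmap_pure iH iH) (tmap_pure piD_hom (id_alg_hom OGL)).
by rewrite piD_in piM_xM eq_sym (negPf ki) tpure0l.
Qed.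

(** The image of Y and the matrix of the t_k^-1 (x) y_ik are both inverse to the image of X, hence
    equal. *)
Lemma Dcoact_y i k : Dcoact (y i k) = tpure (tDV A k) (y i k).
Proof.
have DH := Dcoact_hom.
have hom_delta (i' j' : 'I_N) : Dcoact (i' == j')%:R = (i' == j')%:R.
  by case: (i' == j'); [exact: hom1 DH | exact: hom0 DH].
suff : (fun i k => Dcoact (y i k)) = (fun i k => tpure (tDV A k) (y i k)).
  by move=> /(congr1 (fun M => M i k)).
apply/esym/(@mm_inv_uniq _ _ (fun i j => tpure (tD A i) (xGL i j))).
  apply/funext => a; apply/funext => b; rewrite /mm.
  under eq_bigr => c _ do rewrite tpureM tDVK.
  by rewrite -tpure_sumr (sum_yx yx) /mid; case: (a == b); rewrite ?tpure0r.
apply/funext => a; apply/funext => b; rewrite /mm.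
under eq_bigr => c _ do rewrite -Dcoact_x -(homM DH).
by rewrite -(hom_sum DH) (sum_xy xy) hom_delta.
Qed.

(** In [coorbit_mulx] the factors y_ik and x_kj carry the weights t_k^-1 and t_k, which cancel;
    coinvariance thus passes from h to h x_ij. *)
Lemma coinvariant_Im (xi : 'M[A]_N) : is_diag_mx xi ->
  forall h, Dcoact (coorbit q xi h) = tpure 1 (coorbit q xi h).
Proof.
move=> xiD h; have DH := Dcoact_hom.
elim: (OM_span h) => [|u v _ IHu _ IHv|a u uW].
- rewrite -(rmorph0 (@algmap A OM)) (coorbitA qU q2U xy yx xiD) (homA DH).
  by rewrite algmap_tpure1.
- by rewrite (coorbitD qU q2U xy yx xiD) (homD DH) IHu IHv tpureDr.
rewrite (coorbitZ qU q2U xy yx xiD) (homM DH) (homA DH) -algmap_mul_tpurer.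
congr (_ * _); elim: uW => [|w i j _ IHw].
  rewrite -(rmorph1 (@algmap A OM)) (coorbitA qU q2U xy yx xiD) (homA DH).
  by rewrite algmap_tpure1.
rewrite (coorbit_mulx qU q2U xy yx xiD) (hom_sum DH) tpure_sumr.
apply: eq_bigr => k _; rewrite !(homM DH) IHw Dcoact_x Dcoact_y (homA DH).
rewrite -algmap_mul_tpurer; congr (_ * _).
by rewrite !tpureM mulr1 tDVK.
Qed.

Lemma Dcoact_word u v : Dcoact (yprod u * xprod v)
  = tpure ((\prod_(p <- u) tDV A p.2) * (\prod_(p <- v) tD A p.1))
          (yprod u * xprod v).
Proof.
have DH := Dcoact_hom.
rewrite (homM DH) (hom_prod DH) (hom_prod DH) -tpureM; congr (_ * _).
  rewrite /yprod; elim: u => [|p u IHu]; first by rewrite !big_nil.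
  by rewrite !big_cons IHu Dcoact_y tpureM.
rewrite /xprod; elim: v => [|p v IHv]; first by rewrite !big_nil.
by rewrite !big_cons IHv Dcoact_x tpureM.
Qed.

Variables (a : 'I_N -> A).
Hypothesis aU : forall i, a i \is a GRing.unit.

(** Evaluating the torus at a point turns the coaction into a linear operator [torus_act], which
    fixes coinvariants and has the words as eigenvectors. *)
Definition torus_pt : OD -> A^o :=
  plift (fun g => match g with inl i => a i : A^o | inr i => (a i)^-1 end).

Lemma torus_pt_satisfies : satisfies (@torus_rel A N)
  (fun g => match g with inl i => a i : A^o | inr i => (a i)^-1 end).
Proof.
move=> s t; case=> {s t} [g h|i] /=; first exact: mulrC.
by rewrite mulrV.
Qed.
Lemma torus_pt_hom : is_alg_hom torus_pt.
Proof. exact: plift_alg_hom torus_pt_satisfies. Qed.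
Lemma torus_pt_tD i : torus_pt (tD A i) = a i.
Proof. exact: (plift_pgen torus_pt_satisfies). Qed.
Lemma torus_pt_tDV i : torus_pt (tDV A i) = (a i)^-1.
Proof. exact: (plift_pgen torus_pt_satisfies). Qed.

Definition torus_act (f : OGL) : OGL :=
  tlift (fun d g => (torus_pt d : A) *%: g) (Dcoact f).

Lemma torus_act_bal : balanced (fun d (g : OGL) => (torus_pt d : A) *%: g).
Proof.
have tH := torus_pt_hom.
split=> [u u' v|u v v'|b u v]; rewrite /ascale.
- by rewrite (homD tH) rmorphD mulrDl.
- by rewrite mulrDr.
- by rewrite (homM tH) (homA tH) [X in algmap X * _]mulrC rmorphM -mulrA.
Qed.

Lemma torus_act_coinv f : Dcoact f = tpure 1 f -> torus_act f = f.
Proof.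
rewrite /torus_act => ->; rewrite (tlift_pure torus_act_bal).
by rewrite (hom1 torus_pt_hom) /ascale rmorph1 mul1r.
Qed.

Lemma torus_act_word u v : torus_act (yprod u * xprod v)
  = algmap ((\prod_(p <- u) (a p.2)^-1) * \prod_(p <- v) a p.1) * (yprod u * xprod v).
Proof.
rewrite /torus_act Dcoact_word (tlift_pure torus_act_bal).
have tH := torus_pt_hom.
rewrite (homM tH) !(hom_prod tH); congr (algmap (_ * _) * _).
  by apply: eq_bigr => p _; rewrite torus_pt_tDV.
by apply: eq_bigr => p _; rewrite torus_pt_tD.
Qed.

Lemma torus_act_sum I r (F : I -> OGL) (c : I -> A) :
  torus_act (\sum_(i <- r) algmap (c i) * F i)
  = \sum_(i <- r) algmap (c i) * torus_act (F i).
Proof.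
rewrite /torus_act (hom_sum Dcoact_hom) (tlift_sum torus_act_bal).
apply: eq_bigr => i _; rewrite (homM Dcoact_hom) (homA Dcoact_hom).
move: (Dcoact (F i)) => t.
apply: (@tlift_eq _ _ _ _ (fun t => tlift _ (algmap (c i) * t))
          (fun t => algmap (c i) * tlift _ t)) => [s s'|s s'|d g].
- by rewrite mulrDr (tliftD torus_act_bal).
- by rewrite (tliftD torus_act_bal) mulrDr.
rewrite algmap_mul_tpurer !(tlift_pure torus_act_bal) /ascale !mulrA.
by rewrite [algmap (c i) * _]algmapC.
Qed.
End Spanning.

(** * Endomorphisms of tensor powers *)

Section Cyc.
Variable N : nat.

(** Appends i as the last letter, the one innermost in Y_n M X_n; [uncyc] splits it off again. *)
Fixpoint cyc n (i : 'I_N) : idx N n -> idx N n.+1 :=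
  match n return idx N n -> idx N n.+1 with
  | 0 => fun=> (i, tt)
  | n'.+1 => fun I => (I.1, cyc i I.2)
  end.

Fixpoint uncyc n : idx N n.+1 -> 'I_N * idx N n :=
  match n return idx N n.+1 -> 'I_N * idx N n with
  | 0 => fun I => (I.1, tt)
  | n'.+1 => fun I => ((uncyc I.2).1, (I.1, (uncyc I.2).2))
  end.

Lemma cycK n i (I : idx N n) : uncyc (cyc i I) = (i, I).
Proof. by elim: n I => [[]|n IHn [j I]] //=; rewrite IHn. Qed.
Lemma uncycK n (I : idx N n.+1) : cyc (uncyc I).1 (uncyc I).2 = I.
Proof. by elim: n I => [[i []]|n IHn [j I]] //=; rewrite IHn. Qed.

Lemma iseq_cyc n i (I : idx N n) : iseq (cyc i I) = rcons (iseq I) i.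
Proof. by elim: n I => [[]|n IHn [j I]] //; rewrite -[RHS]/(j :: rcons (iseq I) i) -IHn. Qed.

Lemma sum_cyc (R : nmodType) n (F : idx N n.+1 -> R) :
  \sum_(I : idx N n.+1) F I = \sum_(i : 'I_N) \sum_(I : idx N n) F (cyc i I).
Proof.
elim: n F => [|n IHn] F.
  by rewrite sum_idxS; apply: eq_bigr => i _; rewrite !sum_idx0.
rewrite sum_idxS; under eq_bigr => j _ do rewrite (IHn (fun I => F (j, I))).
by rewrite exchange_big; apply: eq_bigr => i _; rewrite [RHS]sum_idxS.
Qed.
End Cyc.

(* The operations on End(V^(x)n) preserving the set of matrices M such that    *)
(* the entries of X^-1 M X, X the matrix of words of length n, lie in the      *)
(* image of the co-orbit map.                                                  *)
Section IdxOps.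
Variables (R : comPzRingType) (q : R) (N : nat) (d : 'I_N -> R).
Local Notation mat n := (idx N n -> idx N n -> R).

Definition op_head n (M : mat n) : mat n.+1 :=
  fun I J => (I.1 == J.1)%:R * d I.1 * M I.2 J.2.

Definition op_pre n (M : mat n) : mat n.+1 :=
  fun I J => ((uncyc I).1 == (uncyc J).1)%:R * M (uncyc I).2 (uncyc J).2.

(** The quantum partial trace over the last factor; the weights are those of [qweight], so that
    [qtrace] applies. *)
Definition op_tr n (M : mat n.+1) : mat n :=
  fun I J => \sum_(i < N) q ^+ (2 * (N - i.+1)) * M (cyc i I) (cyc i J).

(** The k-th Hecke generator, acting by [rmat] on the adjacent letters k and k + 1 counted from 0,
    and the identity if there is no such pair. The two letters enter in reverse order because [xw]
    multiplies later letters first. *)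
Fixpoint hec (n : nat) : nat -> mat n :=
  match n return nat -> mat n with
  | 0 => fun _ _ _ => 1
  | n'.+1 => fun k => match k with
    | 0 => match n' return mat n'.+1 with
      | 0 => fun I J => (I == J)%:R
      | n''.+1 => fun I J =>
         rmat q (I.2.1, I.1) (J.2.1, J.1) * (I.2.2 == J.2.2)%:R
      end
    | k'.+1 => fun I J => (I.1 == J.1)%:R * hec k' I.2 J.2
    end
  end.
End IdxOps.

Arguments hec {R} q {N} n k I J.

Section PhiDef.
Variables (A : comUnitRingType) (q : A) (N : nat) (B : pzAlgType A).
Hypothesis qU : q \is a GRing.unit.
Variables x y : 'I_N -> 'I_N -> B.
Hypotheses (xR : qrel q x) (xy : mm x y = mid) (yx : mm y x = mid).
Local Notation mat n := (idx N n -> idx N n -> A).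

(** The words are read backwards so that [xw] and [yw] are inverse matrices: in a product of [yw]
    with [xw] the last letters meet. *)
Definition xw n (I J : idx N n) : B := zs x (rev (iseq I)) (rev (iseq J)).
Definition yw n (I J : idx N n) : B := zs y (iseq I) (iseq J).

Lemma xwS n i (I : idx N n) j J :
  @xw n.+1 (i, I) (j, J) = xw I J * x i j.
Proof. by rewrite /xw /= !rev_cons zs_rcons. Qed.
Lemma ywS n i (I : idx N n) j J :
  @yw n.+1 (i, I) (j, J) = y i j * yw I J.
Proof. by []. Qed.
Lemma xw_cyc n i (I : idx N n) j J : xw (cyc i I) (cyc j J) = x i j * xw I J.
Proof. by rewrite /xw !iseq_cyc !rev_rcons. Qed.
Lemma yw_cyc n i (I : idx N n) j J : yw (cyc i I) (cyc j J) = yw I J * y i j.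
Proof. by rewrite /yw !iseq_cyc zs_rcons. Qed.

Lemma pair_delta (T1 T2 : eqType) (R : pzRingType) (a b : T1) (c d : T2) :
  ((a, c) == (b, d))%:R = (a == b)%:R * (c == d)%:R :> R.
Proof. by rewrite xpair_eqE; case: (a == b); rewrite ?mul1r ?mul0r. Qed.

Lemma xyw n : mm (@xw n) (@yw n) = mid.
Proof.
elim: n => [|n IHn]; apply/funext => -[].
  by apply/funext => -[]; rewrite /mm sum_idx0 mul1r.
move=> i I; apply/funext => -[j J].
have IHIJ : \sum_(K : idx N n) xw I K * yw K J = (I == J)%:R.
  by rewrite -[LHS]/(mm (@xw n) (@yw n) I J) IHn.
rewrite /mm sum_idxS exchange_big /= /mid pair_delta.
under eq_bigr => K _.
  under eq_bigr => k _ do rewrite xwS ywS -!mulrA (mulrA (x i k)).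
  rewrite -mulr_sumr -mulr_suml (sum_xy xy); over.
case: (i == j); last by rewrite big1 ?mul0r // => K _; rewrite mul0r mulr0.
by rewrite -IHIJ mul1r; apply: eq_bigr => K _; rewrite mul1r.
Qed.

Lemma yxw n : mm (@yw n) (@xw n) = mid.
Proof.
elim: n => [|n IHn]; apply/funext => -[].
  by apply/funext => -[]; rewrite /mm sum_idx0 mul1r.
move=> i I; apply/funext => -[j J].
have IHIJ : \sum_(K : idx N n) yw I K * xw K J = (I == J)%:R.
  by rewrite -[LHS]/(mm (@yw n) (@xw n) I J) IHn.
rewrite /mm sum_idxS /= /mid pair_delta.
under eq_bigr => k _.
  under eq_bigr => K _ do rewrite xwS ywS -!mulrA (mulrA (yw I K)).
  rewrite -mulr_sumr -mulr_suml IHIJ; over.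
case: (I == J); last by rewrite big1 ?mulr0 // => K _; rewrite mul0r mulr0.
under eq_bigr => k _ do rewrite mul1r.
by rewrite (sum_yx yx) mulr1.
Qed.

Definition Phi n (M : mat n) : idx N n -> idx N n -> B :=
  mm (@yw n) (mm (cmat M) (@xw n)).

Lemma PhiE n (M : mat n) I J : Phi M I J
  = \sum_(K : idx N n) \sum_(L : idx N n) yw I K * (algmap (M K L) * xw L J).
Proof. by rewrite /Phi /mm; apply: eq_bigr => K _; rewrite mulr_sumr. Qed.

Lemma PhiD n (M P : mat n) I J :
  Phi (fun I J => M I J + P I J) I J = Phi M I J + Phi P I J.
Proof.
rewrite !PhiE -big_split; apply: eq_bigr => K _.
rewrite -big_split; apply: eq_bigr => L _.
by rewrite rmorphD mulrDl mulrDr.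
Qed.

Lemma PhiZ n (c : A) (M : mat n) I J :
  Phi (fun I J => c * M I J) I J = algmap c * Phi M I J.
Proof.
rewrite !PhiE mulr_sumr; apply: eq_bigr => K _.
rewrite mulr_sumr; apply: eq_bigr => L _.
by rewrite rmorphM -(mulrA (algmap c)) !(mulrA _ (algmap c)) -algmapC -!mulrA.
Qed.

(** The first letter is outermost, so this is the recursion of [coorbit_mulx] with an entry of
    [Phi M] as the value. *)
Lemma Phi_head (d : 'I_N -> A) n (M : mat n) i I j J :
  Phi (op_head d M) (i, I) (j, J)
  = \sum_k algmap (d k) * (y i k * Phi M I J * x k j).
Proof.
rewrite PhiE sum_idxS; apply: eq_bigr => k _.
under eq_bigr => K _.
  rewrite sum_idxS (bigD1 k) //= [X in _ + X]big1 ?addr0; last first.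
    move=> l lk; rewrite big1 // => L _.
    by rewrite /op_head /= eq_sym (negPf lk) !mul0r rmorph0 mul0r mulr0.
  under eq_bigr => L _ do rewrite /op_head /= eqxx mul1r ywS xwS.
  over.
rewrite PhiE mulr_sumr mulr_suml mulr_sumr; apply: eq_bigr => K _.
rewrite mulr_sumr mulr_suml mulr_sumr; apply: eq_bigr => L _.
rewrite rmorphM -(mulrA (algmap (d k))) (mulrA _ (algmap (d k))) -algmapC.
by rewrite -!mulrA.
Qed.

(** The last letters meet in the middle with the identity between them, so their y and x cancel. *)
Lemma Phi_pre n (M : mat n) i I j J :
  Phi (op_pre M) (cyc i I) (cyc j J) = (i == j)%:R * Phi M I J.
Proof.
rewrite PhiE sum_cyc exchange_big PhiE mulr_sumr; apply: eq_bigr => K _ /=.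
under eq_bigr => k _.
  rewrite sum_cyc (bigD1 k) //= [X in _ + X]big1 ?addr0; last first.
    move=> l lk; rewrite big1 // => L _.
    by rewrite /op_pre /= !cycK /= eq_sym (negPf lk) !mul0r rmorph0 mul0r mulr0.
  under eq_bigr => L _ do rewrite /op_pre !cycK /= eqxx mul1r yw_cyc xw_cyc.
  over.
rewrite exchange_big mulr_sumr; apply: eq_bigr => L _ /=.
under eq_bigr => k _.
  rewrite -mulrA (mulrA _ (x k j)) [algmap _ * x k j]algmapC -mulrA (mulrA (y i k)).
  over.
rewrite -mulr_sumr -mulr_suml (sum_yx yx).
by case: (i == j); rewrite ?mul1r ?mul0r ?mulr0.
Qed.

Lemma mulA_ins (c : A) (u v w : B) :
  algmap c * (u * (v * w)) = u * (algmap c * v * w).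
Proof. by rewrite -!mulrA !(mulrA _ (algmap c)) -algmapC -!mulrA. Qed.

(** The last letter contributes y_ik x_li around an entry of M. By [qtrace] the weighted sum over i
    is the weight of k if k = l and 0 otherwise, which moves the trace onto M. *)
Lemma Phi_tr n (M : mat n.+1) I J :
  Phi (op_tr q M) I J
  = \sum_(i < N) algmap (q ^+ (2 * (N - i.+1))) * Phi M (cyc i I) (cyc i J).
Proof.
have RE i : Phi M (cyc i I) (cyc i J)
   = \sum_(K : idx N n) \sum_(L : idx N n) \sum_k \sum_l
       yw I K * ((y i k * x l i) * (algmap (M (cyc k K) (cyc l L)) * xw L J)).
  rewrite PhiE sum_cyc exchange_big; apply: eq_bigr => K _ /=.
  under eq_bigr => k _ do rewrite sum_cyc exchange_big /=.
  rewrite exchange_big; apply: eq_bigr => L _; apply: eq_bigr => k _.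
  apply: eq_bigr => l _; rewrite yw_cyc xw_cyc -mulrA; congr (_ * _).
  by rewrite -[RHS]mulrA; congr (_ * _); rewrite !mulrA algmapC.
under [RHS]eq_bigr => i _ do rewrite RE mulr_sumr.
rewrite exchange_big PhiE; apply: eq_bigr => K _ /=.
under [RHS]eq_bigr => i _ do rewrite mulr_sumr.
rewrite exchange_big; apply: eq_bigr => L _ /=.
under [RHS]eq_bigr => i _ do rewrite mulr_sumr.
rewrite exchange_big /= /op_tr rmorph_sum mulr_suml mulr_sumr.
apply: eq_bigr => k _.
under [RHS]eq_bigr => i _ do rewrite mulr_sumr.
rewrite exchange_big /= (bigD1 k) //= [X in _ + X]big1 ?addr0 => [|l lk].
  under [RHS]eq_bigr => i _.
    rewrite mulA_ins; over.
  rewrite -mulr_sumr -mulr_suml (qtrace qU xR xy yx) eqxx mul1r.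
  by rewrite rmorphM -!mulrA.
under eq_bigr => i _.
  rewrite mulA_ins; over.
rewrite -mulr_sumr -mulr_suml (qtrace qU xR xy yx) eq_sym (negPf lk).
by rewrite !mul0r mulr0.
Qed.

(** For k = 0 this is [xR] multiplied on the left by the monomial in the remaining letters; for
    larger k the first letter is a spectator on the right. *)
Lemma hec_xw n k : mm (cmat (@hec A q N n k)) (@xw n) = mm (@xw n) (cmat (@hec A q N n k)).
Proof.
have id_case m (c : mat m) : c = (fun I J => (I == J)%:R) ->
    mm (cmat c) (@xw m) = mm (@xw m) (cmat c).
  move=> ->; rewrite (_ : cmat _ = mid) ?mm1l ?mm1r //.
  by apply/funext => I; apply/funext => J; rewrite /cmat rmorph_nat.
elim: n k => [|n IHn] k.
  by apply: id_case; apply/funext => -[]; apply/funext => -[].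
case: k => [|k]; last first.
  apply/funext => -[i I]; apply/funext => -[j J].
  transitivity ((mm (cmat (hec q n k)) (@xw n)) I J * x i j).
    rewrite /mm sum_idxS (bigD1 i) //= [X in _ + X]big1 ?addr0.
      rewrite mulr_suml; apply: eq_bigr => K _.
      by rewrite /cmat /= eqxx mul1r xwS mulrA.
    move=> l li; rewrite big1 // => K _.
    by rewrite /cmat /= eq_sym (negPf li) mul0r rmorph0 mul0r.
  rewrite IHn /mm sum_idxS (bigD1 j) //= [X in _ + X]big1 ?addr0.
    rewrite mulr_suml; apply: eq_bigr => K _.
    by rewrite /cmat /= eqxx mul1r xwS -!mulrA algmapC.
  move=> l lj; rewrite big1 // => K _.
  by rewrite /cmat /= (negPf lj) mul0r rmorph0 mulr0.
case: n IHn => [|n] _; first exact: id_case.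
apply/funext => -[i1 [i2 I]]; apply/funext => -[j1 [j2 J]].
have E := congr1 (fun M => xw I J * M (i2, i1) (j2, j1)) xR.
apply: (etrans _ (etrans E _)).
  rewrite /mm sum_idxS mulr_sumr.
  rewrite -(pair_bigA _ (fun a b => xw I J * (cmat (rmat q) (i2, i1) (a, b) * ten2 x (a, b) (j2, j1)))) /=.
  rewrite [RHS]exchange_big; apply: eq_bigr => k1 _ /=.
  rewrite sum_idxS; apply: eq_bigr => k2 _.
  rewrite (bigD1 I) //= [X in _ + X]big1 ?addr0; last first.
    by move=> K KI; rewrite /cmat /= eq_sym (negPf KI) mulr0 rmorph0 mul0r.
  by rewrite /cmat /= eqxx mulr1 !xwS /ten2 /= -[in LHS]mulrA [LHS]mulrA [algmap _ * xw _ _]algmapC -mulrA.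
rewrite /mm sum_idxS mulr_sumr.
rewrite -(pair_bigA _ (fun a b => xw I J * (ten2 x (i2, i1) (a, b) * cmat (rmat q) (a, b) (j2, j1)))) /=.
rewrite [LHS]exchange_big; apply: eq_bigr => k1 _ /=.
rewrite sum_idxS; apply: eq_bigr => k2 _.
rewrite (bigD1 J) //= [X in _ + X]big1 ?addr0; last first.
  by move=> K KJ; rewrite /cmat /= (negPf KJ) mulr0 rmorph0 mulr0.
by rewrite /cmat /= eqxx mulr1 !xwS /ten2 /= -!mulrA.
Qed.

Lemma hec_yw n k : mm (cmat (@hec A q N n k)) (@yw n) = mm (@yw n) (cmat (@hec A q N n k)).
Proof. exact: mm_comm_inv (@xyw n) (@yxw n) (hec_xw n k). Qed.

Lemma cmat_mm n (M P : mat n) : cmat (mm M P) = mm (cmat M) (cmat P) :> (_ -> _ -> B).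
Proof.
apply/funext => I; apply/funext => J; rewrite /cmat /mm rmorph_sum.
by apply: eq_bigr => K _; rewrite rmorphM.
Qed.

Lemma Phi_row n k (M : mat n) :
  Phi (mm (hec q n k) M) = mm (cmat (hec q n k)) (Phi M).
Proof. by rewrite /Phi cmat_mm !mmA -[LHS]mmA -hec_yw mmA. Qed.
Lemma Phi_col n k (M : mat n) :
  Phi (mm M (hec q n k)) = mm (Phi M) (cmat (hec q n k)).
Proof. by rewrite /Phi cmat_mm !mmA hec_xw. Qed.
End PhiDef.

(** Adjacent swaps bring the first letter of t to the front of s, and the remaining letters are
    treated by induction behind a fixed prefix. *)
Lemma perm_swap_ind (T : eqType) (P : seq T -> Prop) :
  (forall s a b t, P (s ++ [:: a, b & t]) -> P (s ++ [:: b, a & t])) ->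
  forall s t, perm_eq s t -> P s -> P t.
Proof.
move=> swapP s t.
have front pre s1 b s2 : P (pre ++ s1 ++ b :: s2) -> P (pre ++ b :: s1 ++ s2).
  elim/last_ind: s1 s2 => [//|s1 a IHs1] s2.
  by rewrite !cat_rcons catA => /swapP; rewrite -catA => /IHs1.
suff H pre : perm_eq s t -> P (pre ++ s) -> P (pre ++ t) by apply: (H [::]).
elim: t pre s => [|b t IHt] pre s st; first by rewrite (perm_nilP st).
have bs : b \in s by rewrite (perm_mem st) mem_head.
case/splitPr: s / bs st => s1 s2 st /front.
rewrite -!cat_rcons; apply: IHt.
apply/seq.permP => p; have /seq.permP/(_ p) := st.
by rewrite !count_cat /= addnCA => /addnI.
Qed.

(** * Specialization at q = 1 *)

Section Classical.
Variables (K : fieldType) (N : nat) (xi : 'I_N -> K).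
Hypothesis xi_inj : injective xi.
Local Notation mat n := (idx N n -> idx N n -> K).
Variable E : forall n, mat n -> Prop.
Hypotheses (E1 : @E 0 (fun _ _ => 1))
  (ED : forall n (M P : mat n), E M -> E P -> E (fun I J => M I J + P I J))
  (EZ : forall n c (M : mat n), E M -> E (fun I J => c * M I J))
  (Ehead : forall n (M : mat n), E M -> E (op_head xi M))
  (Epre : forall n (M : mat n), E M -> E (op_pre M))
  (Etr : forall n (M : mat n.+1), E M -> E (op_tr 1 M))
  (Erow : forall n k (M : mat n), E M -> E (mm (hec 1 n k) M))
  (Ecol : forall n k (M : mat n), E M -> E (mm M (hec 1 n k))).

Fixpoint swp (n : nat) : nat -> idx N n -> idx N n :=
  match n return nat -> idx N n -> idx N n with
  | 0 => fun _ I => I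
  | n'.+1 => fun k => match k with
    | 0 => match n' return idx N n'.+1 -> idx N n'.+1 with
      | 0 => fun I => I
      | n''.+1 => fun I => (I.2.1, (I.1, I.2.2))
      end
    | k'.+1 => fun I => (I.1, swp k' I.2)
    end
  end.

Lemma swpK n k : involutive (@swp n k).
Proof.
elim: n k => [//|n IHn] [|k] /=; last by move=> [i I]; rewrite /= IHn.
by case: n {IHn} => [//|n] [i [j I]].
Qed.

(** At q = 1 the term with q^2 - 1 disappears and [rmat] becomes the flip. *)
Lemma hec_swp n k (I J : idx N n) : hec (1 : K) n k I J = (swp k I == J)%:R.
Proof.
elim: n k I J => [|n IHn] k; first by do 2!case.
case: k => [|k] /=; last by move=> [i I] [j J]; rewrite /= IHn pair_delta.
case: n {IHn} => [//|n] [i1 [i2 I]] [j1 [j2 J]] /=.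
rewrite /rmat /= !expr1n subrr mul0rn mulr0 addr0 mulr1 !pair_delta.
by rewrite (mulrC (i1 == j2)%:R) mulrA.
Qed.

Lemma iseq_swp n s a b t (I : idx N n) : iseq I = s ++ [:: a, b & t] ->
  iseq (swp (size s) I) = s ++ [:: b, a & t].
Proof.
elim: n s I => [|n IHn] [|c s] //= I.
  by case: n I {IHn} => [|n] //= [i [j I]] /= [-> -> ->].
by case=> -> /IHn ->.
Qed.

Lemma classical_swp_row n k (M : mat n) : E M -> E (fun I J => M (swp k I) J).
Proof.
move=> /(Erow k); congr (E _); apply/funext => I; apply/funext => J.
rewrite /mm; under eq_bigr => L _ do rewrite hec_swp.
exact: sum_delta_l.
Qed.

Lemma classical_swp_col n k (M : mat n) : E M -> E (fun I J => M I (swp k J)).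
Proof.
move=> /(Ecol k); congr (E _); apply/funext => I; apply/funext => J.
rewrite /mm; under eq_bigr => L _ do rewrite hec_swp.
rewrite -(sum_delta_r (swp k J) (M I)); apply: eq_bigr => L _.
by rewrite -(can_eq (@swpK n k) (swp k L)) swpK.
Qed.

(** Products of adjacent transpositions. Rows and columns of a matrix in E may be permuted by two of
    them independently, see [classical_adj]. *)
Inductive adj n : (idx N n -> idx N n) -> Prop :=
| adj_id : adj id
| adj_swp k : adj (@swp n k)
| adj_comp s t : adj s -> adj t -> adj (s \o t).

Lemma classical_adj n (s t : idx N n -> idx N n) (M : mat n) : adj s -> adj t ->
  E M -> E (fun I J => M (s I) (t J)).
Proof.
move=> sA tA EM.
have EC (P : mat n) : E P -> E (fun I J => P I (t J)).
  elim: tA P => {t} [|k|t u _ IHt _ IHu] P EP; first exact: EP.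
    exact: (classical_swp_col k EP).
  exact: (IHu _ (IHt _ EP)).
apply: (EC (fun I J => M (s I) J)).
elim: sA M EM => {s} [|k|s u _ IHs _ IHu] M EM; first exact: EM.
  exact: (classical_swp_row k EM).
exact: (IHu _ (IHs _ EM)).
Qed.

Lemma adj_lift n (s : idx N n -> idx N n) : adj s ->
  @adj n.+1 (fun I => (I.1, s I.2)).
Proof.
elim=> {s} [|k|s t _ IHs _ IHt].
- rewrite (_ : (fun _ => _) = id); first exact: adj_id.
  by apply/funext => -[].
- exact: (@adj_swp n.+1 k.+1).
- exact: adj_comp IHs IHt.
Qed.

Lemma adj_cyc n : adj (fun I : idx N n.+1 => cyc I.1 I.2).
Proof.
elim: n => [|n IHn].
  rewrite (_ : (fun _ => _) = id); first exact: adj_id.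
  by apply/funext => -[i []].
rewrite (_ : (fun _ => _) = (fun I : idx N n.+2 => (I.1, cyc I.2.1 I.2.2)) \o @swp n.+2 0).
  exact: adj_comp (adj_lift IHn) (@adj_swp n.+2 0).
by apply/funext => -[i [j I]].
Qed.

Lemma adj_uncyc n : adj (@uncyc N n : idx N n.+1 -> idx N n.+1).
Proof.
elim: n => [|n IHn].
  rewrite (_ : @uncyc N 0 = id :> (idx N 1 -> idx N 1)); first exact: adj_id.
  by apply/funext => -[i []].
rewrite (_ : @uncyc N n.+1 = @swp n.+2 0 \o (fun I => (I.1, uncyc I.2 : idx N n.+1))).
  exact: adj_comp (@adj_swp n.+2 0) (adj_lift IHn).
by apply/funext => -[i I].
Qed.

(** A cyclic shift of the letters moves the identity factor of [op_pre] from the last place to the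
    first. *)
Lemma classical_pre_head n (M : mat n) : E M ->
  @E n.+1 (fun I J => (I.1 == J.1)%:R * M I.2 J.2).
Proof.
move=> /Epre /(classical_adj (adj_cyc n) (adj_cyc n)); congr (E _).
by apply/funext => I; apply/funext => J; rewrite /op_pre !cycK.
Qed.

Lemma classical_tr_head n (M : mat n.+1) : E M ->
  @E n (fun I J => \sum_(i < N) M (i, I) (i, J)).
Proof.
move=> /(classical_adj (adj_uncyc n) (adj_uncyc n)) /Etr; congr (E _).
apply/funext => I; apply/funext => J; apply: eq_bigr => i _.
by rewrite expr1n mul1r !cycK.
Qed.

(* The partial trace of P_12 (xi (x) M) is xi_1 M.                             *)
Lemma classical_mul_head n (M : mat n.+1) : E M ->
  @E n.+1 (fun I J => xi I.1 * M I J).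
Proof.
move=> /Ehead /(classical_swp_row 0) /classical_tr_head; congr (E _).
apply/funext => -[i I]; apply/funext => J.
rewrite -[RHS](sum_delta_l i (fun k => xi k * M (k, I) J)).
by apply: eq_bigr => k _; rewrite /op_head /= -mulrA; case: eqVneq => [->|_] //; rewrite !mul0r.
Qed.

(** By induction 1 (x) E_{K0 K0} is available. [classical_mul_head] multiplies it by p(xi) acting on
    the first factor, where p is the Lagrange polynomial with roots xi_l for l different from k;
    dividing by p(xi_k), nonzero as the entries are distinct, isolates the first letter k. *)
Lemma classical_unit n (K0 : idx N n) : E (fun I J => (I == K0)%:R * (J == K0)%:R).
Proof.
elim: n K0 => [|n IHn] K0.
  move: E1; congr (E _); apply/funext => -[]; apply/funext => -[].
  by case: K0; rewrite mulr1.
case: K0 => k K0; have := classical_pre_head (IHn K0).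
set M := (fun _ => _) => EM.
pose p i := \prod_(l < N | l != k) (xi i - xi l).
have Ep : @E n.+1 (fun I J => p I.1 * M I J).
  rewrite /p; elim: (index_enum _) => [|l r IHr].
    by move: EM; congr (E _); apply/funext => I; apply/funext => J; rewrite big_nil mul1r.
  have [lk|lk] := boolP (l != k).
    have := ED (classical_mul_head IHr) (EZ (- xi l) IHr); congr (E _).
    apply/funext => I; apply/funext => J.
    by rewrite big_cons lk -mulrDl mulrA.
  by move: IHr; congr (E _); apply/funext => I; apply/funext => J; rewrite big_cons (negPf lk).
have pk0 : p k != 0.
  apply/prodf_neq0 => l lk; rewrite subr_eq0; apply: contra_neq lk.
  by move=> /xi_inj.
have := EZ (p k)^-1 Ep; congr (E _); apply/funext => -[i I]; apply/funext => -[j J].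
rewrite /M /= !pair_delta.
have [->|ik] := eqVneq i k.
  by rewrite mulrA mulVf // !mul1r [k == j]eq_sym mulrCA.
rewrite (_ : p i = 0) ?mul0r ?mulr0 ?mul0r //.
by rewrite /p (bigD1 i) //= subrr mul0r.
Qed.

Lemma classical_perm_unit n (K0 L : idx N n) : perm_eq (iseq L) (iseq K0) ->
  E (fun I J => (I == K0)%:R * (J == L)%:R).
Proof.
move=> KL.
pose P s := forall K1 : idx N n, iseq K1 = s ->
  E (fun I J => (I == K1)%:R * (J == L)%:R).
suff : P (iseq K0) by apply.
apply: (@perm_swap_ind _ P _ _ _ KL) => [s a b t Ps K1 K1E|K1 /iseq_inj->]; last exact: classical_unit.
have := Ps _ (iseq_swp K1E) => /(classical_swp_row (size s)); congr (E _).
apply/funext => I; apply/funext => J.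
by rewrite (inj_eq (can_inj (@swpK n (size s)))).
Qed.
End Classical.

(** * Lifting from q = 1 to generic q *)

Section EtaMorphism.
Variable K : fieldType.

Lemma eta1 : eta (1 : Laurent K) = 1.
Proof. by apply: (@eta_const K 1 1); rewrite polyC1 tofrac1. Qed.
Lemma eta_zmod_morphism : zmod_morphism (@eta K).
Proof. by move=> a b; apply: (@addIr _ (eta b)); rewrite -etaD !subrK. Qed.
Lemma eta_monoid_morphism : monoid_morphism (@eta K).
Proof. by split; [apply: eta1 | apply: etaM]. Qed.
HB.instance Definition _ :=
  GRing.isZmodMorphism.Build (Laurent K) K (@eta K) eta_zmod_morphism.
HB.instance Definition _ :=
  GRing.isMonoidMorphism.Build (Laurent K) K (@eta K) eta_monoid_morphism.

Lemma lval_zmod_morphism : zmod_morphism (@lval K). Proof. by []. Qed.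
Lemma lval_monoid_morphism : monoid_morphism (@lval K). Proof. by []. Qed.
HB.instance Definition _ := GRing.isZmodMorphism.Build
  (Laurent K) {fraction {poly K}} (@lval K) lval_zmod_morphism.
HB.instance Definition _ := GRing.isMonoidMorphism.Build
  (Laurent K) {fraction {poly K}} (@lval K) lval_monoid_morphism.

Lemma laurent_const (c : K) : FracField.tofrac (c%:P : {poly K}) \in @laurent K.
Proof. by apply/asboolP; exists c%:P, 0%N; rewrite expr0 divr1. Qed.
Definition Lconst (c : K) : Laurent K := MkLaurent (laurent_const c).
Lemma eta_Lconst c : eta (Lconst c) = c. Proof. exact: eta_const. Qed.
End EtaMorphism.

Section OpsMorphism.
Variables (R R' : comPzRingType) (f : {rmorphism R -> R'}) (q : R) (N : nat).

Lemma map_op_head d n (M : idx N n -> idx N n -> R) I J :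
  f (op_head d M I J) = op_head (f \o d) (fun I J => f (M I J)) I J.
Proof. by rewrite /op_head !rmorphM rmorph_nat. Qed.
Lemma map_op_pre n (M : idx N n -> idx N n -> R) I J :
  f (op_pre M I J) = op_pre (fun I J => f (M I J)) I J.
Proof. by rewrite /op_pre rmorphM rmorph_nat. Qed.
Lemma map_op_tr n (M : idx N n.+1 -> idx N n.+1 -> R) I J :
  f (op_tr q M I J) = op_tr (f q) (fun I J => f (M I J)) I J.
Proof.
by rewrite /op_tr rmorph_sum; apply: eq_bigr => i _; rewrite rmorphM rmorphXn.
Qed.
Lemma map_mm (T : finType) (M P : T -> T -> R) I J :
  f (mm M P I J) = mm (fun I J => f (M I J)) (fun I J => f (P I J)) I J.
Proof. by rewrite /mm rmorph_sum; apply: eq_bigr => i _; rewrite rmorphM. Qed.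
Lemma map_hec n k (I J : idx N n) : f (hec q n k I J) = hec (f q) n k I J.
Proof.
elim: n k I J => [|n IHn] k I J; first exact: rmorph1.
case: k => [|k]; last by rewrite /= rmorphM rmorph_nat IHn.
case: n I J {IHn} => [|n] I J; first exact: rmorph_nat.
rewrite /= rmorphM rmorph_nat /rmat rmorphD !rmorphM !rmorph_nat rmorphMn.
by rewrite rmorphB rmorph1 !rmorphXn.
Qed.
End OpsMorphism.

Section WeightZero.
Variables (R : comPzRingType) (q : R) (N : nat).

(** Weight-zero matrices. Keeping the lifts in this class confines them to the span of the units
    E_KL with L a rearrangement of K, which makes the linear system in [ImM_unit] square. *)
Definition wt0 n (M : idx N n -> idx N n -> R) :=
  forall I J, ~~ perm_eq (iseq I) (iseq J) -> M I J = 0.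

Lemma wt0_head d n (M : idx N n -> idx N n -> R) : wt0 M -> wt0 (op_head d M).
Proof.
move=> M0 [i I] [j J] /=; rewrite /op_head /=; case: eqVneq => [->|_].
  by rewrite perm_cons => /M0 ->; rewrite mulr0.
by rewrite !mul0r.
Qed.

Lemma wt0_pre n (M : idx N n -> idx N n -> R) : wt0 M -> wt0 (op_pre M).
Proof.
move=> M0 I J; rewrite -(uncycK I) -(uncycK J) !iseq_cyc /op_pre !cycK /=.
rewrite perm_rcons perm_sym perm_rcons perm_sym.
case: eqVneq => [->|_]; last by rewrite mul0r.
by rewrite perm_cons => /M0 ->; rewrite mulr0.
Qed.

Lemma wt0_tr n (M : idx N n.+1 -> idx N n.+1 -> R) : wt0 M -> wt0 (op_tr q M).
Proof.
move=> M0 I J IJ; rewrite /op_tr big1 // => i _; rewrite M0 ?mulr0 //.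
by rewrite !iseq_cyc perm_rcons perm_sym perm_rcons perm_cons perm_sym.
Qed.

Lemma wt0_mm n (M P : idx N n -> idx N n -> R) : wt0 M -> wt0 P -> wt0 (mm M P).
Proof.
move=> M0 P0 I J IJ; rewrite /mm big1 // => L _.
have [IL|/M0->] := boolP (perm_eq (iseq I) (iseq L)); last by rewrite mul0r.
rewrite P0 ?mulr0 //; apply: contra IJ; exact: perm_trans.
Qed.

Lemma wt0_hec n k : wt0 (@hec R q N n k).
Proof.
elim: n k => [|n IHn] k; first by case; case.
case: k => [|k]; last first.
  move=> [i I] [j J] /=; case: eqVneq => [->|_]; last by rewrite mul0r.
  by rewrite perm_cons => /IHn ->; rewrite mulr0.
case: n {IHn} => [|n] I J /=; first by case: eqVneq => [->|//]; rewrite perm_refl.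
case: I J => [i1 [i2 I]] [j1 [j2 J]] /=.
have [->|_] := eqVneq I J; last by rewrite mulr0.
rewrite mulr1 /rmat /=.
have [[-> ->]|_] := eqVneq (i1, i2) (j2, j1).
  by rewrite -(cat1s j2) -(cat1s j1) (perm_catCA [:: j2] [:: j1] (iseq J)) perm_refl.
have [[-> ->]|_] := eqVneq (i2, i1) (j2, j1); first by rewrite perm_refl.
by rewrite !mul0r addr0.
Qed.
End WeightZero.

Section Lifting.
Variables (K : fieldType) (N : nat).
Local Notation L := (Laurent K).
Local Notation Kq := {fraction {poly K}}.
Local Notation q := (qfrac K).
Variables (B : pzAlgType Kq) (x y : 'I_N -> 'I_N -> B).
Hypotheses (xR : qrel q x) (xy : mm x y = mid) (yx : mm y x = mid).
Variable xi : 'I_N -> L.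
Hypothesis xi_inj : injective (fun i => eta (xi i)).
Variable Im : B -> Prop.
Hypotheses (ImD : forall u v, Im u -> Im v -> Im (u + v))
  (ImZ : forall a u, Im u -> Im (algmap a * u)) (Im1 : Im 1)
  (ImT : forall i j u, Im u ->
     Im (\sum_k algmap (lval (xi k)) * (y i k * u * x k j))).

Lemma Im_sum I r (P : pred I) (F : I -> B) :
  (forall i, P i -> Im (F i)) -> Im (\sum_(i <- r | P i) F i).
Proof.
move=> FI; elim/big_ind: _ => //.
by rewrite -[0](mul0r 1) -(rmorph0 (@algmap Kq B)); apply: ImZ.
Qed.

Local Notation lift M := (fun I J => lval (M I J)).

Definition ImM n (M : idx N n -> idx N n -> Kq) := forall I J, Im (Phi x y M I J).

(** Specializations of weight-zero matrices over K[q, q^-1] that [Phi] sends into the image. This is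
    the family E to which the results at q = 1 are applied. *)
Definition spec n (M0 : idx N n -> idx N n -> K) :=
  exists M : idx N n -> idx N n -> L,
    [/\ ImM (lift M), wt0 M & (fun I J => eta (M I J)) = M0].

Lemma qfracU : q \is a GRing.unit.
Proof. by rewrite unitfE qfrac_neq0. Qed.

Lemma spec_one : @spec 0 (fun _ _ => 1).
Proof.
exists (fun _ _ => 1); split=> [I J|I J|].
- rewrite PhiE !sum_idx0; case: I J => [] [].
  by rewrite /yw /xw /= mul1r mulr1 rmorph1.
- by case: I J => [] [].
- by apply/funext => I; apply/funext => J; apply: rmorph1.
Qed.

Lemma spec_add n (M P : idx N n -> idx N n -> K) :
  spec M -> spec P -> spec (fun I J => M I J + P I J).
Proof.
move=> [M' [MI M0 <-]] [P' [PI P0 <-]].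
exists (fun I J => M' I J + P' I J); split=> [I J|I J IJ|].
- rewrite -[Phi _ _ _ _ _]/(Phi x y (fun I J => lval (M' I J) + lval (P' I J)) I J).
  by rewrite PhiD; apply: ImD.
- by rewrite M0 ?P0 ?addr0.
- by apply/funext => I; apply/funext => J; rewrite rmorphD.
Qed.

Lemma spec_scale n c (M : idx N n -> idx N n -> K) :
  spec M -> spec (fun I J => c * M I J).
Proof.
move=> [M' [MI M0 <-]].
exists (fun I J => Lconst c * M' I J); split=> [I J|I J IJ|].
- rewrite -[Phi _ _ _ _ _]/(Phi x y (fun I J => lval (Lconst c) * lval (M' I J)) I J).
  by rewrite PhiZ; apply: ImZ.
- by rewrite M0 ?mulr0.
- by apply/funext => I; apply/funext => J; rewrite etaM eta_Lconst.
Qed.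

Lemma lval_fun n (M : idx N n -> idx N n -> L) (P : idx N n -> idx N n -> Kq) :
  (forall I J, lval (M I J) = P I J) -> lift M = P.
Proof. by move=> MP; apply/funext => I; apply/funext => J. Qed.

Lemma spec_head n (M : idx N n -> idx N n -> K) :
  spec M -> spec (op_head (fun i => eta (xi i)) M).
Proof.
move=> [M' [MI M0 <-]]; exists (op_head xi M'); split.
- rewrite (lval_fun (map_op_head (@lval K) xi M')) => -[i I] [j J].
  by rewrite Phi_head; apply: ImT; apply: MI.
- exact: wt0_head.
- by apply/funext => I; apply/funext => J; rewrite (map_op_head (@eta K)).
Qed.

Lemma spec_pre n (M : idx N n -> idx N n -> K) : spec M -> spec (op_pre M).
Proof.
move=> [M' [MI M0 <-]]; exists (op_pre M'); split.
- rewrite (lval_fun (map_op_pre (@lval K) M')) => I J.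
  rewrite -(uncycK I) -(uncycK J) (Phi_pre yx).
  by rewrite -(rmorph_nat (@algmap Kq B)); apply: ImZ; apply: MI.
- exact: wt0_pre.
- by apply/funext => I; apply/funext => J; rewrite (map_op_pre (@eta K)).
Qed.

Lemma spec_tr n (M : idx N n.+1 -> idx N n.+1 -> K) : spec M -> spec (op_tr 1 M).
Proof.
move=> [M' [MI M0 <-]]; exists (op_tr (qL K) M'); split.
- rewrite (lval_fun (map_op_tr (@lval K) (qL K) M')) => I J.
  rewrite (Phi_tr qfracU xR xy yx); apply: Im_sum => i _.
  by apply: ImZ; apply: MI.
- exact: wt0_tr.
- by apply/funext => I; apply/funext => J; rewrite (map_op_tr (@eta K)) -[X in op_tr X]/(eta (qL K)) eta_qL.
Qed.

Lemma spec_row n k (M : idx N n -> idx N n -> K) : spec M -> spec (mm (hec 1 n k) M).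
Proof.
move=> [M' [MI M0 <-]]; exists (mm (hec (qL K) n k) M'); split.
- rewrite (lval_fun (map_mm (@lval K) (hec (qL K) n k) M')).
  rewrite (lval_fun (map_hec (@lval K) (qL K) k)) => I J.
  rewrite (Phi_row xR xy yx); apply: Im_sum => I' _.
  by apply: ImZ; apply: MI.
- exact: wt0_mm (wt0_hec _ _) M0.
- apply/funext => I; apply/funext => J; rewrite (map_mm (@eta K)).
  congr (mm _ _ _ _); apply/funext => I'; apply/funext => J'.
  by rewrite (map_hec (@eta K)) -[X in hec X]/(eta (qL K)) eta_qL.
Qed.

Lemma spec_col n k (M : idx N n -> idx N n -> K) : spec M -> spec (mm M (hec 1 n k)).
Proof.
move=> [M' [MI M0 <-]]; exists (mm M' (hec (qL K) n k)); split.
- rewrite (lval_fun (map_mm (@lval K) M' (hec (qL K) n k))).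
  rewrite (lval_fun (map_hec (@lval K) (qL K) k)) => I J.
  rewrite (Phi_col _ xR); apply: Im_sum => I' _.
  by rewrite /cmat -algmapC; apply: ImZ; apply: MI.
- exact: wt0_mm M0 (wt0_hec _ _).
- apply/funext => I; apply/funext => J; rewrite (map_mm (@eta K)).
  congr (mm _ _ _ _); apply/funext => I'; apply/funext => J'.
  by rewrite (map_hec (@eta K)) -[X in hec X]/(eta (qL K)) eta_qL.
Qed.

Lemma Phi_sum n (T : finType) (c : T -> Kq) (M : T -> idx N n -> idx N n -> Kq) I J :
  Phi x y (fun I J => \sum_t c t * M t I J) I J
  = \sum_t algmap (c t) * Phi x y (M t) I J.
Proof.
elim: (index_enum T) => [|t r IHr].
  rewrite big_nil (_ : (fun _ _ => _) = (fun I J => 0 * (0 : Kq))).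
    by rewrite (PhiZ x y 0 (fun _ _ => 0)) rmorph0 mul0r.
  by apply/funext => I'; apply/funext => J'; rewrite big_nil mulr0.
rewrite big_cons -IHr -PhiZ -PhiD; congr (Phi x y _ I J).
by apply/funext => I'; apply/funext => J'; rewrite big_cons.
Qed.

(* The lifts of the matrix units form a square matrix over K[q, q^-1] which    *)
(* specializes to the identity at q = 1, hence is invertible over K(q).        *)
Lemma ImM_unit n (K0 L0 : idx N n) : perm_eq (iseq L0) (iseq K0) ->
  ImM (fun I J => (I == K0)%:R * (J == L0)%:R).
Proof.
move=> KL0.
pose T := {p : idx N n * idx N n | perm_eq (iseq p.2) (iseq p.1)}.
have Elift (p : T) : spec (fun I J => (I == (val p).1)%:R * (J == (val p).2)%:R).
  apply: (classical_perm_unit xi_inj spec_one spec_add spec_scale spec_head spec_pre spec_tr spec_row spec_col).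
  exact: (valP p).
pose M p := projT1 (cid (Elift p)).
have [MI M0 ME] : [/\ forall p, ImM (lift (M p)), forall p, wt0 (M p)
    & forall p I J, eta (M p I J) = (I == (val p).1)%:R * (J == (val p).2)%:R].
  split=> p; rewrite /M; case: cid => M' [? ? ME] //= I J.
  exact: (congr1 (fun P => P I J) ME).
(* Row a lists the coordinates of the lift numbered a with respect to the matrix units indexed by
   T. *)
pose G : 'M[L]_#|{: T}| := \matrix_(a, b) M (enum_val a) (val (enum_val b)).1 (val (enum_val b)).2.
have GE : map_mx (@eta K) G = 1%:M.
  apply/matrixP => a b; rewrite !mxE ME -pair_delta -!surjective_pairing.
  by rewrite (inj_eq val_inj) (inj_eq enum_val_inj) eq_sym.
pose G' : 'M[Kq]_#|{: T}| := map_mx (@lval K) G.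
have G'U : G' \in unitmx.
  rewrite unitmxE unitfE /G' det_map_mx.
  have : eta (\det G) != 0 by rewrite -det_map_mx GE det1 oner_eq0.
  apply: contra_neq => /(@val_inj _ _ L (\det G) 0) ->; exact: rmorph0.
pose t0 : 'I_#|{: T}| := enum_rank (Sub (K0, L0) KL0 : T).
(* Row t0 of the inverse of G' expresses the wanted unit through the lifts; at pairs outside T both
   sides vanish, by [M0]. *)
have U : (fun I J => (I == K0)%:R * (J == L0)%:R)
  = (fun I J => \sum_b invmx G' t0 b * lval (M (enum_val b) I J)).
  apply/funext => I; apply/funext => J.
  have [IJ|IJ] := boolP (perm_eq (iseq J) (iseq I)); last first.
    rewrite big1 => [|b _]; last first.
      by rewrite M0 1?perm_sym // rmorph0 mulr0.
    rewrite -pair_delta; case: eqP => // -[IK JL].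
    by rewrite IK JL KL0 in IJ.
  pose c : 'I_#|{: T}| := enum_rank (Sub (I, J) IJ : T).
  have cE : val (enum_val c) = (I, J) by rewrite enum_rankK SubK.
  transitivity ((invmx G' *m G') t0 c).
    rewrite mulVmx // mxE -pair_delta eq_sym.
    by rewrite (inj_eq enum_rank_inj) -(inj_eq val_inj) !SubK.
  by rewrite mxE; apply: eq_bigr => b _; rewrite !mxE cE.
rewrite U => I J; rewrite (Phi_sum _ (fun b => lift (M (enum_val b)))).
by apply: Im_sum => b _; apply: ImZ; apply: MI.
Qed.
End Lifting.

Local Open Scope classical_set_scope.

(** * The image of the co-orbit map *)

(** By linearity p(1) f is the sum of the p(chi_i) u_i for every polynomial p. Taking the chi_i
    different from 1 as the roots of p kills the unwanted terms and leaves p(1) nonzero. *)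
Lemma weight_separation (F : fieldType) (B : pzAlgType F) (I : eqType)
    (r : seq I)
    (u : I -> B) (chi : I -> F) (f : B) :
  (forall n, f = \sum_(i <- r) algmap (chi i ^+ n) * u i) ->
  f = \sum_(i <- r | chi i == 1) u i.
Proof.
move=> fE.
have pE (p : {poly F}) : algmap p.[1] * f = \sum_(i <- r) algmap p.[chi i] * u i.
  rewrite horner_coef rmorph_sum mulr_suml.
  under eq_bigr => n _ do rewrite expr1n mulr1 {1}(fE n) mulr_sumr.
  rewrite exchange_big; apply: eq_bigr => i _ /=.
  rewrite horner_coef rmorph_sum mulr_suml; apply: eq_bigr => n _.
  by rewrite mulrA -algmapM.
pose p : {poly F} := \prod_(i <- r | chi i != 1) ('X - (chi i)%:P).
have p1 : p.[1] != 0.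
  rewrite horner_prod; elim: r {fE pE p} => [|i r IHr].
    by rewrite big_nil oner_neq0.
  rewrite big_cons; case: ifP => // chi1; rewrite mulf_neq0 //.
  by rewrite hornerXsubC subr_eq0 eq_sym.
have pchi : \sum_(i <- r) algmap p.[chi i] * u i
          = algmap p.[1] * \sum_(i <- r | chi i == 1) u i.
  rewrite mulr_sumr (bigID (fun i => chi i == 1)) /= [X in _ + X]big1_seq ?addr0.
    by apply: eq_bigr => i /eqP ->.
  move=> i /andP[chi1 ir]; rewrite (_ : p.[chi i] = 0) ?rmorph0 ?mul0r //.
  by rewrite /p horner_prod (big_rem i) //= chi1 hornerXsubC subrr mul0r.
have := pE p; rewrite pchi => /(congr1 (fun w => algmap p.[1]^-1 * w)).
by rewrite !mulrA -!algmapM mulVf // algmap1 !mul1r.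
Qed.

Section Generic.
Variable K : fieldType.
Hypothesis charK : forall n, n.+1%:R != 0 :> K.
Local Notation q := (qfrac K).

Lemma qfracX n : q ^+ n = FracField.tofrac ('X^n : {poly K}).
Proof. by rewrite tofracXn. Qed.

Lemma qfrac_inj m n : q ^+ m = q ^+ n -> m = n.
Proof.
rewrite !qfracX => /eqP; rewrite tofrac_eq => /eqP /(congr1 (fun p : {poly K} => size p)).
by rewrite !size_polyXn => -[].
Qed.

Lemma qfrac2U : 1 + q ^+ 2 \is a GRing.unit.
Proof.
rewrite unitfE qfracX -tofrac1 -tofracD tofrac_eq0.
apply/eqP => /(congr1 (fun p : {poly K} => p`_0)).
by rewrite coefD coef1 coefXn coef0 addr0 => /eqP; rewrite oner_eq0.
Qed.

(** At q = 1 the sum counts the repetition-free words of length N, a positive integer and so nonzero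
    in K. *)
Lemma eps_normU N : eps_norm q N \is a GRing.unit.
Proof.
pose p (J : idx N N) : {poly K} := (uniq (iseq J))%:R * 'X^(2 * ninv (iseq J)).
have -> : eps_norm q N = FracField.tofrac (\sum_J p J).
  rewrite rmorph_sum; apply: eq_bigr => J _; rewrite /p /eps.
  case: (uniq _); last by rewrite mul0r rmorph0 expr0n.
  by rewrite mul1r; apply: etrans (qfracX _); rewrite -exprM mulnC exprM sqrrN exprM.
rewrite unitfE tofrac_eq0; apply/eqP => /(congr1 (fun p : {poly K} => p.[1])).
rewrite horner_sum horner0.
under eq_bigr => J _ do rewrite /p hornerM hornerXn expr1n mulr1 -mulr_natl mulr1 hornerMn hornerC.
have [J0 J0E] := iseq_surj_size (size_enum_ord N).
rewrite -natr_sum (bigD1 J0) //= J0E enum_uniq => /eqP; apply/negP.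
exact: charK.
Qed.

Variable N : nat.
Local Notation Kq := {fraction {poly K}}.
Local Notation OGL := (OGL q N).
Local Notation xGL := (@xGL _ q N).
Local Notation qU := (qfracU K).
Local Notation q2U := qfrac2U.
Variable y : 'I_N -> 'I_N -> OGL.
Hypotheses (xy : mm xGL y = mid) (yx : mm y xGL = mid).

Definition word (t : seq ('I_N * 'I_N) * seq ('I_N * 'I_N)) : OGL :=
  yprod y t.1 * xprod q t.2.

Lemma lspan_words (f : OGL) : exists r : seq (Kq * (seq ('I_N * 'I_N) * seq ('I_N * 'I_N))),
  f = \sum_(t <- r) algmap t.1 * word t.2.
Proof.
elim: (OGL_span qU q2U xy yx f) => [|u v _ [r ->] _ [s ->]|a _ [u [v ->]]].
- by exists [::]; rewrite big_nil.
- by exists (r ++ s); rewrite big_cat.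
- by exists [:: (a, (u, v))]; rewrite big_seq1.
Qed.

Definition cntl (k : 'I_N) (u : seq ('I_N * 'I_N)) := count_mem k [seq p.2 | p <- u].
Definition cntr (k : 'I_N) (u : seq ('I_N * 'I_N)) := count_mem k [seq p.1 | p <- u].

(** Points of the k-th one-parameter subgroup of the torus. They scale a word by the n-th power of a
    fixed element of K(q), the form required by [weight_separation]. *)
Definition one_param (k : 'I_N) (n : nat) (i : 'I_N) : Kq :=
  if i == k then q ^+ n else 1.

Lemma one_paramU k n i : one_param k n i \is a GRing.unit.
Proof. by rewrite /one_param; case: ifP; rewrite ?unitr1 // unitrX // qU. Qed.

Lemma torus_act_one_param k n t : torus_act (one_param k n) (word t)
  = algmap ((q ^+ cntr k t.2 / q ^+ cntl k t.1) ^+ n) * word t.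
Proof.
rewrite (torus_act_word qU q2U xy yx (one_paramU k n)); congr (algmap _ * _).
rewrite mulrC exprMn exprVn -!exprM; congr (_ * _).
  rewrite /cntr; elim: t.2 => [|p u IHu]; first by rewrite big_nil expr0.
  rewrite big_cons IHu /= /one_param mulnDl exprD.
  by case: (p.1 == k); rewrite ?mul1n ?mul0n.
rewrite /cntl; elim: t.1 => [|p u IHu]; first by rewrite big_nil expr0 invr1.
rewrite big_cons IHu /= /one_param mulnDl exprD invfM.
by case: (p.2 == k); rewrite ?mul1n ?mul0n // expr0 invr1.
Qed.

(** The letters k are treated one at a time: [weight_separation] discards the words in which k
    occurs unequally often among the column indices of the y's and the row indices of the x's,
    because distinct powers of q differ. *)
Lemma coinv_balanced (f : OGL) : Dcoact f = tpure 1 f ->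
  exists r : seq (Kq * (seq ('I_N * 'I_N) * seq ('I_N * 'I_N))),
  f = \sum_(t <- r | perm_eq [seq p.2 | p <- t.2.1] [seq p.1 | p <- t.2.2])
        algmap t.1 * word t.2.
Proof.
move=> fD; have [r rE] := lspan_words f; exists r.
pose bal k (t : Kq * (seq ('I_N * 'I_N) * seq ('I_N * 'I_N))) :=
  cntr k t.2.2 == cntl k t.2.1.
have filt (ks : seq 'I_N) :
    f = \sum_(t <- r | all (fun k => bal k t) ks) algmap t.1 * word t.2.
  elim: ks => [//|k ks IHks].
  rewrite [LHS](@weight_separation _ _ _ [seq t <- r | all (fun k => bal k t) ks]
    (fun t => algmap t.1 * word t.2)
    (fun t => q ^+ cntr k t.2.2 / q ^+ cntl k t.2.1)).
    rewrite big_filter_cond; apply: eq_bigl => t /=; rewrite andbC; congr (_ && _).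
    apply/eqP/eqP => [e|->]; last by rewrite divff // expf_neq0 // qfrac_neq0.
    apply: qfrac_inj; move: (congr1 (fun w => w * q ^+ cntl k t.2.1) e).
    by rewrite divfK ?mul1r // expf_neq0 // qfrac_neq0.
  move=> n; rewrite -{1}(torus_act_coinv (one_paramU k n) fD).
  rewrite {1}IHks -big_filter.
  rewrite (torus_act_sum qU q2U (one_paramU k n)); apply: eq_bigr => t _.
  by rewrite torus_act_one_param !mulrA -!algmapM [X in algmap X * _]mulrC.
rewrite {1}(filt (enum 'I_N)); apply: eq_bigl => t.
apply/allP/idP => [tb|tp k _].
  apply/allP => k _ /=; rewrite eq_sym; apply: tb; exact: mem_enum.
by rewrite /bal eq_sym /cntl /cntr; apply/eqP/seq.permP.
Qed.

Lemma xprod_zs v : xprod q v = zs xGL [seq p.1 | p <- v] [seq p.2 | p <- v].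
Proof.
rewrite /xprod; elim: v => [|p v IHv]; first by rewrite big_nil.
by rewrite big_cons IHv.
Qed.
Lemma yprod_zs u : yprod y u = zs y [seq p.1 | p <- u] [seq p.2 | p <- u].
Proof.
rewrite /yprod; elim: u => [|p v IHv]; first by rewrite big_nil.
by rewrite big_cons IHv.
Qed.

(** The column indices of the y's give K0, and the row indices of the x's, reversed to match [xw],
    give L0. *)
Lemma word_Phi t : perm_eq [seq p.2 | p <- t.1] [seq p.1 | p <- t.2] ->
  exists n (K0 L0 I0 J0 : idx N n), perm_eq (iseq L0) (iseq K0) /\
  word t = Phi xGL y (fun I J => (I == K0)%:R * (J == L0)%:R) I0 J0.
Proof.
case: t => u v /= uv; have uvn := perm_size uv; rewrite !size_map in uvn.
have [I0 I0E] : exists I : idx N (size u), iseq I = [seq p.1 | p <- u].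
  by apply: iseq_surj_size; rewrite size_map.
have [K0 K0E] : exists I : idx N (size u), iseq I = [seq p.2 | p <- u].
  by apply: iseq_surj_size; rewrite size_map.
have [J0 J0E] : exists I : idx N (size u), iseq I = rev [seq p.2 | p <- v].
  by apply: iseq_surj_size; rewrite size_rev size_map.
have [L0 L0E] : exists I : idx N (size u), iseq I = rev [seq p.1 | p <- v].
  by apply: iseq_surj_size; rewrite size_rev size_map.
exists (size u), K0, L0, I0, J0; split.
  by rewrite K0E L0E perm_rev perm_sym.
rewrite PhiE (bigD1 K0) //= [X in _ + X]big1 ?addr0 => [|K1 /negPf K1K]; last first.
  by rewrite big1 // => L1 _; rewrite K1K mul0r rmorph0 mul0r mulr0.
rewrite (bigD1 L0) //= [X in _ + X]big1 ?addr0 => [|L1 /negPf L1L]; last first.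
  by rewrite L1L mulr0 rmorph0 mul0r mulr0.
rewrite !eqxx mulr1 rmorph1 mul1r /word yprod_zs xprod_zs /xw /yw.
by rewrite I0E K0E J0E L0E !revK.
Qed.

Variable xi : 'M[Laurent K]_N.
Hypothesis xi_diag : is_diag_mx xi.
Hypothesis xi_inj : injective (fun i => eta (xi i i)).
Local Notation xiq := (map_mx (@lval K) xi).

Lemma xiq_diag : is_diag_mx xiq.
Proof.
apply/is_diag_mxP => i j ij; rewrite mxE.
by have /is_diag_mxP/(_ i j ij) -> := xi_diag.
Qed.

Lemma coorbit_image : range (coorbit q xiq) = D_coinvariants q N.
Proof.
have D := xiq_diag; apply/seteqP; split=> [_ [h _ <-]|f fD].
  exact: (coinvariant_Im qU q2U xy yx D h).
have [r ->] := coinv_balanced fD.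
have ImD := @Im_D _ _ _ qU q2U _ xy yx _ D.
have ImZ := @Im_Z _ _ _ qU q2U _ xy yx _ D.
have Im1 := @Im_1 _ _ _ qU q2U _ xy yx _ D.
have ImT (i j : 'I_N) u : range (coorbit q xiq) u -> range (coorbit q xiq)
    (\sum_k algmap (lval (xi k k)) * (y i k * u * xGL k j)).
  move=> /(Im_T qU q2U xy yx D i j).
  by under eq_bigr => k _ do rewrite mxE.
apply: (Im_sum ImD ImZ Im1) => t /word_Phi [n [K0 [L0 [I0 [J0 [KL ->]]]]]].
apply: (ImZ).
exact: (ImM_unit (xGL_qrel N qU) xy yx xi_inj ImD ImZ Im1 ImT KL).
Qed.
End Generic.

(** At a nonzero coordinate of an eigenvector the eigenvalue equals the diagonal entry. N distinct
    values among N diagonal entries leave no room for repetition. *)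
Lemma diag_eigenvalues_inj (F : fieldType) (N : nat) (M : 'M[F]_N) :
  is_diag_mx M -> distinct_eigenvalues M -> injective (fun i => M i i).
Proof.
move=> /is_diag_mxP MD [s [us sN sE]].
have sub : {subset s <= codom (fun i => M i i)}.
  move=> a /(allP sE)/eigenvalueP [v vM v0].
  have /rV0Pn [j vj] := v0; apply/codomP; exists j.
  have := congr1 (fun w : 'rV_N => w 0 j) vM; rewrite !mxE (bigD1 j) //= big1.
    by rewrite addr0 mulrC => /(mulIf vj) ->.
  by move=> k kj; rewrite MD ?mulr0.
apply/injectiveP; apply: (leq_size_uniq us sub).
by rewrite size_codom card_ord sN.
Qed.

Theorem theorem5p7 (R : realType) (S : pred R[i]) (K : subFieldType S)
    (N : nat) (xi : 'M[Laurent K]_N) :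
  (1 <= N)%N ->
  is_diag_mx xi ->
  is_point (qL K) xi ->
  distinct_eigenvalues (map_mx (@eta K) xi) ->
  range (coorbit (qfrac K) (map_mx (@lval K) xi)) =
    D_coinvariants (qfrac K) N.
Proof.
move=> _ xi_diag _ xi_ev.
have charK n : n.+1%:R != 0 :> K.
  rewrite -(inj_eq val_inj) rmorph_nat rmorph0.
  by rewrite Num.Theory.pnatr_eq0.
have [y [xy yx]] := xGL_inverse (qfracU K) (qfrac2U K) (eps_normU charK N).
apply: (coorbit_image xy yx xi_diag).
have D : is_diag_mx (map_mx (@eta K) xi).
  apply/is_diag_mxP => i j ij; rewrite mxE.
  by have /is_diag_mxP/(_ i j ij) -> := xi_diag; apply: rmorph0.
move=> i j /= e; apply: (diag_eigenvalues_inj D xi_ev).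
by rewrite /= !mxE.
Qed.
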